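(* Let $W=\frac1{\sqrt n}\sum_{i=1}^nX_i$, where $X_1,\dots,X_n$ are independent $d$-dimensional random vectors with $\mathbb{E}X_i=0$, $|X_i|\le\beta$ for all $i$, and $\mathbb{E}WW^{\rm T}=I_d$. Let $Z$ have the standard $d$-dimensional normal distribution. Then $$d_{\mathcal W}(\mathcal L(W),\mathcal L(Z))\le\frac{Cd\beta}{\sqrt n}(1+\log n)\qquad\text{and}\qquad d_{\mathcal W}(\mathcal L(W),\mathcal L(Z))\le\frac{Cd^2\beta}{\sqrt n},$$ where $C$ is an absolute constant.
   Context: $|\cdot|$ is the Euclidean norm. $d_{\mathcal W}(\mathcal L(W),\mathcal L(Z))=\sup_h|\mathbb{E}h(W)-\mathbb{E}h(Z)|$, the supremum over all $h:\mathbb{R}^d\to\mathbb{R}$ with $|h(x)-h(y)|\le|x-y|$ for all $x,y$. *)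

(* Defs.v *)
From HB Require Import structures.
From mathcomp Require Import all_boot all_order all_algebra.
From mathcomp Require Import all_classical all_reals all_analysis.
Set Implicit Arguments. Unset Strict Implicit. Unset Printing Implicit Defensive.
Import Order.TTheory GRing.Theory Num.Theory.
Import numFieldNormedType.Exports.
Local Open Scope classical_set_scope.
Local Open Scope ring_scope.

Definition enorm {R : realType} {d : nat} (v : 'I_d -> R) : R :=
  Num.sqrt (\sum_(k < d) v k ^+ 2).

Definition lipschitz1 {R : realType} {d : nat} (h : ('I_d -> R) -> R) : Prop :=
  forall x y, `|h x - h y| <= enorm (fun k => x k - y k).

Definition gen_sigma {dT} {T : measurableType dT} {R : realType} {d : nat}
  (Y : 'I_d -> T -> R) : set (set T) :=
  <<s [set A | exists k B, measurable B /\ A = Y k @^-1` B] >>.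

Definition indep_vectors {dT} {T : measurableType dT} {R : realType}
  (P : probability T R) {n d : nat} (X : 'I_n -> 'I_d -> T -> R) : Prop :=
  forall A : 'I_n -> set T, (forall i, gen_sigma (X i) (A i)) ->
    P (\bigcap_i A i) = (\prod_(i < n) P (A i))%E.

Definition Wsum {dT} {T : measurableType dT} {R : realType} {n d : nat}
  (X : 'I_n -> 'I_d -> T -> R) (x : T) : 'I_d -> R :=
  fun k => (Num.sqrt (n%:R))^-1 * \sum_(i < n) X i k x.

Definition std_normal_vector {dT} {T : measurableType dT} {R : realType}
  (Q : probability T R) {d : nat} (Z : 'I_d -> T -> R) : Prop :=
  [/\ forall k, measurable_fun setT (Z k),
      indep_vectors Q (fun k (_ : 'I_1) => Z k) &
      forall k (B : set R), measurable B ->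
        Q (Z k @^-1` B) = normal_prob 0 1 B].

Definition wasserstein {R : realType} {d : nat}
  {dT} {T : measurableType dT} (P : probability T R) (W : T -> 'I_d -> R)
  {dT'} {T' : measurableType dT'} (Q : probability T' R) (Z : T' -> 'I_d -> R)
  : \bar R :=
  ereal_sup [set `| (\int[P]_x (h (W x))%:E) - (\int[Q]_y (h (Z y))%:E) |%E
            | h in [set h | lipschitz1 h]].

(* Main.v *)
Require Import Defs.
From HB Require Import structures.
From mathcomp Require Import all_boot all_order all_algebra.
From mathcomp Require Import all_classical all_reals all_analysis.
From mathcomp Require Import measurable_realfun.
From mathcomp Require Import ring lra.
Set Implicit Arguments. Unset Strict Implicit. Unset Printing Implicit Defensive.
Import Order.TTheory GRing.Theory Num.Theory.
Import numFieldNormedType.Exports.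
Local Open Scope classical_set_scope.
Local Open Scope ring_scope.

(* For a Lipschitz h let sm s h be its convolution with the Gaussian law of covariance
   s^2 I. The mean of sm (sqrt v) h at sqrt(1-v) W goes from E h(W) at v = 0 to E h(Z) at
   v = 1. Up to third order terms, an increment of this mean compares the Laplacian and
   the drift term of an Ornstein-Uhlenbeck generator. Writing W = xi_i + W_i with
   independent parts, E xi_i = 0 and Cov W = I (Stein's identity), the difference is a sum
   of expectations E Phi(W_i), where Phi is a third derivative of the smoothed h times
   |xi_i|^3 <= (beta / sqrt n) |xi_i|^2.

   Bounding |Phi| pointwise by 1/v and integrating over v in [1/n, 1] gives the logarithm.
   For the bound without logarithm, let kappa be the supremum of the gap over 1-Lipschitz
   functions. Phi is Lipschitz with constant O(v^(-3/2)) and has Gaussian mean O(1), as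
   two smoothings at total scale about 1 have been applied; so
   |E Phi(W_i)| = O(1 + (kappa + delta) v^(-3/2)) with delta = beta / sqrt n.
   Integrating over [v0, 1] and choosing sqrt v0 proportional to d delta, the
   inequality for kappa closes up. *)

(** * One-dimensional Gaussian integrals *)

(** The obstacle is that [h] is only Lipschitz: its derivatives exist after smoothing at scale
    [sqrt v], and the third one blows up as [v] tends to 0. The path therefore starts at some
    [v0 > 0], at a cost of order [sqrt (d * v0)] that has to be balanced against the accumulated
    remainder. It also stops at some [v1 < 1], later sent to 1, because the square root in the scale
    [sqrt (1 - v)] is not Lipschitz at the end. Increments over steps of variance [e^2] are summed
    instead of differentiating along the path; their O(e^3) errors disappear when the mesh is
    refined.

    The two bounds share the whole argument except for one ingredient, the function [bet] that
    controls the mean of Phi at a leave-one-out sum.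

    No Gaussian measure on R^d is constructed: [gam] is any probability whose values on boxes are
    products of normal probabilities, and in the end it is the law of Z. One-dimensional Gaussian
    identities pass to it by redrawing one coordinate at a time. *)

Section image_measure.
Context d1 d2 (T1 : measurableType d1) (T2 : measurableType d2) (R : realType).
Variables (mu : {measure set T1 -> \bar R}) (f : T1 -> T2).
Hypothesis mf : measurable_fun setT f.

Definition image_measure : {measure set T2 -> \bar R} :=
  @measure_function_pushforward__canonical__measure_function_Measure
    _ _ _ _ _ mu f mf.

Lemma image_measureE A : image_measure A = mu (f @^-1` A). Proof. by []. Qed.

Lemma ge0_integral_image (F : T2 -> \bar R) : measurable_fun setT F ->
  (forall x, 0 <= F x)%E ->
  (\int[image_measure]_y F y = \int[mu]_x F (f x))%E.
Proof. by move=> mF F0; rewrite (ge0_integral_pushforward mf mu measurableT mF). Qed.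
End image_measure.

Section lebesgue_affine.
Variable R : realType.
Notation leb := (@lebesgue_measure R).
Local Open Scope ereal_scope.

Let aff (c t : R) : measurableTypeR R -> measurableTypeR R := fun x => (c * x + t)%R.

Let maff c t : measurable_fun setT (aff c t).
Proof. by apply: measurable_funD => //; exact: measurable_funM. Qed.

Lemma lebesgue_measure_affine (c t : R) (A : set R) : (0 < c)%R -> measurable A ->
  (c%:E * leb ((fun x => c * x + t)%R @^-1` A)) = leb A.
Proof.
move=> c0 mA; pose c' : {nonneg R} := NngNum (ltW c0).
suff : forall A, measurable A -> leb A = mscale c' (image_measure leb (maff c t)) A.
  by move=> /(_ _ mA) ->.
move=> {A mA}.
apply: lebesgue_measure_unique => _ [[a b]] _ <-/=.
rewrite /mscale/= image_measureE.
have -> : aff c t @^-1` `]a, b]%classic = [set` `](((a - t) / c)%R), (((b - t) / c)%R)]].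
  apply/seteqP; split => x /=; rewrite /aff !in_itv/=;
  by rewrite ler_pdivlMr// ltr_pdivrMr// lerBrDr ltrBlDr [(x * c)%R]mulrC.
rewrite lebesgue_measure_itv/= lte_fin.
rewrite (lebesgue_measure_itv (Interval (BRight ((a - t) / c)%R) (BRight ((b - t) / c)%R)))/= !lte_fin.
rewrite ltr_pM2r ?invr_gt0// ltrD2r.
case: ifPn => _; last by rewrite mule0.
rewrite -!EFinB -EFinM; congr EFin.
  by field; rewrite gt_eqF.
exact: maff.
Qed.

Lemma ge0_integral_affine (c t : R) (F : R -> \bar R) : (0 < c)%R ->
  measurable_fun setT F -> (forall x, 0 <= F x) ->
  \int[leb]_x F x = c%:E * \int[leb]_x F (c * x + t)%R.
Proof.
move=> c0 mF F0; pose c' : {nonneg R} := NngNum (ltW c0).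
transitivity (\int[mscale c' (image_measure leb (maff c t))]_x F x).
  apply: eq_measure_integral => A mA _; rewrite /= /mscale /=.
  exact/esym/lebesgue_measure_affine.
by rewrite ge0_integral_mscale//= ge0_integral_image.
Qed.
End lebesgue_affine.

Section density.
Context dT (T : measurableType dT) (R : realType).
Variable mu : {sigma_finite_measure set T -> \bar R}.
Variable nu : {finite_measure set T -> \bar R}.
Variable g : T -> R.
Hypothesis ig : mu.-integrable setT (EFin \o g).
Local Open Scope ereal_scope.
Hypothesis nuE : forall A, measurable A -> nu A = \int[mu]_(x in A) (g x)%:E.

Import Radon_Nikodym_SigmaFinite.

(** [g] and the Radon-Nikodym derivative of [nu] have the same integral over every measurable set,
    so they agree almost everywhere and the change of variables for the latter applies to [g]. *)
Lemma ge0_integral_density (f : T -> \bar R) : measurable_fun setT f ->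
  (forall x, 0 <= f x) -> \int[nu]_x f x = \int[mu]_x (f x * (g x)%:E).
Proof.
move=> mf f0.
have numu : nu `<< mu.
  apply/null_content_dominatesP => A mA muA0; rewrite nuE//.
  apply: null_set_integral => //.
  apply: measurable_funTS; exact: measurable_int ig.
rewrite -(change_of_variables numu)//.
have ifd := f_integrable numu.
apply: ae_eq_integral => //.
- apply: emeasurable_funM => //; exact: measurable_int ifd.
- apply: emeasurable_funM => //; exact: measurable_int ig.
- apply: ae_eqe_mul2l; apply: integral_ae_eq => //.
    exact: measurable_int ig.
  by move=> E _ mE; rewrite -nuE// -f_integral.
Qed.
End density.

Section normal1.
Variable R : realType.
Notation leb := (@lebesgue_measure R).
Notation g1 := (@normal_prob R 0 1).
Notation phi := (@normal_pdf R 0 1).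
Local Open Scope ereal_scope.

Lemma normal_pdf01E (x : R) : phi x = ((Num.sqrt (pi *+ 2))^-1 * expR (- x ^+ 2 / 2))%R.
Proof.
rewrite /normal_pdf oner_eq0 /normal_peak /normal_fun.
by rewrite expr1n mul1r subr0.
Qed.

(** Rotation invariance: the planar Gaussian density depends on the radius only. *)
Lemma normal_pdf01M (x y x' y' : R) : (x ^+ 2 + y ^+ 2 = x' ^+ 2 + y' ^+ 2)%R ->
  (phi x * phi y = phi x' * phi y')%R.
Proof.
move=> e; rewrite !normal_pdf01E mulrACA [RHS]mulrACA -!expRD; congr (_ * expR _)%R.
by rewrite -!mulrDl -!opprD e.
Qed.

Lemma ge0_integral_normal (f : R -> \bar R) : measurable_fun setT f ->
  (forall x, 0 <= f x) -> \int[g1]_x f x = \int[leb]_x (f x * (phi x)%:E).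
Proof.
move=> mf f0; apply: (@ge0_integral_density _ _ _ leb g1) => //.
exact: integrable_normal_pdf.
Qed.

Let mphi : measurable_fun setT phi.
Proof. exact: measurable_normal_pdf. Qed.

Let phi0 x : 0 <= (phi x)%:E.
Proof. by rewrite lee_fin normal_pdf_ge0. Qed.

(** The one-dimensional Cameron-Martin formula: translate the Lebesgue variable and complete the
    square in the exponent. *)
Lemma normal_shift (t : R) (f : R -> \bar R) : measurable_fun setT f ->
  (forall x, 0 <= f x) ->
  \int[g1]_y f (y + t)%R = \int[g1]_y (f y * (expR (t * y - t ^+ 2 / 2))%:E).
Proof.
move=> mf f0.
have mt : measurable_fun setT (fun y : R => y + t)%R by exact: measurable_funD.
have mE : measurable_fun setT (fun y : R => f y * (expR (t * y - t ^+ 2 / 2))%:E).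
  apply: emeasurable_funM => //; apply/measurable_EFinP/measurableT_comp => //.
  by apply: measurable_funB => //; exact: measurable_funM.
have E0 y : 0 <= f y * (expR (t * y - t ^+ 2 / 2))%:E.
  by rewrite mule_ge0// lee_fin expR_ge0.
rewrite !ge0_integral_normal//; last first.
  by apply: (measurableT_comp mf).
rewrite [RHS](@ge0_integral_affine _ 1 t)//; last 2 first.
- by apply: emeasurable_funM => //; exact/measurable_EFinP.
- by move=> x; rewrite mule_ge0.
rewrite mul1e; apply: eq_integral => y _; rewrite mul1r -muleA; congr (_ * _).
rewrite -EFinM; congr EFin; rewrite !normal_pdf01E mulrCA -expRD; congr (_ * expR _)%R.
by field.
Qed.

(** Stability of the normal law under independent sums, on the level of densities: a shear reduces
    the argument of [f] to [s1 * y], and a completed square integrates out [y']. *)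
Lemma normal_conv (s1 s2 : R) (f : R -> \bar R) : (0 < s1)%R -> measurable_fun setT f ->
  (forall x, 0 <= f x) ->
  \int[g1]_y' \int[g1]_y f (s1 * y + s2 * y')%R =
  \int[g1]_y f (Num.sqrt (s1 ^+ 2 + s2 ^+ 2) * y)%R.
Proof.
move=> s10 mf f0; pose t : R := (s2 / s1)%R; pose r : R := Num.sqrt (1 + t ^+ 2).
have r0 : (0 < r)%R by rewrite sqrtr_gt0 ltr_wpDr// sqr_ge0.
have r2 : (r ^+ 2 = 1 + t ^+ 2)%R by rewrite sqr_sqrtr// addr_ge0// sqr_ge0.
have -> : (Num.sqrt (s1 ^+ 2 + s2 ^+ 2) = s1 * r)%R.
  rewrite -[s1 in RHS]gtr0_norm// -sqrtr_sqr -sqrtrM ?sqr_ge0//; congr Num.sqrt.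
  by rewrite /t; field; rewrite gt_eqF.
have ml (a b : R) : measurable_fun setT (fun y : R => a * y + b)%R.
  by apply: measurable_funD => //; exact: measurable_funM.
have mfl (a b : R) : measurable_fun setT (fun y : R => f (a * y + b)%R).
  exact: (measurableT_comp mf).
have mpl (a b : R) : measurable_fun setT (fun y : R => (phi (a * y + b)%R)%:E).
  by apply/measurable_EFinP; exact: measurableT_comp.
have mfm (a : R) : measurable_fun setT (fun y : R => f (a * y)%R).
  by apply: (measurableT_comp mf); exact: measurable_funM.
have mpb (b : R) : measurable_fun setT (fun y : R => (phi (y - b))%:E).
  by apply/measurable_EFinP/measurableT_comp => //; exact: measurable_funB.
have mpm (a b : R) : measurable_fun setT (fun y : R => phi (a * (b * y))%R / r)%R.
  apply: measurable_funM; last exact: measurable_cst.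
  by apply: measurableT_comp => //; do 2 apply: measurable_funM => //.
have mpm1 (a : R) : measurable_fun setT (fun y : R => phi (a * y)%R / r)%R.
  apply: measurable_funM; last exact: measurable_cst.
  by apply: measurableT_comp => //; exact: measurable_funM.
have mphi2 : measurable_fun setT (fun z : R * R => f (s1 * z.1)%R * (phi (z.1 - t * z.2))%:E * (phi z.2)%:E).
  apply: emeasurable_funM.
    apply: emeasurable_funM.
      by apply: (measurableT_comp mf); exact: measurable_funM.
    apply/measurable_EFinP/measurableT_comp => //.
    by apply: measurable_funB => //; exact: measurable_funM.
  exact/measurable_EFinP/measurableT_comp.
transitivity (\int[leb]_y' \int[leb]_y (f (s1 * y)%R * (phi (y - t * y'))%:E * (phi y')%:E)).
  rewrite ge0_integral_normal//; last 2 first.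
  - apply: (@measurable_fun_fubini_tonelli_G _ _ _ _ _ g1 (fun z : R * R => f (s1 * z.1 + s2 * z.2)%R)) => //.
    apply: (measurableT_comp mf); apply: measurable_funD; exact: measurable_funM.
  - by move=> y'; apply: integral_ge0.
  apply: eq_integral => y' _.
  rewrite ge0_integral_normal//.
  rewrite -(@ge0_integralZr _ _ _ leb setT measurableT (fun y => f (s1 * y + s2 * y')%R * (phi y)%:E)); last 3 first.
  - by apply: emeasurable_funM; [exact: mfl|exact/measurable_EFinP].
  - by move=> y _; rewrite mule_ge0.
  - exact: phi0.
  - apply/esym; rewrite (@ge0_integral_affine _ 1 (t * y'))//; last 2 first.
    + apply: emeasurable_funM; last exact: measurable_cst.
      by apply: emeasurable_funM; [exact: mfm|exact: mpb].
    + by move=> x; rewrite !mule_ge0.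
    rewrite mul1e; apply: eq_integral => y _; congr (f _ * _%:E * _).
      by rewrite /t; field; rewrite gt_eqF.
    by congr normal_pdf; ring.
rewrite -(@fubini_tonelli _ _ _ _ _ leb leb (fun z : R * R => f (s1 * z.1)%R * (phi (z.1 - t * z.2))%:E * (phi z.2)%:E))//; last first.
  by move=> z; rewrite !mule_ge0.
transitivity (\int[leb]_y (f (s1 * y)%R * (phi (r^-1 * y) / r)%:E)).
  apply: eq_integral => y _; rewrite /fubini_F/=.
  under eq_integral do rewrite -muleA -EFinM.
  rewrite (@ge0_integralZl _ _ _ leb setT measurableT (fun x => (phi (y - t * x) * phi x)%:E))//; last 2 first.
  - apply/measurable_EFinP/measurable_funM => //; apply: measurableT_comp => //.
    by apply: measurable_funB => //; exact: measurable_funM.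
  - by move=> x _; rewrite lee_fin mulr_ge0 ?normal_pdf_ge0.
  congr (_ * _).
  (* Recentre at [t * y / r^2] and rescale by [1 / r], the conditional mean and deviation of the
     integrated variable given [y]; rotation invariance then separates the two densities. *)
  rewrite (@ge0_integral_affine _ r^-1 (t * y / r ^+ 2))//; last 3 first.
  - by rewrite invr_gt0.
  - apply/measurable_EFinP/measurable_funM => //; apply: measurableT_comp => //.
    by apply: measurable_funB => //; exact: measurable_funM.
  - by move=> x; rewrite lee_fin mulr_ge0 ?normal_pdf_ge0.
  rewrite [in RHS]mulrC [in RHS]EFinM; congr (_ * _).
  under eq_integral.
    move=> x _.
    rewrite (@normal_pdf01M _ _ (r^-1 * y)%R x).
      rewrite EFinM; over.
    have -> : (r^-1 * x + t * y / r ^+ 2 = (r * x + t * y) / r ^+ 2)%R.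
      by field; rewrite gt_eqF.
    have -> : ((r^-1 * y) ^+ 2 + x ^+ 2 = (y ^+ 2 + r ^+ 2 * x ^+ 2)/ r ^+ 2)%R.
      by field; rewrite gt_eqF.
    apply: (@mulIf _ (r ^+ 2 * r ^+ 2)); first by rewrite !mulf_neq0 ?gt_eqF ?exprn_gt0.
    have r2n : (r ^+ 2 != 0)%R by rewrite gt_eqF// exprn_gt0.
    transitivity ((y * r ^+ 2 - t * (r * x + t * y)) ^+ 2 + (r * x + t * y) ^+ 2)%R.
      by field; rewrite gt_eqF.
    transitivity ((y ^+ 2 + r ^+ 2 * x ^+ 2) * r ^+ 2)%R; last first.
      by field; rewrite gt_eqF.
    by rewrite r2; ring: r2.
  rewrite ge0_integralZl//; last by apply/measurable_EFinP.
  by rewrite integral_normal_pdf mule1.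
rewrite (@ge0_integral_affine _ r 0)//; last 2 first.
- apply: emeasurable_funM; first exact: mfm.
  by apply/measurable_EFinP; exact: mpm1.
- by move=> x; rewrite mule_ge0// lee_fin mulr_ge0 ?normal_pdf_ge0// invr_ge0 ltW.
rewrite ge0_integral_normal//.
rewrite -(@ge0_integralZl _ _ _ leb setT measurableT (fun y => f (s1 * (r * y + 0))%R * (phi (r^-1 * (r * y + 0)) / r)%:E))//; last 3 first.
- apply: emeasurable_funM; first by under eq_fun do rewrite addr0 mulrA; exact: mfm.
  by apply/measurable_EFinP; under eq_fun do rewrite addr0; exact: mpm.
- by move=> x _; rewrite mule_ge0// lee_fin mulr_ge0 ?normal_pdf_ge0// invr_ge0 ltW.
- by rewrite lee_fin ltW.
apply: eq_integral => y _; rewrite addr0 mulKf ?gt_eqF// mulrA muleCA; congr (_ * _).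
by rewrite -EFinM; congr EFin; rewrite mulrC divfK// gt_eqF.
Qed.
End normal1.

(** * Gaussian vectors *)

Section vec_measurable.
Variables (R : realType) (d : nat).

Let coord (k : 'I_d) (x : 'I_d -> R) : R := x k.
Let coord_sets : set (set ('I_d -> R)) := [set A | exists k B, measurable B /\ A = coord k @^-1` B].

Let vec_set0 : <<s coord_sets >> set0. Proof. exact: sigma_algebra0. Qed.
Let vec_setC A : <<s coord_sets >> A -> <<s coord_sets >> (~` A).
Proof. exact: sigma_algebraC. Qed.
Let vec_bigcup (F : (set ('I_d -> R))^nat) : (forall i, <<s coord_sets >> (F i)) ->
  <<s coord_sets >> (\bigcup_i (F i)).
Proof. exact: sigma_algebra_bigcup. Qed.

HB.instance Definition _ := @isMeasurable.Build (measure_tuple_display (R.-ocitv.-measurable).-sigma)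
  ('I_d -> R) <<s coord_sets >> vec_set0 vec_setC vec_bigcup.

Lemma measurable_coord (k : 'I_d) : measurable_fun setT (fun x : 'I_d -> R => x k).
Proof.
move=> _ B mB; rewrite setTI; apply: sub_sigma_algebra.
by exists k, B.
Qed.

Lemma measurable_vecP dS (S : measurableType dS) (f : S -> 'I_d -> R) :
  measurable_fun setT f <-> (forall k, measurable_fun setT (fun s => f s k)).
Proof.
split=> [mf k|mf]; first exact: (measurableT_comp (measurable_coord k) mf).
apply: (@measurability _ _ _ _ _ _ coord_sets) => // _ [_ [k [B [mB ->]]] <-].
exact: (mf k).
Qed.

Definition box (B : 'I_d -> set R) : set ('I_d -> R) := [set x | forall k, B k (x k)].

Lemma box_bigcap B : box B = \bigcap_(k in [set: 'I_d]) ((fun x : 'I_d -> R => x k) @^-1` B k).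
Proof. by apply/seteqP; split => x /= h k; [move=> _; exact: h|exact: (h k I)]. Qed.

Lemma measurable_box B : (forall k, measurable (B k)) -> measurable (box B).
Proof.
move=> mB; rewrite box_bigcap; apply: fin_bigcap_measurable => // k _.
rewrite -[X in measurable X]setTI; exact: measurable_coord.
Qed.

(** Boxes are a pi-system that generates the sigma-algebra of the coordinates. Laws on R^d are
    identified through this. *)
Lemma vec_measure_unique (m1 m2 : {measure set ('I_d -> R) -> \bar R}) :
  (m1 setT < +oo)%E ->
  (forall B, (forall k, measurable (B k)) -> m1 (box B) = m2 (box B)) ->
  forall A, measurable A -> m1 A = m2 A.
Proof.
move=> m1fin m12; pose G := [set A | exists2 B, (forall k, measurable (B k)) & A = box B].
have GT : G setT by exists (fun=> setT) => //; apply/seteqP; split.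
apply: (@measure_unique _ _ _ G (fun=> setT)) => //.
- apply/seteqP; split => A.
    apply: smallest_sub; first exact: smallest_sigma_algebra.
    move=> _ [k [B [mB ->]]]; apply: sub_sigma_algebra.
    exists (fun j => if j == k then B else setT).
      by move=> j; case: ifP.
    apply/seteqP; split => x /=; first by move=> Bx j; case: ifP => // /eqP ->.
    by move=> /(_ k); rewrite eqxx.
  apply: smallest_sub; first exact: sigma_algebra_measurable.
  by move=> _ [B mB ->]; exact: measurable_box.
- move=> _ _ [B mB ->] [B' mB' ->]; exists (fun k => B k `&` B' k).
    by move=> k; exact: measurableI.
  apply/seteqP; split => x /=; first by move=> [h h'] k; split.
  by move=> h; split=> k; case: (h k).
- exact: bigcup_const.
- by move=> _ [B mB ->]; exact: m12.
Qed.

End vec_measurable.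

Section vec.
Variables (R : realType) (d : nat).
Implicit Types (x y u v : 'I_d -> R) (c L : R).

Definition dot u v : R := \sum_k u k * v k.

Lemma dotC u v : dot u v = dot v u.
Proof. by apply: eq_bigr => k _; rewrite mulrC. Qed.

Lemma dotDl u v w : dot (u + v) w = dot u w + dot v w.
Proof. by rewrite /dot -big_split; apply: eq_bigr => k _; exact: mulrDl. Qed.

Lemma dotZl c u v : dot (c *: u) v = c * dot u v.
Proof. by rewrite /dot mulr_sumr; apply: eq_bigr => k _; rewrite mulrA. Qed.

Lemma dotDr u v w : dot w (u + v) = dot w u + dot w v.
Proof. by rewrite dotC dotDl ![dot w _]dotC. Qed.

Lemma dotZr c u v : dot u (c *: v) = c * dot u v.
Proof. by rewrite dotC dotZl dotC. Qed.

Lemma dot_ge0 u : 0 <= dot u u.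
Proof. by apply: sumr_ge0 => k _; rewrite -expr2 sqr_ge0. Qed.

Lemma enorm_ge0 u : 0 <= enorm u. Proof. exact: sqrtr_ge0. Qed.

Lemma enorm_sqr u : enorm u ^+ 2 = dot u u.
Proof.
rewrite /enorm sqr_sqrtr; last by apply: sumr_ge0 => k _; rewrite sqr_ge0.
by apply: eq_bigr => k _; rewrite expr2.
Qed.

Lemma dot_le u v : `|dot u v| <= enorm u * enorm v.
Proof.
rewrite -ler_sqr ?nnegrE ?mulr_ge0 ?enorm_ge0// real_normK ?num_real//.
rewrite exprMn !enorm_sqr.
have [v0|v0] := eqVneq (dot v v) 0.
  have vk k : v k = 0.
    apply/eqP; rewrite -sqrf_eq0; apply/eqP.
    have /psumr_eq0P : forall i, true -> 0 <= v i * v i by move=> i _; rewrite -expr2 sqr_ge0.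
    by move=> /(_ v0 k isT); rewrite expr2.
  rewrite v0 mulr0 (_ : dot u v = 0) ?expr0n//.
  by apply: big1 => k _; rewrite vk mulr0.
have vp : 0 < dot v v by rewrite lt_neqAle eq_sym v0 dot_ge0.
(* The squared norm of this vector is [dot v v] times the Gram determinant of [u] and [v]. *)
have := dot_ge0 (dot v v *: u + (- dot u v) *: v).
have -> : dot (dot v v *: u + (- dot u v) *: v) (dot v v *: u + (- dot u v) *: v) =
    dot v v * (dot u u * dot v v - dot u v ^+ 2).
  by rewrite !(dotDl, dotDr, dotZl, dotZr) [dot v u]dotC; ring.
by rewrite pmulr_rge0// subr_ge0.
Qed.

Lemma enormZ c u : enorm (c *: u) = `|c| * enorm u.
Proof.
apply: (pexpIrn (n := 2)) => //; rewrite ?nnegrE ?mulr_ge0 ?enorm_ge0//.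
by rewrite exprMn !enorm_sqr dotZl dotZr real_normK ?num_real// mulrA expr2.
Qed.

Lemma enormN u : enorm (- u) = enorm u.
Proof. by rewrite -scaleN1r enormZ normrN1 mul1r. Qed.

Lemma enorm0 : enorm (0 : 'I_d -> R) = 0.
Proof. by rewrite -(scale0r 0) enormZ normr0 mul0r. Qed.

Lemma enormD u v : enorm (u + v) <= enorm u + enorm v.
Proof.
rewrite -ler_sqr ?nnegrE ?addr_ge0 ?enorm_ge0// sqrrD !enorm_sqr !(dotDl, dotDr).
have := dot_le u v; rewrite ler_norml => /andP[_].
by rewrite [dot v u]dotC; lra.
Qed.

Lemma enormB u v : enorm (u - v) = enorm (v - u).
Proof. by rewrite -enormN opprB. Qed.

Lemma coord_le_enorm u k : `|u k| <= enorm u.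
Proof.
rewrite -ler_sqr ?nnegrE ?enorm_ge0// real_normK ?num_real// enorm_sqr /dot (bigD1 k)//=.
by rewrite expr2 lerDl sumr_ge0// => i _; rewrite -expr2 sqr_ge0.
Qed.

(** Growth is measured in the l1 norm because [expR (c * norm1 z)] is a product over the
    coordinates, so its Gaussian expectation factorises. *)
Definition norm1 u : R := \sum_k `|u k|.

Lemma norm1_ge0 u : 0 <= norm1 u. Proof. exact: sumr_ge0. Qed.

Lemma norm1D u v : norm1 (u + v) <= norm1 u + norm1 v.
Proof. by rewrite /norm1 -big_split; apply: ler_sum => k _; exact: ler_normD. Qed.

Lemma norm1Z c u : norm1 (c *: u) = `|c| * norm1 u.
Proof. by rewrite /norm1 mulr_sumr; apply: eq_bigr => k _; rewrite -normrM. Qed.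

Lemma enorm_le_norm1 u : enorm u <= norm1 u.
Proof.
rewrite -ler_sqr ?nnegrE ?norm1_ge0 ?enorm_ge0// enorm_sqr expr2 /dot /norm1 mulr_suml.
apply: ler_sum => k _; rewrite (le_trans (ler_norm _))// normrM ler_wpM2l//.
by rewrite (bigD1 k)//= lerDl sumr_ge0.
Qed.

Definition lip L (h : ('I_d -> R) -> R) := forall x y, `|h x - h y| <= L * enorm (x - y).

Lemma measurable_enorm : measurable_fun setT (@enorm R d).
Proof.
rewrite /enorm; apply: (@measurableT_comp _ _ _ _ _ _ (@Num.sqrt R : R -> R) _ (fun v : 'I_d -> R => \sum_k v k ^+ 2)).
  by apply: continuous_measurable_fun; exact: sqrt_continuous.
by apply: measurable_sum => k; apply: measurable_funX; exact: measurable_coord.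
Qed.

Lemma measurable_vec_scale c : measurable_fun setT (fun z : 'I_d -> R => c *: z).
Proof. by apply/measurable_vecP => k; apply: measurable_funM => //; exact: measurable_coord. Qed.

Lemma measurable_vecD dS (S : measurableType dS) (f g : S -> 'I_d -> R) :
  measurable_fun setT f -> measurable_fun setT g -> measurable_fun setT (fun s => f s + g s).
Proof.
move=> /measurable_vecP mf /measurable_vecP mg; apply/measurable_vecP => k.
exact: measurable_funD.
Qed.

Lemma measurable_vecZ dS (S : measurableType dS) (f : S -> 'I_d -> R) (c : R) :
  measurable_fun setT f -> measurable_fun setT (fun s => c *: f s).
Proof. move=> mf; exact: (measurableT_comp (measurable_vec_scale c)). Qed.

(* A Lipschitz [h] is the pointwise infimum, over rational vectors [q], of the
   cones [h q + L |x - q|]. *)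
Lemma lip_measurable L h : lip L h -> measurable_fun setT h.
Proof.
move=> hL.
pose q (n : nat) : 'I_d -> R := fun k => ratr ((odflt [ffun=> 0] (@unpickle {ffun 'I_d -> rat} n)) k).
pose g n x := h (q n) + L * enorm (x - q n).
have mg n : measurable_fun setT (g n).
  apply: measurable_funD => //; apply: measurable_funM => //.
  apply: (measurableT_comp measurable_enorm).
  by apply: measurable_vecD => //; exact: measurable_id.
apply: (measurability _ (RGenInftyO.measurableE R)) => // _ [_ [c ->] <-].
rewrite setTI (_ : _ @^-1` _ = \bigcup_n (setT `&` g n @^-1` `]-oo, c[)); last first.
  apply/seteqP; split => x /=; rewrite in_itv/=.
    (* With this [e], the cone of a rational vector within [e] of [x] in each coordinate still lies
       below [c] at [x]. *)
    move=> hxc; pose e := (c - h x) / (2 * (`|L| + 1) * d.+1%:R).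
    have e0 : 0 < e by rewrite divr_gt0 ?subr_gt0// !mulr_gt0// ltr_wpDl.
    have [r rP] : exists r : {ffun 'I_d -> rat}, forall k, `|x k - ratr (r k)| < e.
      have ex k : exists r : rat, `|x k - ratr r| < e.
        have [r] := @rat_in_itvoo R (x k - e) (x k + e) ltac:(lra).
        by rewrite in_itv/= => /andP[h1 h2]; exists r; rewrite ltr_norml; apply/andP; split; lra.
      have [f fP] := choice ex; exists [ffun k => f k] => k.
      by rewrite ffunE.
    exists (pickle r) => //=; split => //; rewrite in_itv/= /g.
    have -> : q (pickle r) = fun k => ratr (r k).
      by rewrite /q pickleK.
    set y : 'I_d -> R := fun k => ratr (r k).
    have ny : enorm (x - y) <= d%:R * e.
      apply: (le_trans (enorm_le_norm1 _)).
      rewrite -[X in X%:R * _]card_ord -sumr_const mulr_suml.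
      by apply: ler_sum => k _; rewrite mul1r ltW// rP.
    have := hL y x; rewrite enormB ler_norml => /andP[_ hyx].
    have Ln : L * enorm (x - y) <= (`|L| + 1) * (d%:R * e).
      apply: (@le_trans _ _ ((`|L| + 1) * enorm (x - y))).
        by rewrite ler_wpM2r ?enorm_ge0// (le_trans (ler_norm _))// lerDl.
      by rewrite ler_wpM2l// addr_ge0.
    have : 2 * ((`|L| + 1) * (d%:R * e)) < c - h x.
      have -> : c - h x = 2 * ((`|L| + 1) * (d.+1%:R * e)).
        by rewrite /e; field; rewrite !gt_eqF// ltr_wpDl.
      by rewrite ltr_pM2l// ltr_pM2l ?ltr_wpDl// ltr_pM2r// ltr_nat.
    lra.
  move=> [n _ [_]]; rewrite /= in_itv/= /g => gc.
  rewrite (le_lt_trans _ gc)//.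
  have := hL x (q n); rewrite ler_norml => /andP[_]; lra.
apply: bigcup_measurable => n _; apply: mg => //; exact: measurable_itv.
Qed.
End vec.

Definition upd (R : realType) d (k : 'I_d) (z : 'I_d -> R) (y : R) : 'I_d -> R :=
  fun j => if j == k then y else z j.

Lemma measurable_upd (R : realType) d (k : 'I_d) :
  measurable_fun setT (fun z : ('I_d -> R) * R => upd k z.1 z.2).
Proof.
apply/measurable_vecP => j; rewrite /upd; case: (j == k); first exact: measurable_snd.
exact: (measurableT_comp (measurable_coord j) measurable_fst).
Qed.

Lemma integral_cst_prob dT (T : measurableType dT) (R : realType) (P : probability T R) (r : \bar R) :
  (\int[P]_x r = r)%E.
Proof. by rewrite integral_cst// [X in (_ * X)%E]probability_setT mule1. Qed.

Section gauss.
Variables (R : realType) (d : nat) (gam : probability ('I_d -> R) R).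
Notation g1 := (@normal_prob R 0 1).
Hypothesis gam_box : forall B : 'I_d -> set R, (forall k, measurable (B k)) ->
  gam (box B) = (\prod_k g1 (B k))%E.
Local Open Scope ereal_scope.

(** Redrawing one coordinate from the normal law preserves [gam]. This stands in for an iterated
    integral over the coordinates and carries one-dimensional identities to R^d. *)
Lemma ge0_resample k (F : ('I_d -> R) -> \bar R) : measurable_fun setT F ->
  (forall z, 0 <= F z) ->
  \int[gam]_z F z = \int[gam]_z \int[g1]_y F (upd k z y).
Proof.
move=> mF F0; have mu := @measurable_upd R d k.
transitivity (\int[image_measure (gam \x g1) mu]_z F z).
  apply: eq_measure_integral => A mA _.
  apply: (@vec_measure_unique R d gam (image_measure (gam \x g1) mu)) => //.
    by apply: (le_lt_trans (probability_le1 gam measurableT)); rewrite ltry.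
  move=> B mB; rewrite image_measureE.
  have -> : (fun z : ('I_d -> R) * R => upd k z.1 z.2) @^-1` box B =
      box (fun j => if j == k then setT else B j) `*` B k.
    apply/seteqP; split=> -[z y]/=.
      rewrite /upd => h; split=> [j|]; last by have := h k; rewrite /= eqxx.
      by have := h j; rewrite /=; case: ifP.
    move=> [h hy] j; rewrite /upd/=; case: eqP => [->//|/eqP/negbTE jk].
    by have := h j; rewrite /= jk.
  have mB' : measurable (box (fun j => if j == k then setT else B j)).
    by apply: measurable_box => j; case: ifP.
  have H := product_measure1E gam g1 mB' (mB k). refine (etrans _ (esym H)).
  have mBk j : measurable (if j == k then setT else B j) by case: ifP.
  refine (etrans (gam_box mB) (esym (etrans (congr1 (fun x => x * g1 (B k)) (gam_box mBk)) _))).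
  rewrite (bigD1 k)//= [in RHS](bigD1 k)//= eqxx probability_setT mul1e muleC.
  by congr (_ * _); apply: eq_bigr => j /negbTE ->.
rewrite ge0_integral_image// fubini_tonelli1//; last exact: (measurableT_comp mF mu).
Qed.

Lemma ge0_prod_expectation (f : 'I_d -> R -> \bar R) (s : seq 'I_d) : uniq s ->
  (forall k, measurable_fun setT (f k)) -> (forall k y, 0 <= f k y) ->
  \int[gam]_z (\prod_(k <- s) f k (z k)) = \prod_(k <- s) \int[g1]_y f k y.
Proof.
move=> + mf f0; elim: s => [_|a s IH /= /andP[as_ us]].
  under eq_integral do rewrite big_nil.
  by rewrite integral_cst_prob big_nil.
have mP (t : seq 'I_d) : measurable_fun setT (fun z : 'I_d -> R => \prod_(k <- t) f k (z k)).
  elim: t => [|b t IHt]; first by under eq_fun do rewrite big_nil; exact: measurable_cst.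
  under eq_fun do rewrite big_cons; apply: emeasurable_funM => //.
  exact: (measurableT_comp (mf b) (measurable_coord b)).
have P0 (t : seq 'I_d) z : 0 <= \prod_(k <- t) f k (z k) by apply: prode_ge0 => k _.
rewrite (ge0_resample a)//.
transitivity (\int[gam]_z ((\int[g1]_y f a y) * \prod_(k <- s) f k (z k))).
  apply: eq_integral => z _.
  rewrite -(@ge0_integralZr _ _ _ g1 setT measurableT (f a) (mf a) _ (fun y _ => f0 a y) (P0 s z)).
  apply: eq_integral => y _; rewrite big_cons /upd eqxx; congr (_ * _).
  apply: eq_big_seq => k ks; case: eqP => // ka.
  by move: as_; rewrite -ka ks.
rewrite ge0_integralZl//; last by apply: integral_ge0 => y _.
by rewrite IH// big_cons.
Qed.

(** The shift formula for the constant 1 is exactly this moment generating function. *)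
Lemma normal_exp (t : R) : \int[g1]_y (expR (t * y))%:E = (expR (t ^+ 2 / 2))%:E.
Proof.
have mE : measurable_fun setT (fun y : R => (expR (t * y))%:E).
  by apply/measurable_EFinP/measurableT_comp => //; exact: measurable_funM.
have := @normal_shift R t (cst 1) (measurable_cst _) (fun=> lee01).
rewrite /= integral_cst_prob.
under eq_integral do rewrite mul1e expRD mulrC EFinM.
have e0 (x : R) : 0 <= (expR x)%:E by rewrite lee_fin expR_ge0.
rewrite (@ge0_integralZl _ _ _ g1 setT measurableT (fun y => (expR (t * y))%:E) mE _ (fun y _ => e0 _) (e0 _)).
move=> /(congr1 (fun x => (expR (t ^+ 2 / 2))%:E * x)).
by rewrite mule1 muleA -EFinM -expRD subrr expR0 mul1e => ->.
Qed.

Lemma gauss_exp_norm1 (c : R) : \int[gam]_z (expR (c * norm1 z))%:E < +oo.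
Proof.
have mE (a : R) : measurable_fun setT (fun y : R => (expR (a * y))%:E).
  by apply/measurable_EFinP/measurableT_comp => //; exact: measurable_funM.
have mE' : measurable_fun setT (fun y : R => (expR (c * `|y|))%:E).
  apply/measurable_EFinP/measurableT_comp => //; apply: measurable_funM => //.
have -> : \int[gam]_z (expR (c * norm1 z))%:E =
   \int[gam]_z \prod_(k <- index_enum 'I_d) (expR (c * `|z k|))%:E.
  by apply: eq_integral => z _; rewrite prodEFin -expR_sum mulr_sumr.
rewrite (@ge0_prod_expectation (fun k y => (expR (c * `|y|))%:E)); last 3 first.
- exact: index_enum_uniq.
- by [].
- by move=> k y; rewrite lee_fin expR_ge0.
have fin : \int[g1]_y (expR (c * `|y|))%:E < +oo.
  apply: (@le_lt_trans _ _ (\int[g1]_y ((expR (c * y))%:E + (expR (- c * y))%:E))).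
    apply: ge0_le_integral => //.
    - by apply: emeasurable_funD; exact: mE.
    - move=> y _; rewrite -EFinD lee_fin; have [y0|y0] := ger0P y.
        by rewrite lerDl expR_ge0.
      by rewrite mulrN mulNr lerDr expR_ge0.
  rewrite ge0_integralD//; try exact: mE.
  by rewrite !normal_exp -EFinD ltry.
suff H (s : seq 'I_d) : \prod_(k <- s) \int[g1]_y (expR (c * `|y|))%:E < +oo by exact: H.
elim: s => [|a s IH]; first by rewrite big_nil ltry.
rewrite big_cons lte_mul_pinfty//; first by apply: integral_ge0 => y _; rewrite lee_fin expR_ge0.
by rewrite ge0_fin_numE// integral_ge0// => y _; rewrite lee_fin expR_ge0.
Qed.

(** Induction on the list of shifted coordinates, [bs s] being [b] cut down to those in [s]: each
    step redraws one coordinate and applies [normal_shift] to it. *)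
Lemma ge0_cameron_martin (b : 'I_d -> R) (F : ('I_d -> R) -> \bar R) : measurable_fun setT F ->
  (forall z, 0 <= F z) ->
  \int[gam]_z F (z + b)%R = \int[gam]_z (F z * (expR (dot b z - dot b b / 2))%:E).
Proof.
move=> mF F0.
pose S (s : seq 'I_d) (z : 'I_d -> R) : R := (\sum_(k <- s) (b k * z k - b k ^+ 2 / 2))%R.
pose bs (s : seq 'I_d) : 'I_d -> R := fun k => if k \in s then b k else 0%R.
have mS s : measurable_fun setT (fun z => (expR (S s z))%:E).
  apply/measurable_EFinP/measurableT_comp => //; apply: measurable_sum => k.
  by apply: measurable_funB => //; apply: measurable_funM => //; exact: measurable_coord.
suff H s : uniq s -> forall F : ('I_d -> R) -> \bar R, measurable_fun setT F ->
    (forall z, 0 <= F z) ->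
    \int[gam]_z F (z + bs s)%R = \int[gam]_z (F z * (expR (S s z))%:E).
  have bE : bs (index_enum 'I_d) = b.
    by apply/funext => k; rewrite /bs mem_index_enum.
  have := H (index_enum 'I_d) (index_enum_uniq _) F mF F0.
  rewrite bE => ->; apply: eq_integral => z _; congr (_ * (expR _)%:E).
  rewrite /S sumrB -mulr_suml; congr (_ - _ / _)%R.
elim: s => [_|a s IH /= /andP[as_ us]] {F mF F0} F mF F0.
  by apply: eq_integral => z _; rewrite /S big_nil expR0 mule1; congr F; rewrite addr0.
pose ea : 'I_d -> R := fun k => if k == a then b a else 0%R.
have madd (c : 'I_d -> R) : measurable_fun setT (fun z : 'I_d -> R => z + c)%R.
  by apply: measurable_vecD; [exact: measurable_id|exact: measurable_cst].
transitivity (\int[gam]_z (fun z => F (z + ea)%R) (z + bs s)%R).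
  apply: eq_integral => z _ /=; congr F; rewrite -addrA; congr (_ + _)%R.
  apply/funext => k; change (bs (a :: s) k = bs s k + ea k)%R; rewrite /bs /ea inE.
  by case: eqP => [->|_]/=; rewrite ?(negbTE as_) ?add0r ?addr0.
have mFe : measurable_fun setT (fun z : 'I_d -> R => F (z + ea)%R) := measurableT_comp mF (madd ea).
rewrite (IH us (fun z => F (z + ea)%R) mFe (fun z => F0 _)).
rewrite (ge0_resample a); last 2 first.
- exact: emeasurable_funM.
- by move=> z; rewrite mule_ge0// lee_fin expR_ge0.
rewrite [RHS](ge0_resample a); last 2 first.
- exact: emeasurable_funM.
- by move=> z; rewrite mule_ge0// lee_fin expR_ge0.
apply: eq_integral => z _.
have SS y : S s (upd a z y) = S s z.
  apply: eq_big_seq => k ks; rewrite /upd; case: eqP => // ka.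
  by move: as_; rewrite -ka ks.
have mupd : measurable_fun setT (fun y => upd a z y).
  by apply/measurable_vecP => j; rewrite /upd; case: (j == a); [exact: measurable_id|exact: measurable_cst].
have mE : measurable_fun setT (fun y => F (upd a z y) * (expR (S s z))%:E).
  by apply: emeasurable_funM => //; exact: (measurableT_comp mF mupd).
transitivity (\int[g1]_y (fun y => F (upd a z y) * (expR (S s z))%:E) (y + b a)%R).
  apply: eq_integral => y _ /=; rewrite SS; congr (F _ * _).
  apply/funext => k; change (upd a z y k + ea k = upd a z (y + b a) k)%R.
  by rewrite /upd /ea; case: eqP => // _; rewrite addr0.
refine (etrans (normal_shift (b a) mE _) _).
  by move=> y; rewrite mule_ge0// lee_fin expR_ge0.
apply: eq_integral => y _ /=; rewrite -muleA; congr (_ * _).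
rewrite -EFinM -expRD; congr (expR _)%:E; rewrite {2}/S big_cons addrC.
by congr (_ + _)%R; [rewrite /upd eqxx|rewrite -/(S s _) SS].
Qed.

(** On a box both sides factorise over the coordinates, and each factor is [normal_conv] for an
    indicator. *)
Lemma gauss_conv_measure (s1 s2 : R) (mm : measurable_fun setT (fun z : ('I_d -> R) * ('I_d -> R) => s1 *: z.2 + s2 *: z.1)%R)
  (ms : measurable_fun setT (fun z : 'I_d -> R => Num.sqrt (s1 ^+ 2 + s2 ^+ 2) *: z)%R)
  A : (0 < s1)%R -> measurable A ->
  image_measure (gam \x gam) mm A = image_measure gam ms A.
Proof.
move=> s10 mA; apply: vec_measure_unique => //.
  have := product_measure1E gam gam measurableT measurableT; rewrite setXTT.
  rewrite [X in _ = (X * _)%E]probability_setT [X in _ = (_ * X)%E]probability_setT mule1 => H.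
  exact: (eq_ind_r (fun x => x < +oo) (ltry 1%R) H).
have ml (a c : R) : measurable_fun setT (fun y : R => a * y + c)%R.
  by apply: measurable_funD => //; exact: measurable_funM.
have mlB (a c : R) (B : set R) : measurable B -> measurable [set y | B (a * y + c)%R].
  by move=> mB; rewrite -[X in measurable X]setTI; exact: ml.
move=> B mB; rewrite !image_measureE /=.
have -> : (fun z : 'I_d -> R => Num.sqrt (s1 ^+ 2 + s2 ^+ 2) *: z)%R @^-1` box B =
   box (fun k => [set y | B k (Num.sqrt (s1 ^+ 2 + s2 ^+ 2) * y + 0)%R]).
  by apply/seteqP; split => z h k; have := h k; rewrite /= addr0.
rewrite gam_box; last by move=> k; exact: mlB.
have m2 k : measurable [set z : R * R | B k (s1 * z.2 + s2 * z.1)%R].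
  rewrite -[X in measurable X]setTI; apply: measurable_funD => //;
  exact: measurable_funM.
have mf k : measurable_fun setT (fun y' : R => g1 [set y | B k (s1 * y + s2 * y')%R]).
  apply: (eq_measurable_fun (g1 \o xsection [set z : R * R | B k (s1 * z.2 + s2 * z.1)%R])).
    by move=> y' _ /=; congr g1; apply/seteqP; split => y; rewrite /xsection/= inE.
  exact: (measurable_fun_xsection g1 (m2 k)).
transitivity (\int[gam]_z' (\prod_k g1 [set y | B k (s1 * y + s2 * z' k)%R])).
  apply: eq_integral => z' _ /=.
  rewrite -gam_box; last by move=> k; exact: mlB.
  by congr (gam _); apply/seteqP; split => z; rewrite /xsection/= inE.
rewrite (@ge0_prod_expectation (fun k y' => g1 [set y | B k (s1 * y + s2 * y')%R]))//; last first.
  exact: index_enum_uniq.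
apply: eq_bigr => k _.
pose f (y : R) : \bar R := (\1_(B k) y)%:E.
have mfk : measurable_fun setT f by apply/measurable_EFinP; exact: measurable_indic.
have f0 y : 0 <= f y by rewrite lee_fin.
have /= := @normal_conv R s1 s2 f s10 mfk f0.
have E a c : \int[g1]_y f (a * y + c)%R = g1 [set y | B k (a * y + c)%R].
  transitivity (\int[g1]_y (\1_[set y | B k (a * y + c)%R] y)%:E).
    by [].
  exact: (etrans (integral_indic g1 measurableT (mlB _ _ _ (mB k))) (congr1 g1 (setIT _))).
under eq_integral do rewrite E.
move=> ->.
by rewrite -E; under [RHS]eq_integral do rewrite addr0.
Qed.

End gauss.

(** * Expectations of real functions *)

Lemma probability_inhabited dT (T : measurableType dT) (R : realType) (P : probability T R) :
  exists w : T, True.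
Proof.
apply: contrapT => nT; have := probability_setT P.
rewrite (_ : [set: T] = set0) ?measure0.
  by move=> /eqP; rewrite lt_eqF// lte01.
by apply/seteqP; split => // w _; case: nT; exists w.
Qed.

Section expectation.
Context dT (T : measurableType dT) (R : realType) (P : probability T R).
Implicit Types f g : T -> R.

Definition integ f := P.-integrable setT (EFin \o f).

Lemma integ_measurable f : integ f -> measurable_fun setT f.
Proof. by move=> /measurable_int/measurable_EFinP. Qed.

Lemma integ_cst (r : R) : integ (fun=> r).
Proof. exact: finite_measure_integrable_cst. Qed.

Lemma integ_le f g : measurable_fun setT f -> integ g -> (forall x, `|f x| <= g x) -> integ f.
Proof.
move=> mf ig fg; apply: (le_integrable measurableT _ _ ig); first exact/measurable_EFinP.
by move=> x _ /=; rewrite lee_fin (le_trans (fg x))// ler_norm.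
Qed.

Lemma integ_bounded f (B : R) : measurable_fun setT f -> (forall x, `|f x| <= B) -> integ f.
Proof. by move=> mf fB; apply: (integ_le mf (integ_cst B)). Qed.

Lemma integD f g : integ f -> integ g -> integ (fun x => f x + g x).
Proof. by move=> h1 h2; exact (integrableD measurableT h1 h2). Qed.

Lemma integB f g : integ f -> integ g -> integ (fun x => f x - g x).
Proof. by move=> h1 h2; exact (integrableB measurableT h1 h2). Qed.

Lemma integZ (r : R) f : integ f -> integ (fun x => r * f x).
Proof. by move=> h; exact (integrableZl measurableT r h). Qed.

Lemma integ_sum (I : Type) (s : seq I) (F : I -> T -> R) :
  (forall i, integ (F i)) -> integ (fun x => \sum_(i <- s) F i x).
Proof.
move=> iF; apply: (eq_integrable measurableT (fun x => \sum_(i <- s) (F i x)%:E)%E) => //.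
  by move=> x _; rewrite /= sumEFin.
by apply: (integrable_sum measurableT) => i _; exact: iF.
Qed.

Lemma ecst (r : R) : \int[P]_x r = r.
Proof. by rewrite Rintegral_cst// [X in fine X]probability_setT mulr1. Qed.

Lemma eD f g : integ f -> integ g -> \int[P]_x (f x + g x) = \int[P]_x f x + \int[P]_x g x.
Proof. by move=> ? ?; exact: RintegralD. Qed.

Lemma eB f g : integ f -> integ g -> \int[P]_x (f x - g x) = \int[P]_x f x - \int[P]_x g x.
Proof. by move=> ? ?; exact: RintegralB. Qed.

Lemma eZ (r : R) f : integ f -> \int[P]_x (r * f x) = r * \int[P]_x f x.
Proof. by move=> ?; exact: RintegralZl. Qed.

Lemma esumr (I : Type) (s : seq I) (F : I -> T -> R) : (forall i, integ (F i)) ->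
  \int[P]_x (\sum_(i <- s) F i x) = \sum_(i <- s) \int[P]_x F i x.
Proof.
move=> iF; elim: s => [|a s IH].
  by under eq_Rintegral do rewrite big_nil; rewrite big_nil ecst.
under eq_Rintegral do rewrite big_cons.
by rewrite eD// ?IH ?big_cons//; exact: integ_sum.
Qed.

Lemma e_le f g : integ f -> integ g -> (forall x, f x <= g x) -> \int[P]_x f x <= \int[P]_x g x.
Proof. by move=> ? ? fg; apply: le_Rintegral. Qed.

Lemma e_norm_le f g : integ f -> integ g -> (forall x, `|f x| <= g x) ->
  `|\int[P]_x f x| <= \int[P]_x g x.
Proof.
move=> iF ig fg; apply: (le_trans (le_normr_Rintegral measurableT iF)).
by apply: e_le => //; exact: integrable_norm.
Qed.

Lemma e_norm_cst f (B : R) : integ f -> (forall x, `|f x| <= B) -> `|\int[P]_x f x| <= B.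
Proof. by move=> iF fB; rewrite -[leRHS]ecst; apply: e_norm_le => //; exact: integ_cst. Qed.

Lemma EFin_e f : integ f -> (\int[P]_x f x)%:E = (\int[P]_x (f x)%:E)%E.
Proof. by move=> iF; rewrite /Rintegral fineK//; exact: integrable_fin_num. Qed.

End expectation.

Section fubini.
Context d1 d2 (T1 : measurableType d1) (T2 : measurableType d2) (R : realType).
Variables (P1 : probability T1 R) (P2 : probability T2 R) (F : T1 * T2 -> R) (a : T1 -> R) (b : T2 -> R).
Hypotheses (mF : measurable_fun setT F) (ia : integ P1 a) (ib : integ P2 b).
Hypothesis Fab : forall x y, `|F (x, y)| <= a x * b y.

Lemma integ_prod : (P1 \x P2)%E.-integrable setT (EFin \o F).
Proof.
apply/integrable12ltyP; first exact/measurable_EFinP.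
have [x0|T10] := pselect (exists x0 : T1, True); last first.
  rewrite (_ : [set: T1] = set0) ?integral_set0//.
  by apply/seteqP; split=> // x; case: T10; exists x.
have [y0|T20] := pselect (exists y0 : T2, True); last first.
  under eq_integral.
    move=> x _; rewrite (_ : [set: T2] = set0) ?integral_set0; last first.
      by apply/seteqP; split=> // y; case: T20; exists y.
    over.
  by rewrite integral_cst_prob.
pose na x := `|a x|; pose nb y := `|b y|.
have ina : integ P1 na by exact: integrable_norm.
have inb : integ P2 nb by exact: integrable_norm.
apply: (@le_lt_trans _ _ (\int[P1]_x ((\int[P2]_y nb y)%:E * (na x)%:E))%E).
  apply: ge0_le_integral => //.
  - by move=> x _; exact: integral_ge0.
  - apply: (@measurable_fun_fubini_tonelli_F _ _ _ _ _ P2 (fun z => `|(F z)%:E|%E)) => //.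
    by apply: measurableT_comp => //; exact/measurable_EFinP.
  - apply: emeasurable_funM => //; apply/measurable_EFinP.
    exact: integ_measurable ina.
  - move=> x _; rewrite EFin_e// -(@ge0_integralZr _ _ _ P2 setT measurableT (EFin \o nb)); [|by apply/measurable_EFinP; exact: integ_measurable inb|by move=> y _; rewrite lee_fin normr_ge0|by rewrite lee_fin normr_ge0].
    apply: ge0_le_integral => //.
    + apply: measurableT_comp => //; apply/measurable_EFinP.
      exact: (measurableT_comp mF (pair1_measurable x)).
    + apply: emeasurable_funM => //; apply/measurable_EFinP.
      exact: integ_measurable inb.
    + move=> y _; rewrite abse_EFin -EFinM lee_fin (le_trans (Fab x y))//.
      by rewrite (le_trans (ler_norm _))// normrM mulrC.
rewrite (@ge0_integralZl _ _ _ P1 setT measurableT (EFin \o na)); [|by apply/measurable_EFinP; exact: integ_measurable ina|by move=> y _; rewrite lee_fin normr_ge0|by rewrite lee_fin; apply: Rintegral_ge0 => y _; exact: normr_ge0].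
by rewrite -EFin_e// -EFinM ltry.
Qed.

Lemma integ_pair1 x : integ P2 (fun y => F (x, y)).
Proof.
apply: (@integ_le _ _ _ _ _ (fun y => a x * b y)) => //; last exact: integZ.
exact: (measurableT_comp mF (pair1_measurable x)).
Qed.

Lemma integ_pair2 y : integ P1 (fun x => F (x, y)).
Proof.
apply: (integ_le _ (integZ (b y) ia)).
  exact: (measurableT_comp mF (pair2_measurable y)).
by move=> x; rewrite mulrC.
Qed.

Lemma e_prod1 : \int[P1]_x \int[P2]_y F (x, y) = fine (\int[P1 \x P2]_z (F z)%:E)%E.
Proof.
rewrite {1}/Rintegral -integral12_prod_meas1; last exact: integ_prod.
congr fine; apply: eq_integral => x _; rewrite EFin_e//; exact: integ_pair1.
Qed.

Lemma integ_e1 : integ P1 (fun x => \int[P2]_y F (x, y)).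
Proof.
apply: (eq_integrable measurableT _ _ _ (integrable_fubini_F integ_prod)) => // x _.
by rewrite /= EFin_e//; exact: integ_pair1.
Qed.

Lemma e_fubini : \int[P1]_x \int[P2]_y F (x, y) = \int[P2]_y \int[P1]_x F (x, y).
Proof.
rewrite /Rintegral; congr fine.
transitivity (\int[P1]_x \int[P2]_y (EFin \o F) (x, y))%E.
  by apply: eq_integral => x _; rewrite -/(Rintegral _ _ _) EFin_e//; exact: integ_pair1.
rewrite (Fubini integ_prod).
by apply: eq_integral => y _; rewrite -/(Rintegral _ _ _) EFin_e//; exact: integ_pair2.
Qed.
End fubini.

(** * Functions of at most exponential growth *)

Section exp_growth.
Variables (R : realType) (d : nat).
Implicit Types f g h : ('I_d -> R) -> R.

(** A class stable under sums, products and affine substitutions that contains the Lipschitz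
    functions, the Hermite weights and the Cameron-Martin densities, and on which all Gaussian
    integrals converge. *)
Definition expg f := measurable_fun setT f /\
  exists C c : R, [/\ 0 <= C, 0 <= c & forall z, `|f z| <= C * expR (c * norm1 z)].

Lemma expR_norm1_ge1 (c : R) (z : 'I_d -> R) : 0 <= c -> 1 <= expR (c * norm1 z).
Proof. by move=> c0; rewrite -expR0 ler_expR mulr_ge0// norm1_ge0. Qed.

Lemma expR_norm1_le (c c' : R) (z : 'I_d -> R) : c <= c' -> expR (c * norm1 z) <= expR (c' * norm1 z).
Proof. by move=> cc; rewrite ler_expR ler_wpM2r// norm1_ge0. Qed.

Lemma expg_cst (r : R) : expg (fun=> r).
Proof.
split; first exact: measurable_cst.
by exists `|r|, 0; split => // z; rewrite mul0r expR0 mulr1.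
Qed.

Lemma expgD f g : expg f -> expg g -> expg (fun z => f z + g z).
Proof.
move=> [mf [C [c [C0 c0 fC]]]] [mg [D [e [D0 e0 gD]]]]; split; first exact: measurable_funD.
exists (C + D), (c + e); split; rewrite ?addr_ge0// => z.
rewrite (le_trans (ler_normD _ _))// mulrDl lerD//.
  by rewrite (le_trans (fC z))// ler_wpM2l// expR_norm1_le// lerDl.
by rewrite (le_trans (gD z))// ler_wpM2l// expR_norm1_le// lerDr.
Qed.

Lemma expgM f g : expg f -> expg g -> expg (fun z => f z * g z).
Proof.
move=> [mf [C [c [C0 c0 fC]]]] [mg [D [e [D0 e0 gD]]]]; split; first exact: measurable_funM.
exists (C * D), (c + e); split; rewrite ?addr_ge0 ?mulr_ge0// => z.
by rewrite normrM mulrDl expRD mulrACA ler_pM.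
Qed.

Lemma expgZ (r : R) f : expg f -> expg (fun z => r * f z).
Proof. by move=> ?; apply: expgM => //; exact: expg_cst. Qed.

Lemma expgB f g : expg f -> expg g -> expg (fun z => f z - g z).
Proof.
move=> ef eg; apply: expgD => //.
by have := expgZ (-1) eg; congr expg; apply/funext => z; rewrite mulN1r.
Qed.

Lemma expg_norm f : expg f -> expg (fun z => `|f z|).
Proof.
move=> [mf [C [c [C0 c0 fC]]]]; split; first exact: measurableT_comp.
by exists C, c; split=> // z; rewrite normr_id.
Qed.

Lemma expgX f n : expg f -> expg (fun z => f z ^+ n).
Proof.
move=> ef; elim: n => [|n IH]; first exact: expg_cst.
by under eq_fun do rewrite exprS; exact: expgM.
Qed.

Lemma norm1_le_expR (z : 'I_d -> R) : norm1 z <= expR (1 * norm1 z).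
Proof. by rewrite mul1r (le_trans _ (expR_ge1Dx _))// lerDr. Qed.

Lemma expg_enorm : expg (@enorm R d).
Proof.
split; first exact: measurable_enorm.
exists 1, 1; split => // z; rewrite mul1r ger0_norm ?enorm_ge0//.
exact: le_trans (enorm_le_norm1 z) (norm1_le_expR z).
Qed.

Lemma expg_lip (L : R) h : lip L h -> expg h.
Proof.
move=> hL; split; first exact: lip_measurable hL.
exists (`|h 0| + `|L|), 1; split; rewrite ?addr_ge0// => z.
have := hL z 0; rewrite subr0 => h1.
have h2 : `|h z| <= `|h 0| + L * enorm z.
  by rewrite -[h z](subrK (h 0)) (le_trans (ler_normD _ _))// addrC lerD2l.
rewrite (le_trans h2)// mulrDl lerD//.
  by rewrite ler_peMr// expR_norm1_ge1.
apply: (@le_trans _ _ (`|L| * enorm z)); first by rewrite ler_wpM2r ?enorm_ge0// ler_norm.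
by rewrite ler_wpM2l// (le_trans (enorm_le_norm1 z))// norm1_le_expR.
Qed.

Lemma expg_dot (u : 'I_d -> R) : expg (dot u).
Proof.
apply: (@expg_lip (enorm u)) => x y.
have -> : dot u x - dot u y = dot u (x - y).
  by rewrite dotDr -(scaleN1r y) dotZr mulN1r.
exact: dot_le.
Qed.

Lemma expg_coord (k : 'I_d) : expg (fun z => z k).
Proof.
apply: (@expg_lip 1) => x y; rewrite mul1r.
exact: (coord_le_enorm (x - y) k).
Qed.

Lemma expg_expR f (a c : R) : measurable_fun setT f -> 0 <= c ->
  (forall z, f z <= a + c * norm1 z) -> expg (fun z => expR (f z)).
Proof.
move=> mf c0 fle; split; first exact: measurableT_comp.
exists (expR a), c; split; rewrite ?expR_ge0// => z.
by rewrite ger0_norm ?expR_ge0// -expRD ler_expR.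
Qed.

Lemma measurable_affine (x : 'I_d -> R) (s : R) : measurable_fun setT (fun z : 'I_d -> R => x + s *: z).
Proof.
by apply: measurable_vecD; [exact: measurable_cst|exact: measurable_vec_scale].
Qed.

Lemma expg_affine f (x : 'I_d -> R) (s : R) : expg f -> expg (fun z => f (x + s *: z)).
Proof.
move=> [mf [C [c [C0 c0 fC]]]]; split; first exact: (measurableT_comp mf (measurable_affine x s)).
exists (C * expR (c * norm1 x)), (c * `|s|); split; rewrite ?mulr_ge0// ?expR_ge0// => z.
rewrite (le_trans (fC _))// -mulrA -expRD ler_wpM2l// ler_expR -mulrA -mulrDr ler_wpM2l//.
by rewrite -norm1Z norm1D.
Qed.

End exp_growth.

Section gauss_real.
Variables (R : realType) (d : nat) (gam : probability ('I_d -> R) R).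
Hypothesis gam_box : forall B : 'I_d -> set R, (forall k, measurable (B k)) ->
  gam (box B) = (\prod_k (@normal_prob R 0 1) (B k))%E.
Implicit Types f g h : ('I_d -> R) -> R.

Let expR_integ (c : R) : integ gam (fun z => expR (c * norm1 z)).
Proof.
have mE : measurable_fun setT (fun z : 'I_d -> R => expR (c * norm1 z)).
  apply: measurableT_comp => //; apply: measurable_funM => //.
  by apply: measurable_sum => k; apply: measurableT_comp => //; exact: measurable_coord.
apply/integrableP; split; first exact/measurable_EFinP.
under eq_integral do rewrite /= ger0_norm ?expR_ge0//.
exact: gauss_exp_norm1.
Qed.

Lemma expg_integ f : expg f -> integ gam f.
Proof.
move=> [mf [C [c [C0 c0 fC]]]]; apply: integ_le mf _ fC.
exact/integZ/expR_integ.
Qed.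

Lemma cameron_martin f (b : 'I_d -> R) : expg f ->
  \int[gam]_z f (z + b) = \int[gam]_z (f z * expR (dot b z - dot b b / 2)).
Proof.
move=> [mf _]; have mEf : measurable_fun setT (EFin \o f) by exact/measurable_EFinP.
rewrite /Rintegral; congr fine; rewrite integralE [RHS]integralE; congr (_ - _)%E.
  have mp : measurable_fun setT (EFin \o f)^\+%E by exact: measurable_funepos.
  transitivity (\int[gam]_z (EFin \o f)^\+ (z + b)%R)%E; first by apply: eq_integral => z _; rewrite !funeposE.
  refine (etrans (ge0_cameron_martin gam_box b mp _) _) => //.
  apply: eq_integral => z _; rewrite !funeposE/= EFinM.
  by rewrite maxe_pMl ?lee_fin ?expR_ge0// mul0e.
have mp : measurable_fun setT (EFin \o f)^\-%E by exact: measurable_funeneg.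
transitivity (\int[gam]_z (EFin \o f)^\- (z + b)%R)%E; first by apply: eq_integral => z _; rewrite !funenegE.
refine (etrans (ge0_cameron_martin gam_box b mp _) _) => //.
apply: eq_integral => z _; rewrite !funenegE EFinM -mulNe.
by rewrite maxe_pMl ?lee_fin ?expR_ge0// mul0e.
Qed.

Lemma gauss_conv f (s1 s2 : R) : 0 < s1 -> expg f ->
  \int[gam]_z' \int[gam]_z f (s1 *: z + s2 *: z') = \int[gam]_z f (Num.sqrt (s1 ^+ 2 + s2 ^+ 2) *: z).
Proof.
move=> s10 ef; have [mf [C [c [C0 c0 fC]]]] := ef.
set s := Num.sqrt _.
have mm : measurable_fun setT (fun z : ('I_d -> R) * ('I_d -> R) => s1 *: z.2 + s2 *: z.1).
  by apply: measurable_vecD; apply: measurable_vecZ; [exact: measurable_snd|exact: measurable_fst].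
have ms : measurable_fun setT (fun z : 'I_d -> R => s *: z) by exact: measurable_vec_scale.
have mF : measurable_fun setT (fun z : ('I_d -> R) * ('I_d -> R) => f (s1 *: z.2 + s2 *: z.1)).
  exact: (measurableT_comp mf mm).
have bd x y : `|f (s1 *: y + s2 *: x)| <= (C * expR (c * `|s2| * norm1 x)) * expR (c * `|s1| * norm1 y).
  rewrite (le_trans (fC _))// -mulrA -expRD ler_wpM2l// ler_expR -!mulrA -mulrDr ler_wpM2l//.
  by rewrite -!norm1Z addrC norm1D.
have ia := integZ C (expR_integ (c * `|s2|)).
have ib := expR_integ (c * `|s1|).
rewrite (e_prod1 mF ia ib bd) /Rintegral; congr fine.
have iF := integ_prod mF ia ib bd.
have mEf : measurable_fun setT (EFin \o f) by exact/measurable_EFinP.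
transitivity (\int[image_measure (gam \x gam) mm]_z (EFin \o f) z)%E.
  by rewrite (@integral_pushforward _ _ _ _ _ _ mm _ _ _ mEf iF).
transitivity (\int[image_measure gam ms]_z (EFin \o f) z)%E.
  by apply: eq_measure_integral => A mA _; exact: gauss_conv_measure.
rewrite (@integral_pushforward _ _ _ _ _ _ ms _ _ _ mEf)//.
apply: expg_integ; have := @expg_affine _ _ f 0 s ef.
by congr expg; apply/funext => z; rewrite add0r.
Qed.

End gauss_real.

(** * Gaussian smoothing *)

Section real_analysis.
Variable R : realType.
Implicit Types (G g : R -> R).

Lemma quad_is_derive G (t g K : R) :
  (forall e, `|e| <= 1 -> `|G (t + e) - G t - e * g| <= K * e ^+ 2) -> is_derive t 1 G g.
Proof.
move=> H.
have cv : h^-1 *: (G (h *: (1 : R) + t) - G t) @[h --> 0^'] --> g.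
  apply/cvgrPdist_le => eps eps0.
  have K0 : 0 < `|K| + 1 by rewrite ltr_wpDl.
  near=> h.
  have h0 : h != 0 by near: h; exact: nbhs_dnbhs_neq.
  have h1 : `|h| <= 1.
    by near: h; apply: dnbhs0_le.
  have h2 : `|h| <= eps / (`|K| + 1).
    by near: h; apply: dnbhs0_le; rewrite divr_gt0.
  have := H h h1; rewrite [t + h]addrC => He.
  have e1 : g - h^-1 * (G (h + t) - G t) = - (h^-1 * (G (h + t) - G t - h * g)).
    by field.
  rewrite /GRing.scale/= mulr1 e1 normrN normrM normfV.
  have hp : 0 < `|h| by rewrite normr_gt0.
  rewrite mulrC ler_pdivrMr// (le_trans He)//.
  rewrite -[h ^+ 2]ger0_norm ?sqr_ge0// normrX expr2 mulrA ler_wpM2r//.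
  apply: (@le_trans _ _ ((`|K| + 1) * `|h|)).
    by rewrite ler_wpM2r// (le_trans (ler_norm _))// lerDl.
  by rewrite mulrC -ler_pdivlMr.
apply: DeriveDef; first exact: (cvgP _ cv).
exact: (cvg_lim _ cv).
Unshelve. all: by end_near. Qed.

(** Uniqueness of a first-order coefficient. It identifies two formulas for one derivative without
    manipulating the integrals that define them. *)
Lemma quad_unique (f : R -> R) (a b K K' : R) :
  (forall e, `|e| <= 1 -> `|f e - e * a| <= K * e ^+ 2) ->
  (forall e, `|e| <= 1 -> `|f e - e * b| <= K' * e ^+ 2) -> a = b.
Proof.
move=> Ha Hb; apply/eqP; rewrite -subr_eq0 -normr_eq0 eq_le normr_ge0 andbT.
apply/ler_addgt0Pr => eps eps0; rewrite add0r.
pose M := `|K| + `|K'| + 1.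
have M0 : 0 < M by rewrite ltr_wpDl// addr_ge0.
pose e := Num.min 1 (eps / M).
have e0 : 0 < e by rewrite lt_min ltr01 divr_gt0.
have e1 : `|e| <= 1 by rewrite gtr0_norm// ge_min lexx.
have e2 : e * M <= eps by rewrite -ler_pdivlMr// ge_min lexx orbT.
have h1 := Ha e e1; have h2 := Hb e e1.
have h3 : `|e * (a - b)| <= e ^+ 2 * M.
  have -> : e * (a - b) = (f e - e * b) - (f e - e * a) by ring.
  rewrite (le_trans (ler_normB _ _))//.
  have := ler_norm K; have := ler_norm K'.
  have : 0 <= e ^+ 2 by exact: sqr_ge0.
  rewrite /M; nra.
rewrite normrM gtr0_norm// expr2 -mulrA ler_pM2l// in h3.
exact: le_trans h3 e2.
Qed.

Lemma mvt_bound G g (a M : R) : 0 <= a -> (forall t : R, is_derive t 1 G (g t)) ->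
  (forall t, 0 <= t -> t <= a -> `|g t| <= M) -> `|G a - G 0| <= M * a.
Proof.
move=> a0 dG gM.
have cG : {within `[0, a], continuous G}.
  apply: continuous_subspaceT => t; apply: differentiable_continuous.
  by apply/derivable1_diffP; have [] := dG t.
have [c] := MVT_segment a0 (fun t _ => dG t) cG.
rewrite in_itv/= => /andP[c0 ca] ->; rewrite subr0 normrM (ger0_norm a0).
by rewrite ler_wpM2r// gM.
Qed.

Lemma expR_sub1_le (w : R) : `|expR w - 1| <= `|w| * expR `|w|.
Proof.
have h1 := expR_ge1Dx w.
have h2 : expR w - 1 <= w * expR w.
  have := expR_ge1Dx (- w); rewrite expRN => h.
  have e0 := expR_gt0 w.
  have : (1 - w) * expR w <= 1 by rewrite -ler_pdivlMr// div1r.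
  by lra.
have [w0|w0] := ger0P w.
  by rewrite ger0_norm ?subr_ge0 ?(le_trans _ h1)// lerDl.
rewrite ler0_norm; last by rewrite subr_le0 -expR0 ler_expR ltW.
rewrite (@le_trans _ _ (- w))//; first by lra.
by rewrite ler_peMr ?oppr_ge0 ?(ltW w0)// -expR0 ler_expR oppr_ge0 ltW.
Qed.

Lemma expR_taylor1_le (w : R) : `|expR w - 1 - w| <= w ^+ 2 * expR `|w|.
Proof.
have h1 := expR_ge1Dx w.
have h2 : expR w - 1 <= w * expR w.
  have := expR_ge1Dx (- w); rewrite expRN => h.
  have e0 := expR_gt0 w.
  have : (1 - w) * expR w <= 1 by rewrite -ler_pdivlMr// div1r.
  by lra.
rewrite ger0_norm; last by lra.
apply: (@le_trans _ _ (w * (expR w - 1))); first by lra.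
rewrite (le_trans (ler_norm _))// normrM expr2 -[w * w]ger0_norm ?normrM -?mulrA; last first.
  by rewrite -expr2 sqr_ge0.
by rewrite ler_wpM2l// expR_sub1_le.
Qed.

Lemma sqr_le_expR (q : R) : 0 <= q -> q ^+ 2 <= 4 * expR q.
Proof.
move=> q0; have h := expR_ge1Dx (q / 2).
have -> : expR q = expR (q / 2) ^+ 2.
  by rewrite -expRM_natl; congr expR; field.
nra.
Qed.

Lemma le_expR (q : R) : q <= expR q.
Proof. by have := expR_ge1Dx q; lra. Qed.

Section tilt.
Variables (t y c : R).
Hypotheses (t1 : `|t| <= 1) (c0 : 0 <= c).
Let q := `|y| + c.
Let w := t * y - t ^+ 2 * c.

Let q0 : 0 <= q. Proof. by rewrite addr_ge0. Qed.

Let t2 : t ^+ 2 <= `|t|.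
Proof. by rewrite -[t ^+ 2]ger0_norm ?sqr_ge0// normrX expr2 ler_piMr. Qed.

Let wq : `|w| <= `|t| * q.
Proof.
rewrite (le_trans (ler_normB _ _))// (normrM t y) (normrM _ c) (ger0_norm c0) mulrDr lerD2l.
by rewrite ler_wpM2r// ger0_norm ?sqr_ge0.
Qed.

Let wq1 : `|w| <= q.
Proof. by rewrite (le_trans wq)// ler_piMl. Qed.

(** [expR w] is the Cameron-Martin density for a shift by [t *: b], where [y = dot b z] and
    [2 * c = dot b b]. Powers of [q] are absorbed into the exponential: 5 is 4 from the remainder of
    [expR] plus 1 from the term [t^2 * c]. *)
Lemma tilt1_le : `|expR w - 1 - t * y| <= 5 * expR (3 * q) * t ^+ 2.
Proof.
have -> : expR w - 1 - t * y = (expR w - 1 - w) - t ^+ 2 * c by rewrite /w; ring.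
rewrite (le_trans (ler_normB _ _))//.
have h1 : `|expR w - 1 - w| <= t ^+ 2 * (4 * expR (3 * q)).
  rewrite (le_trans (expR_taylor1_le _))//.
  apply: (@le_trans _ _ ((t ^+ 2 * q ^+ 2) * expR q)).
    rewrite ler_pM ?sqr_ge0 ?expR_ge0//; last by rewrite ler_expR.
    rewrite -exprMn -[w ^+ 2]ger0_norm ?sqr_ge0// -[(t * q) ^+ 2]ger0_norm ?sqr_ge0//.
    by rewrite !normrX ler_sqr ?nnegrE// normrM (ger0_norm q0).
  rewrite -mulrA ler_wpM2l ?sqr_ge0//.
  apply: (@le_trans _ _ (4 * expR q * expR q)).
    by rewrite ler_wpM2r ?expR_ge0// sqr_le_expR.
  rewrite -mulrA -expRD ler_wpM2l// ler_expR; move: q0; lra.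
have h2 : `|t ^+ 2 * c| <= t ^+ 2 * expR (3 * q).
  rewrite normrM !ger0_norm ?sqr_ge0// ler_wpM2l ?sqr_ge0//.
  apply: (@le_trans _ _ q); first by rewrite lerDr.
  apply: (le_trans (le_expR q)); rewrite ler_expR; move: q0; lra.
have -> : 5 * expR (3 * q) * t ^+ 2 = t ^+ 2 * (4 * expR (3 * q)) + t ^+ 2 * expR (3 * q) by ring.
exact: lerD.
Qed.

(** The density now carries the shifted first Hermite polynomial, and the first-order coefficient is
    the second one. Of the constant 13, the part 5 comes from [tilt1_le] and 8 from the correction
    [2 * c * t]. *)
Lemma tilt2_le : `|(y - t * (2 * c)) * expR w - y - t * (y ^+ 2 - 2 * c)|
  <= 13 * expR (4 * q) * t ^+ 2.
Proof.
have -> : (y - t * (2 * c)) * expR w - y - t * (y ^+ 2 - 2 * c) =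
  y * (expR w - 1 - t * y) - (2 * c * t) * (expR w - 1) by ring.
rewrite (le_trans (ler_normB _ _))//.
have yq : `|y| <= q by rewrite lerDl.
have cq : c <= q by rewrite lerDr.
have h1 : `|y * (expR w - 1 - t * y)| <= 5 * expR (4 * q) * t ^+ 2.
  rewrite normrM (le_trans (ler_pM _ _ (le_trans yq (le_expR q)) tilt1_le))//.
  have -> : expR q * (5 * expR (3 * q) * t ^+ 2) = 5 * (expR q * expR (3 * q)) * t ^+ 2 by ring.
  rewrite -expRD ler_wpM2r ?sqr_ge0// ler_wpM2l// ler_expR; lra.
have h2 : `|(2 * c * t) * (expR w - 1)| <= 8 * expR (4 * q) * t ^+ 2.
  rewrite normrM.
  apply: (@le_trans _ _ ((2 * q * `|t|) * ((`|t| * q) * expR q))).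
    rewrite ler_pM//.
      by rewrite !normrM (ger0_norm c0) ler_wpM2r// ger0_norm// ler_wpM2l.
    rewrite (le_trans (expR_sub1_le _))// ler_pM//.
    by rewrite ler_expR.
  have -> : 2 * q * `|t| * (`|t| * q * expR q) = 2 * (q ^+ 2 * expR q) * `|t| ^+ 2 by ring.
  rewrite real_normK ?num_real// ler_wpM2r ?sqr_ge0//.
  have -> : 8 * expR (4 * q) = 2 * (4 * expR (4 * q)) by ring.
  rewrite ler_wpM2l//.
  apply: (@le_trans _ _ (4 * expR q * expR q)).
    by rewrite ler_wpM2r ?expR_ge0// sqr_le_expR.
  rewrite -mulrA -expRD ler_wpM2l// ler_expR; move: q0; lra.
have -> : 13 * expR (4 * q) * t ^+ 2 = 5 * expR (4 * q) * t ^+ 2 + 8 * expR (4 * q) * t ^+ 2 by ring.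
exact: lerD.
Qed.
End tilt.

End real_analysis.

Section smoothing.
Variables (R : realType) (d : nat) (gam : probability ('I_d -> R) R).
Hypothesis gam_box : forall B : 'I_d -> set R, (forall k, measurable (B k)) ->
  gam (box B) = (\prod_k (@normal_prob R 0 1) (B k))%E.
Implicit Types (h k w : ('I_d -> R) -> R) (x y u v z : 'I_d -> R) (s r L : R).

(* Gaussian integration by parts writes the derivatives along [u] of the smoothing
   [sm s h] as smoothings of [h] weighted by Hermite polynomials. [D1] and [D2] are the
   first two derivatives, given by these formulas so that [h] need not be smooth. *)
Definition wsm (w : ('I_d -> R) -> R) (s : R) (h : ('I_d -> R) -> R) (x : 'I_d -> R) : R :=
  \int[gam]_z (h (x + s *: z) * w z).

Definition sm (s : R) (h : ('I_d -> R) -> R) (x : 'I_d -> R) : R := \int[gam]_z h (x + s *: z).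

Definition D1 s h u x := wsm (fun z => dot u z / s) s h x.
Definition D2 s h u x := wsm (fun z => (dot u z ^+ 2 - dot u u) / s ^+ 2) s h x.

Let ig := expg_integ gam_box.

Lemma expg_w1 u s : expg (fun z => dot u z / s).
Proof. by under eq_fun do rewrite mulrC; apply: expgZ; exact: expg_dot. Qed.

Lemma expg_w2 u s : expg (fun z => (dot u z ^+ 2 - dot u u) / s ^+ 2).
Proof.
under eq_fun do rewrite mulrC; apply: expgZ; apply: expgB; last exact: expg_cst.
by apply: expgX; exact: expg_dot.
Qed.

Lemma integ_w h w s x : expg h -> expg w -> integ gam (fun z => h (x + s *: z) * w z).
Proof. by move=> eh ew; apply: ig; apply: expgM => //; exact: expg_affine. Qed.

Lemma integ_s h s x : expg h -> integ gam (fun z => h (x + s *: z)).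
Proof. by move=> eh; apply: ig; exact: expg_affine. Qed.

Let tiltE h s x u (e : R) z : 0 < s ->
  h (x + e *: u + s *: z) = h (x + s *: (z + e *: (s^-1 *: u))).
Proof.
move=> s0; congr h; rewrite scalerDr !scalerA addrA -!addrA; congr (_ + _); rewrite addrC; congr (_ + _).
by congr (_ *: _); field; rewrite gt_eqF.
Qed.

(** Moving [x] by [e *: u] is the same as moving [z] by [e *: b] with [b = u / s]. Cameron-Martin
    transfers this shift to the density, and only the density is expanded. *)
Lemma taylor1 h s x u : expg h -> 0 < s -> exists K, forall e, `|e| <= 1 ->
  `|sm s h (x + e *: u) - sm s h x - e * D1 s h u x| <= K * e ^+ 2.
Proof.
move=> eh s0; pose b := s^-1 *: u; pose c := dot b b / 2.
have c0 : 0 <= c by rewrite divr_ge0// dot_ge0.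
pose F z := h (x + s *: z).
have eF : expg F by exact: expg_affine.
pose k z := `|F z| * (5 * expR (3 * (`|dot b z| + c))).
have eE : expg (fun z => expR (3 * (`|dot b z| + c))).
  apply: (@expg_expR _ _ _ (3 * c) (3 * enorm b)).
  - apply: measurable_funM => //; apply: measurable_funD => //.
    by apply: measurableT_comp => //; exact: (expg_dot b).1.
  - by rewrite mulr_ge0// enorm_ge0.
  - move=> z; rewrite mulrDr addrC lerD2l -mulrA ler_wpM2l//.
    by rewrite (le_trans (dot_le _ _))// ler_wpM2l ?enorm_ge0// enorm_le_norm1.
have ek : expg k by apply: expgM; [exact: expg_norm|exact: expgZ].
exists (\int[gam]_z k z) => e e1.
have -> : sm s h (x + e *: u) = \int[gam]_z (F z * expR (e * dot b z - e ^+ 2 * c)).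
  rewrite /sm; under eq_Rintegral do rewrite tiltE//.
  rewrite -/(F _) (cameron_martin gam_box (e *: b) eF); apply: eq_Rintegral => z _.
  by rewrite !(dotZl e b) (dotZr e b) /c; congr (_ * expR _); field.
have ew : expg (fun z => expR (e * dot b z - e ^+ 2 * c)).
  apply: (@expg_expR _ _ _ 0 (enorm b)) => [||z].
  - by apply: measurable_funB => //; apply: measurable_funM => //; exact: (expg_dot b).1.
  - exact: enorm_ge0.
  - rewrite add0r (@le_trans _ _ (e * dot b z))//.
      by rewrite lerBlDr lerDl mulr_ge0// sqr_ge0.
    rewrite (le_trans (ler_norm _))// normrM (@le_trans _ _ `|dot b z|)// ?ler_piMl//.
    by rewrite (le_trans (dot_le _ _))// ler_wpM2l ?enorm_ge0// enorm_le_norm1.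
have eD : expg (fun z => F z * (dot u z / s)) by apply: expgM => //; exact: expg_w1.
have -> : e * D1 s h u x = \int[gam]_z (e * (F z * (dot u z / s))).
  by rewrite eZ//; exact: ig.
have iFw := ig (expgM eF ew).
rewrite -eB//; [|exact: ig].
rewrite -eB//; [|by apply: integB => //; exact: ig|by apply: integZ; exact: ig].
rewrite [leRHS]mulrC -(eZ (e ^+ 2)); last exact: ig.
apply: e_norm_le.
- by apply: integB; [apply: integB => //; exact: ig|apply: integZ; exact: ig].
- by apply: integZ; exact: ig.
- move=> z; rewrite /k.
  have -> : F z * expR (e * dot b z - e ^+ 2 * c) - F z - e * (F z * (dot u z / s)) =
    F z * (expR (e * dot b z - e ^+ 2 * c) - 1 - e * dot b z).
    by rewrite /b dotZl; field; rewrite gt_eqF.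
  rewrite normrM [leRHS]mulrC -[leRHS]mulrA ler_wpM2l//.
  exact: tilt1_le.
Qed.

(** As for [taylor1], except that the weight [dot b z] is translated too, whence the correction
    [e * (2 * c)]. *)
Lemma taylor2 h s x u : expg h -> 0 < s -> exists K, forall e, `|e| <= 1 ->
  `|D1 s h u (x + e *: u) - D1 s h u x - e * D2 s h u x| <= K * e ^+ 2.
Proof.
move=> eh s0; pose b := s^-1 *: u; pose c := dot b b / 2.
have c0 : 0 <= c by rewrite divr_ge0// dot_ge0.
pose F z := h (x + s *: z).
have eF : expg F by exact: expg_affine.
pose k z := `|F z| * (13 * expR (4 * (`|dot b z| + c))).
have eE : expg (fun z => expR (4 * (`|dot b z| + c))).
  apply: (@expg_expR _ _ _ (4 * c) (4 * enorm b)).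
  - apply: measurable_funM => //; apply: measurable_funD => //.
    by apply: measurableT_comp => //; exact: (expg_dot b).1.
  - by rewrite mulr_ge0// enorm_ge0.
  - move=> z; rewrite mulrDr addrC lerD2l -mulrA ler_wpM2l//.
    by rewrite (le_trans (dot_le _ _))// ler_wpM2l ?enorm_ge0// enorm_le_norm1.
have ek : expg k by apply: expgM; [exact: expg_norm|exact: expgZ].
have bu z : dot u z / s = dot b z by rewrite /b dotZl mulrC.
exists (\int[gam]_z k z) => e e1.
have eFb : expg (fun z => F z * (dot b z - e * (2 * c))).
  by apply: expgM => //; apply: expgB; [exact: expg_dot|exact: expg_cst].
have -> : D1 s h u (x + e *: u) = \int[gam]_z (F z * (dot b z - e * (2 * c)) * expR (e * dot b z - e ^+ 2 * c)).
  transitivity (\int[gam]_z (fun z => F z * (dot b z - e * (2 * c))) (z + e *: b)).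
    apply: eq_Rintegral => z _; rewrite tiltE// bu; congr (_ * _).
    by rewrite dotDr dotZr /c; field.
  rewrite (cameron_martin gam_box (e *: b) eFb); apply: eq_Rintegral => z _.
  by rewrite !(dotZl e b) (dotZr e b) /c; congr (_ * expR _); field.
have ew : expg (fun z => expR (e * dot b z - e ^+ 2 * c)).
  apply: (@expg_expR _ _ _ 0 (enorm b)) => [||z].
  - by apply: measurable_funB => //; apply: measurable_funM => //; exact: (expg_dot b).1.
  - exact: enorm_ge0.
  - rewrite add0r (@le_trans _ _ (e * dot b z))//.
      by rewrite lerBlDr lerDl mulr_ge0// sqr_ge0.
    rewrite (le_trans (ler_norm _))// normrM (@le_trans _ _ `|dot b z|)// ?ler_piMl//.
    by rewrite (le_trans (dot_le _ _))// ler_wpM2l ?enorm_ge0// enorm_le_norm1.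
have iFw := ig (expgM eFb ew).
have i1 : integ gam (fun z => F z * (dot u z / s)) by apply: integ_w => //; exact: expg_w1.
have i2 : integ gam (fun z => F z * ((dot u z ^+ 2 - dot u u) / s ^+ 2)).
  by apply: integ_w => //; exact: expg_w2.
rewrite /D1 /D2 /wsm -/(F _) -eZ// -eB// -eB//; [|exact: integB|exact: integZ].
rewrite [leRHS]mulrC -(eZ (e ^+ 2)); last exact: ig.
apply: e_norm_le.
- by apply: integB; [exact: integB|exact: integZ].
- by apply: integZ; exact: ig.
- move=> z; rewrite /k.
  rewrite -/(F z); have -> : F z * (dot b z - e * (2 * c)) * expR (e * dot b z - e ^+ 2 * c)
     - F z * (dot u z / s) - e * (F z * ((dot u z ^+ 2 - dot u u) / s ^+ 2)) =
    F z * ((dot b z - e * (2 * c)) * expR (e * dot b z - e ^+ 2 * c)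
      - dot b z - e * (dot b z ^+ 2 - 2 * c)).
    by rewrite /c /b !dotZl !dotZr; field; rewrite gt_eqF.
  rewrite normrM [leRHS]mulrC -[leRHS]mulrA ler_wpM2l//.
  exact: tilt2_le.
Qed.
End smoothing.

(** * Derivative bounds and the semigroup law for smoothed functions *)

Section smoothing_bounds.
Variables (R : realType) (d : nat) (gam : probability ('I_d -> R) R).
Hypothesis gam_box : forall B : 'I_d -> set R, (forall k, measurable (B k)) ->
  gam (box B) = (\prod_k (@normal_prob R 0 1) (B k))%E.
Implicit Types (h k w : ('I_d -> R) -> R) (x y u v z : 'I_d -> R) (s r L : R).

Notation wsm := (wsm gam).
Notation sm := (sm gam).
Notation D1 := (D1 gam).
Notation D2 := (D2 gam).

Let ig := expg_integ gam_box.

Lemma expg_dot2 u : expg (fun z => dot u z ^+ 2).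
Proof. exact: (expgX 2 (expg_dot u)). Qed.

Lemma expg_hermite2 u : expg (fun z => dot u z ^+ 2 - dot u u).
Proof. exact: (expgB (expg_dot2 u) (expg_cst _ _)). Qed.

(** Smoothing the constant 1 gives a constant, so its first-order coefficient in [taylor1] is 0;
    that coefficient is this mean. The variance comes out of [taylor2] in the same way. *)
Lemma e_dot u : \int[gam]_z dot u z = 0.
Proof.
have e1 := expg_cst d (1 : R).
have [K HK] := taylor1 gam_box (0 : 'I_d -> R) u e1 ltr01.
have sm1 x : sm 1 (fun=> 1) x = 1 by rewrite /sm ecst.
have <- : D1 1 (fun=> 1) u 0 = 0.
  apply: (@quad_unique _ (fun=> 0) _ _ K 0) => e e1'; last by rewrite mulr0 subr0 normr0 mul0r.
  by have := HK e e1'; rewrite !sm1 subrr.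
by apply: eq_Rintegral => z _; rewrite mul1r divr1.
Qed.

Lemma e_dot2 u : \int[gam]_z (dot u z ^+ 2) = dot u u.
Proof.
have e1 := expg_cst d (1 : R).
have [K HK] := taylor2 gam_box (0 : 'I_d -> R) u e1 ltr01.
have D10 x : D1 1 (fun=> 1) u x = 0.
  by rewrite -(e_dot u); apply: eq_Rintegral => z _; rewrite mul1r divr1.
have H : D2 1 (fun=> 1) u 0 = 0.
  apply: (@quad_unique _ (fun=> 0) _ _ K 0) => e e1'; last by rewrite mulr0 subr0 normr0 mul0r.
  by have := HK e e1'; rewrite !D10 subrr.
apply/eqP; rewrite -subr_eq0 -[X in _ - X](ecst gam) -eB; last exact: integ_cst.
  rewrite -{}H; apply/eqP; apply: eq_Rintegral => z _.
  by rewrite mul1r expr1n divr1.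
by exact: (ig (expg_dot2 u)).
Qed.

(** Jensen's inequality obtained pointwise, from [|a| <= a^2 / (2 N) + N / 2] with [N = enorm u],
    once [N = 0] is set aside. *)
Lemma e_dot_norm u : \int[gam]_z `|dot u z| <= enorm u.
Proof.
have iN : integ gam (fun z => `|dot u z|) by apply: ig; apply: expg_norm; exact: expg_dot.
have [u0|u0] := eqVneq (enorm u) 0.
  rewrite u0 -[leRHS](ecst gam); apply: e_le => //; first exact: integ_cst.
  by move=> z; rewrite (le_trans (dot_le _ _))// u0 mul0r.
have up : 0 < enorm u by rewrite lt_neqAle eq_sym u0 enorm_ge0.
have i2 : integ gam (fun z => (2 * enorm u)^-1 * dot u z ^+ 2).
  by apply: integZ; exact: (ig (expg_dot2 u)).
have -> : enorm u = \int[gam]_z ((2 * enorm u)^-1 * dot u z ^+ 2 + enorm u / 2).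
  rewrite eD//; last exact: integ_cst.
  rewrite (eZ _ (ig (expg_dot2 u))) ecst e_dot2 -enorm_sqr.
  by field.
apply: e_le => //; first by apply: integD => //; exact: integ_cst.
move=> z; rewrite -[dot u z ^+ 2]real_normK ?num_real//.
set a := `|dot u z|; rewrite -subr_ge0.
have -> : (2 * enorm u)^-1 * a ^+ 2 + enorm u / 2 - a = (a - enorm u) ^+ 2 / (2 * enorm u) by field.
by rewrite divr_ge0 ?sqr_ge0// mulr_ge0// ltW.
Qed.

Lemma e_hermite2_norm u : \int[gam]_z `|dot u z ^+ 2 - dot u u| <= 2 * enorm u ^+ 2.
Proof.
have i2 : integ gam (fun z => dot u z ^+ 2) by exact: (ig (expg_dot2 u)).
have -> : 2 * enorm u ^+ 2 = \int[gam]_z (dot u z ^+ 2 + dot u u).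
  by rewrite eD ?ecst ?e_dot2// ?enorm_sqr; [ring|exact: integ_cst].
apply: e_le; first by apply: ig; exact: (expg_norm (expg_hermite2 u)).
  by apply: integD => //; exact: integ_cst.
move=> z; rewrite (le_trans (ler_normB _ _))// !ger0_norm ?sqr_ge0//.
exact: dot_ge0.
Qed.

(** Common source of the derivative bounds: sup norm of the increment times L1 norm of the
    weight. *)
Lemma wsm_diff_le (k h w : ('I_d -> R) -> R) s x y (M N : R) : expg h -> expg k -> expg w -> 0 <= M ->
  (forall z, `|k (x + s *: z) - h (y + s *: z)| <= M) -> \int[gam]_z `|w z| <= N ->
  `|wsm w s k x - wsm w s h y| <= M * N.
Proof.
move=> eh ek ew M0 kh wN.
have ik := integ_w gam_box s x ek ew; have ih := integ_w gam_box s y eh ew.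
rewrite -eB// (@le_trans _ _ (M * \int[gam]_z `|w z|))//; last by rewrite ler_wpM2l.
have iw := ig (expg_norm ew).
rewrite -eZ//; apply: e_norm_le; [exact: integB|exact: integZ|].
by move=> z; rewrite -mulrBl normrM ler_wpM2r.
Qed.

Lemma w1_norm u s : 0 < s -> \int[gam]_z `|dot u z / s| <= enorm u / s.
Proof.
move=> s0; under eq_Rintegral do rewrite normrM mulrC.
rewrite eZ; last by apply: ig; apply: expg_norm; exact: expg_dot.
by rewrite normfV gtr0_norm// mulrC ler_wpM2r ?invr_ge0 ?(ltW s0)// e_dot_norm.
Qed.

Lemma w2_norm u s : 0 < s ->
  \int[gam]_z `|(dot u z ^+ 2 - dot u u) / s ^+ 2| <= 2 * enorm u ^+ 2 / s ^+ 2.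
Proof.
move=> s0; under eq_Rintegral do rewrite normrM mulrC.
rewrite eZ; last first.
  by apply: ig; exact: (expg_norm (expg_hermite2 u)).
have s2 : 0 < s ^+ 2 by rewrite exprn_gt0.
by rewrite normfV gtr0_norm// mulrC ler_wpM2r ?invr_ge0 ?(ltW s2)// e_hermite2_norm.
Qed.

Let shift_lip h L s x v z : lip L h -> `|h (x + v + s *: z) - h (x + s *: z)| <= L * enorm v.
Proof.
move=> hL; have := hL (x + v + s *: z) (x + s *: z).
by have -> : x + v + s *: z - (x + s *: z) = v by rewrite [x + v]addrC -(addrA v) addrK.
Qed.

Lemma sm_lip h L s : 0 <= L -> lip L h -> lip L (sm s h).
Proof.
move=> L0 hL x y; have eh := expg_lip hL.
rewrite -eB; [|exact: integ_s|exact: integ_s].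
apply: e_norm_cst; first by apply: integB; exact: integ_s.
move=> z; rewrite (le_trans (hL _ _))//.
by have -> : x + s *: z - (y + s *: z) = x - y by rewrite opprD addrACA subrr addr0.
Qed.

Lemma wsm_lip h w L s : 0 <= L -> lip L h -> expg w ->
  lip (L * \int[gam]_z `|w z|) (wsm w s h).
Proof.
move=> L0 hL ew x y; have eh := expg_lip hL.
rewrite mulrAC; apply: wsm_diff_le => //; first by rewrite mulr_ge0// enorm_ge0.
move=> z; rewrite (le_trans (hL _ _))//.
by have -> : x + s *: z - (y + s *: z) = x - y by rewrite opprD addrACA subrr addr0.
Qed.

(** The derivative falls on the Gaussian at the price [1 / s], while the displacement [v] is charged
    to the Lipschitz constant. Each further derivative costs one more power of [1 / s]. *)
Lemma D1_shift_le h L s u x v : 0 <= L -> lip L h -> 0 < s ->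
  `|D1 s h u (x + v) - D1 s h u x| <= L * enorm v * (enorm u / s).
Proof.
move=> L0 hL s0; have eh := expg_lip hL.
apply: wsm_diff_le => //; [exact: expg_w1|by rewrite mulr_ge0 ?enorm_ge0| |exact: w1_norm].
by move=> z; exact: shift_lip.
Qed.

Lemma D2_shift_le h L s u x v : 0 <= L -> lip L h -> 0 < s ->
  `|D2 s h u (x + v) - D2 s h u x| <= L * enorm v * (2 * enorm u ^+ 2 / s ^+ 2).
Proof.
move=> L0 hL s0; have eh := expg_lip hL.
apply: wsm_diff_le => //; [exact: expg_w2|by rewrite mulr_ge0 ?enorm_ge0| |exact: w2_norm].
by move=> z; exact: shift_lip.
Qed.

Let lineD x u (t e : R) : x + (t + e) *: u = x + t *: u + e *: u.
Proof. by rewrite scalerDl addrA. Qed.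

(** Regularisation of a merely bounded function: along the segment from [y] to [x] the derivative
    [D1] is at most [M * enorm (x - y) / s]. *)
Lemma sm_bounded_lip k M s : expg k -> 0 <= M -> (forall x, `|k x| <= M) -> 0 < s ->
  lip (M / s) (sm s k).
Proof.
move=> ek M0 kM s0 x y.
have -> : x = y + 1 *: (x - y) by rewrite scale1r addrC subrK.
have -> : y = y + 0 *: (x - y) by rewrite scale0r addr0.
set v := x - _; rewrite scale0r addr0 scale1r.
have -> : y + (x - y) - y = x - y by rewrite addrAC subrr add0r.
pose G t := sm s k (y + t *: (x - y)).
have -> : sm s k (y + (x - y)) - sm s k y = G 1 - G 0 by rewrite /G scale1r scale0r addr0.
rewrite -[leRHS]mulr1.
apply: (@mvt_bound _ G (fun t => D1 s k (x - y) (y + t *: (x - y)))) => // t.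
  have [K HK] := taylor1 gam_box (y + t *: (x - y)) (x - y) ek s0.
  apply: (@quad_is_derive _ _ _ _ K) => e e1; rewrite /G lineD; exact: HK.
move=> t0 t1.
rewrite -[D1 _ _ _ _]subr0.
(* Comparison with the zero function turns the increment bound [wsm_diff_le] into a bound on one
   value. *)
have <- : D1 s (fun=> 0) (x - y) (y + t *: (x - y)) = 0.
  by rewrite /D1 /wsm; under eq_Rintegral do rewrite mul0r; rewrite ecst.
rewrite mulrAC -mulrA; apply: wsm_diff_le => //; first exact: expg_cst.
- exact: expg_w1.
- by move=> z; rewrite subr0.
- exact: w1_norm.
Qed.

Lemma sm_taylor0 h L s x u : 0 <= L -> lip L h -> 0 < s ->
  `|sm s h (x + u) - sm s h x - D1 s h u x| <= L * enorm u ^+ 2 / s.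
Proof.
move=> L0 hL s0; have eh := expg_lip hL.
pose G t := sm s h (x + t *: u) - t * D1 s h u x.
have -> : sm s h (x + u) - sm s h x - D1 s h u x = G 1 - G 0.
  by rewrite /G scale1r scale0r addr0; ring.
rewrite -[leRHS]mulr1.
apply: (@mvt_bound _ G (fun t => D1 s h u (x + t *: u) - D1 s h u x)) => // t.
  have [K HK] := taylor1 gam_box (x + t *: u) u eh s0.
  apply: (@quad_is_derive _ _ _ _ K) => e e1; rewrite /G lineD.
  by have := HK e e1; congr (`|_| <= _); ring.
move=> t0 t1; rewrite (le_trans (D1_shift_le _ _ _ L0 hL s0))//.
rewrite enormZ (ger0_norm t0).
have -> : L * (t * enorm u) * (enorm u / s) = t * (L * enorm u ^+ 2 / s) by ring.
by rewrite ler_piMl// divr_ge0 ?(ltW s0)// mulr_ge0// sqr_ge0.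
Qed.

Lemma D1_taylor h L s x u (a : R) : 0 <= L -> lip L h -> 0 < s -> 0 <= a ->
  `|D1 s h u (x + a *: u) - D1 s h u x - a * D2 s h u x| <= 2 * L * a ^+ 2 * enorm u ^+ 3 / s ^+ 2.
Proof.
move=> L0 hL s0 a0; have eh := expg_lip hL.
pose G t := D1 s h u (x + t *: u) - t * D2 s h u x.
have -> : D1 s h u (x + a *: u) - D1 s h u x - a * D2 s h u x = G a - G 0.
  by rewrite /G scale0r addr0; ring.
have -> : 2 * L * a ^+ 2 * enorm u ^+ 3 / s ^+ 2 = (2 * L * a * enorm u ^+ 3 / s ^+ 2) * a by ring.
apply: (@mvt_bound _ G (fun t => D2 s h u (x + t *: u) - D2 s h u x)) => // t.
  have [K HK] := taylor2 gam_box (x + t *: u) u eh s0.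
  apply: (@quad_is_derive _ _ _ _ K) => e e1; rewrite /G lineD.
  by have := HK e e1; congr (`|_| <= _); ring.
move=> t0 t1; rewrite (le_trans (D2_shift_le _ _ _ L0 hL s0))//.
rewrite enormZ (ger0_norm t0).
have -> : L * (t * enorm u) * (2 * enorm u ^+ 2 / s ^+ 2) = t * (2 * L * enorm u ^+ 3 / s ^+ 2) by ring.
have -> : 2 * L * a * enorm u ^+ 3 / s ^+ 2 = a * (2 * L * enorm u ^+ 3 / s ^+ 2) by ring.
by rewrite ler_wpM2r// divr_ge0 ?sqr_ge0// !mulr_ge0 ?exprn_ge0 ?enorm_ge0//.
Qed.

Lemma sm_taylor h L s x u : 0 <= L -> lip L h -> 0 < s ->
  `|sm s h (x + u) - sm s h x - D1 s h u x - D2 s h u x / 2| <= 2 * L * enorm u ^+ 3 / s ^+ 2.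
Proof.
move=> L0 hL s0; have eh := expg_lip hL.
pose G t := sm s h (x + t *: u) - t * D1 s h u x - t ^+ 2 / 2 * D2 s h u x.
have -> : sm s h (x + u) - sm s h x - D1 s h u x - D2 s h u x / 2 = G 1 - G 0.
  by rewrite /G scale1r scale0r addr0; field.
rewrite -[leRHS]mulr1.
apply: (@mvt_bound _ G (fun t => D1 s h u (x + t *: u) - D1 s h u x - t * D2 s h u x)) => // t.
  have [K HK] := taylor1 gam_box (x + t *: u) u eh s0.
  apply: (@quad_is_derive _ _ _ _ (K + `|D2 s h u x|)) => e e1; rewrite /G lineD.
  set A := sm s h _; set B := sm s h _; set P := D1 s h u (x + t *: u).
  have -> : A - (t + e) * D1 s h u x - (t + e) ^+ 2 / 2 * D2 s h u x -
   (B - t * D1 s h u x - t ^+ 2 / 2 * D2 s h u x) -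
   e * (P - D1 s h u x - t * D2 s h u x) = (A - B - e * P) - e ^+ 2 / 2 * D2 s h u x by field.
  rewrite (le_trans (ler_normB _ _))// mulrDl lerD//; first exact: HK.
  rewrite normrM mulrC ler_wpM2l// ger0_norm ?divr_ge0 ?sqr_ge0//.
  by have := sqr_ge0 e; lra.
move=> t0 t1; rewrite (le_trans (D1_taylor _ _ L0 hL s0 t0))//.
have -> : 2 * L * t ^+ 2 * enorm u ^+ 3 / s ^+ 2 = t ^+ 2 * (2 * L * enorm u ^+ 3 / s ^+ 2) by ring.
rewrite ler_piMl ?expr_le1//.
by rewrite divr_ge0 ?sqr_ge0// !mulr_ge0 ?exprn_ge0 ?enorm_ge0//.
Qed.

Lemma sm_sm h s r x : expg h -> 0 < r ->
  sm s (sm r h) x = sm (Num.sqrt (r ^+ 2 + s ^+ 2)) h x.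
Proof.
move=> eh r0.
have ef : expg (fun z => h (x + z)).
  by have := expg_affine x 1 eh; congr expg; apply/funext => z; rewrite scale1r.
rewrite /sm -(gauss_conv gam_box s r0 ef).
apply: eq_Rintegral => z' _; apply: eq_Rintegral => z _; congr h.
by rewrite -addrA; congr (_ + _); rewrite addrC.
Qed.

(** By the semigroup law [sm_sm] both sides are first-order coefficients of the same function. *)
Lemma D1_sm h s r u x : expg h -> expg (sm r h) -> 0 < s -> 0 < r ->
  D1 s (sm r h) u x = D1 (Num.sqrt (r ^+ 2 + s ^+ 2)) h u x.
Proof.
move=> eh ef s0 r0.
have q0 : 0 < Num.sqrt (r ^+ 2 + s ^+ 2) by rewrite sqrtr_gt0 addr_gt0// exprn_gt0.
have [K HK] := taylor1 gam_box x u ef s0.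
have [K' HK'] := taylor1 gam_box x u eh q0.
apply: (quad_unique HK) => e e1.
rewrite !sm_sm//; exact: HK'.
Qed.

Lemma D2_sm h s r u x : expg h -> expg (sm r h) -> 0 < s -> 0 < r ->
  D2 s (sm r h) u x = D2 (Num.sqrt (r ^+ 2 + s ^+ 2)) h u x.
Proof.
move=> eh ef s0 r0.
have q0 : 0 < Num.sqrt (r ^+ 2 + s ^+ 2) by rewrite sqrtr_gt0 addr_gt0// exprn_gt0.
have [K HK] := taylor2 gam_box x u ef s0.
have [K' HK'] := taylor2 gam_box x u eh q0.
apply: (quad_unique HK) => e e1.
rewrite !D1_sm//; exact: HK'.
Qed.

Lemma e_wsm h w s r x : expg h -> expg w ->
  \int[gam]_z wsm w s h (x + r *: z) = wsm w s (sm r h) x.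
Proof.
move=> eh ew; have [mh [C [c [C0 c0 hC]]]] := eh; have [mw _] := ew.
pose F (p : ('I_d -> R) * ('I_d -> R)) := h (x + r *: p.1 + s *: p.2) * w p.2.
have mF : measurable_fun setT F.
  apply: measurable_funM; last exact: (measurableT_comp mw measurable_snd).
  apply: (measurableT_comp mh); apply: measurable_vecD.
    by apply: measurable_vecD; [exact: measurable_cst|apply: measurable_vecZ; exact: measurable_fst].
  by apply: measurable_vecZ; exact: measurable_snd.
pose al (z : 'I_d -> R) := C * expR (c * (norm1 x + `|r| * norm1 z)).
pose be (z : 'I_d -> R) := expR (c * (`|s| * norm1 z)) * `|w z|.
have eN (a b : R) : 0 <= b -> expg (fun z : 'I_d -> R => expR (c * (a + b * norm1 z))).
  move=> b0; apply: (@expg_expR _ _ _ (c * a) (c * b)).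
  - apply: measurable_funM => //; apply: measurable_funD => //; apply: measurable_funM => //.
    by apply: measurable_sum => j; apply: measurableT_comp => //; exact: measurable_coord.
  - exact: mulr_ge0.
  - by move=> z; rewrite mulrDr mulrA.
have ial : integ gam al by apply: ig; apply: expgZ; exact: eN.
have ibe : integ gam be.
  apply: ig; apply: expgM; last exact: expg_norm.
  by have := eN 0 `|s| (normr_ge0 _); congr expg; apply/funext => z; rewrite add0r.
have bd p q : `|F (p, q)| <= al p * be q.
  rewrite /F/= normrM mulrA ler_wpM2r// (le_trans (hC _))// -mulrA -expRD ler_wpM2l// ler_expR -mulrDr.
  by rewrite ler_wpM2l// (le_trans (norm1D _ _))// norm1Z lerD2r (le_trans (norm1D _ _))// norm1Z.
rewrite (e_fubini mF ial ibe bd) /F/=.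
apply: eq_Rintegral => q _; rewrite /= mulrC -eZ.
  by apply: eq_Rintegral => p _; rewrite mulrC addrAC.
by apply: integ_s.
Qed.

End smoothing_bounds.

(** * Third-order remainders *)

Section kernel_functionals.
Variables (R : realType) (d : nat) (gam : probability ('I_d -> R) R).
Hypothesis gam_box : forall B : 'I_d -> set R, (forall k, measurable (B k)) ->
  gam (box B) = (\prod_k (@normal_prob R 0 1) (B k))%E.
Implicit Types (h k w : ('I_d -> R) -> R) (x y u v z : 'I_d -> R) (s r L : R).

Notation wsm := (wsm gam).
Notation sm := (sm gam).
Notation D1 := (D1 gam).
Notation D2 := (D2 gam).

Let ig := expg_integ gam_box.

Lemma lip_shift L h y : lip L h -> lip L (fun z => h (z + y)).
Proof.
move=> hL a b; rewrite (le_trans (hL _ _))//.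
by have -> : a + y - (b + y) = a - b by rewrite opprD addrACA subrr addr0.
Qed.

Lemma lipB L L' h k : lip L h -> lip L' k -> lip (L + L') (fun z => h z - k z).
Proof.
move=> hL kL a b; rewrite mulrDl.
have -> : h a - k a - (h b - k b) = (h a - h b) - (k a - k b) by ring.
by rewrite (le_trans (ler_normB _ _))// lerD.
Qed.

Lemma wsm_shift h w s x y : expg h -> expg w ->
  wsm w s h (x + y) - wsm w s h x = wsm w s (fun z => h (z + y) - h z) x.
Proof.
move=> eh ew; rewrite /wsm -eB; [|exact: integ_w|exact: integ_w].
apply: eq_Rintegral => z _; rewrite -mulrBl; congr ((h _ - _) * _).
by rewrite addrAC.
Qed.

(* The two remainders [phiR], [phiF] of Stein's identity enter the estimates only through
   these properties: linearity under translation, compatibility with further smoothing,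
   and the size [m / s ^ 2] of a third derivative of a Lipschitz function smoothed at
   scale [s]. *)
Definition kfun (Phi : R -> (('I_d -> R) -> R) -> ('I_d -> R) -> R) (m : R) :=
  [/\ forall s h L x, 0 < s -> 0 <= L -> lip L h -> `|Phi s h x| <= L * m / s ^+ 2,
      forall s h L x y, 0 < s -> lip L h ->
        Phi s h (x + y) - Phi s h x = Phi s (fun z => h (z + y) - h z) x,
      forall s r h L x, 0 < s -> 0 < r -> 0 <= L -> lip L h ->
        Phi s (sm r h) x = Phi (Num.sqrt (r ^+ 2 + s ^+ 2)) h x &
      forall s r h L x, 0 < s -> 0 <= L -> lip L h ->
        \int[gam]_z Phi s h (x + r *: z) = Phi s (sm r h) x].

(** What is left over when the summand [u] is removed from the position in the drift term. [phiF] is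
    the analogue for the Laplacian term, where the removed vector [v] is unrelated to the direction
    [u]. *)
Definition phiR a u s h x := D1 s h u (x + a *: u) - D1 s h u x - a * D2 s h u x.
Definition phiF u v s h x := D2 s h u (x + v) - D2 s h u x.

Lemma D1_shift h s u x y : expg h -> D1 s h u (x + y) - D1 s h u x = D1 s (fun z => h (z + y) - h z) u x.
Proof. by move=> eh; apply: wsm_shift => //; exact: expg_w1. Qed.

Lemma D2_shift h s u x y : expg h -> D2 s h u (x + y) - D2 s h u x = D2 s (fun z => h (z + y) - h z) u x.
Proof. by move=> eh; apply: wsm_shift => //; exact: expg_w2. Qed.

Lemma e_D1 h s r u x : expg h -> \int[gam]_z D1 s h u (x + r *: z) = D1 s (sm r h) u x.
Proof. by move=> eh; apply: e_wsm => //; exact: expg_w1. Qed.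

Lemma e_D2 h s r u x : expg h -> \int[gam]_z D2 s h u (x + r *: z) = D2 s (sm r h) u x.
Proof. by move=> eh; apply: e_wsm => //; exact: expg_w2. Qed.

Lemma D1_expg L h s r u x : 0 <= L -> lip L h -> expg (fun z => D1 s h u (x + r *: z)).
Proof.
move=> L0 hL.
exact: (expg_affine x r (expg_lip (wsm_lip gam_box s L0 hL (expg_w1 u s)))).
Qed.

Lemma D2_expg L h s r u x : 0 <= L -> lip L h -> expg (fun z => D2 s h u (x + r *: z)).
Proof.
move=> L0 hL.
exact: (expg_affine x r (expg_lip (wsm_lip gam_box s L0 hL (expg_w2 u s)))).
Qed.

Lemma kfun_phiR a u : 0 <= a -> kfun (phiR a u) (2 * a ^+ 2 * enorm u ^+ 3).
Proof.
move=> a0; split.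
- move=> s h L x s0 L0 hL; have := D1_taylor gam_box x u L0 hL s0 a0.
  by congr (_ <= _); ring.
- move=> s h L x y s0 hL; have eh := expg_lip hL; rewrite /phiR.
  rewrite -!(D1_shift s u _ y eh) -(D2_shift s u _ y eh).
  by rewrite [x + y + a *: u]addrAC; ring.
- move=> s r h L x s0 r0 L0 hL; have eh := expg_lip hL.
  have ef := expg_lip (sm_lip gam_box r L0 hL).
  by rewrite /phiR !D1_sm// D2_sm.
- move=> s r h L x s0 L0 hL; have eh := expg_lip hL; rewrite /phiR.
  have i1 y : integ gam (fun z => D1 s h u (y + r *: z)) by apply: ig; exact: D1_expg hL.
  have i2 y : integ gam (fun z => D2 s h u (y + r *: z)) by apply: ig; exact: D2_expg hL.
  transitivity (\int[gam]_z (D1 s h u (x + a *: u + r *: z) - D1 s h u (x + r *: z)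
      - a * D2 s h u (x + r *: z))).
    by apply: eq_Rintegral => z _; rewrite [x + r *: z + a *: u]addrAC.
  rewrite (eB (integB (i1 _) (i1 _)) (integZ a (i2 _))) (eB (i1 _) (i1 _)) (eZ a (i2 _)).
  by rewrite (e_D1 _ _ _ _ eh) (e_D1 _ _ _ _ eh) (e_D2 _ _ _ _ eh).
Qed.

Lemma kfun_phiF u v : kfun (phiF u v) (enorm v * (2 * enorm u ^+ 2)).
Proof.
split.
- move=> s h L x s0 L0 hL; have := D2_shift_le gam_box u x v L0 hL s0.
  by congr (_ <= _); ring.
- move=> s h L x y s0 hL; have eh := expg_lip hL; rewrite /phiF.
  rewrite -!(D2_shift s u _ y eh).
  by rewrite [x + y + v]addrAC; ring.
- move=> s r h L x s0 r0 L0 hL; have eh := expg_lip hL.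
  have ef := expg_lip (sm_lip gam_box r L0 hL).
  by rewrite /phiF !D2_sm.
- move=> s r h L x s0 L0 hL; have eh := expg_lip hL; rewrite /phiF.
  have i2 y : integ gam (fun z => D2 s h u (y + r *: z)) by apply: ig; exact: D2_expg hL.
  transitivity (\int[gam]_z (D2 s h u (x + v + r *: z) - D2 s h u (x + r *: z))).
    by apply: eq_Rintegral => z _; rewrite [x + r *: z + v]addrAC.
  by rewrite (eB (i2 _) (i2 _)) !(e_D2 _ _ _ _ eh).
Qed.

(* Split the smoothing as s^2 = (3s/5)^2 + (4s/5)^2: the first half turns the bounded
   function h(. + y) - h into a Lipschitz one, the second half pays for Phi. *)
Lemma kfun_lip Phi m s h : kfun Phi m -> 0 <= m -> 0 < s -> lip 1 h ->
  lip (3 * m / s ^+ 3) (Phi s h).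
Proof.
move=> [Pb Psh Psm _] m0 s0 h1 a b.
pose y := a - b; have -> : a = b + y by rewrite /y addrC subrK.
have -> : b + y - b = y by rewrite addrAC subrr add0r.
rewrite (Psh _ _ 1)//; set k := fun z => _.
have k2 : lip (1 + 1) k by apply: lipB => //; exact: lip_shift.
have kb z : `|k z| <= enorm y.
  have := h1 (z + y) z; rewrite mul1r /k.
  by have -> : z + y - z = y by rewrite addrAC subrr add0r.
pose s1 := 3 / 5 * s; pose s2 := 4 / 5 * s.
have s10 : 0 < s1 by rewrite mulr_gt0// divr_gt0.
have s20 : 0 < s2 by rewrite mulr_gt0// divr_gt0.
have sE : Num.sqrt (s1 ^+ 2 + s2 ^+ 2) = s.
  have -> : s1 ^+ 2 + s2 ^+ 2 = s ^+ 2 by rewrite /s1 /s2; field.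
  by rewrite sqrtr_sqr gtr0_norm.
rewrite -[in leLHS]sE -(Psm _ _ _ (1 + 1))//.
have kl := sm_bounded_lip gam_box (expg_lip k2) (enorm_ge0 y) kb s10.
rewrite (le_trans (Pb _ _ _ _ s20 _ kl))//.
  by rewrite divr_ge0 ?enorm_ge0// ltW.
have -> : enorm y / s1 * m / s2 ^+ 2 = 125 / 48 * (m * enorm y / s ^+ 3).
  by rewrite /s1 /s2; field; rewrite gt_eqF.
have -> : 3 * m / s ^+ 3 * enorm y = 3 * (m * enorm y / s ^+ 3) by ring.
rewrite ler_wpM2r//; last by lra.
by rewrite divr_ge0 ?mulr_ge0 ?enorm_ge0 ?exprn_ge0// ltW.
Qed.

(** The Gaussian average adds the variance [a^2] to the smoothing, so the bound does not degenerate
    as [s] tends to 0. This is what beats the logarithm. *)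
Lemma kfun_gauss Phi m a s h : kfun Phi m -> 0 < a -> 0 < s -> lip 1 h ->
  `|\int[gam]_z Phi s h (a *: z)| <= m / (a ^+ 2 + s ^+ 2).
Proof.
move=> [Pb Psh Psm Pe] a0 s0 h1.
have -> : \int[gam]_z Phi s h (a *: z) = \int[gam]_z Phi s h (0 + a *: z).
  by apply: eq_Rintegral => z _; rewrite add0r.
rewrite (Pe _ _ _ 1)// (Psm _ _ _ 1)//.
have as0 : 0 < a ^+ 2 + s ^+ 2 by rewrite addr_gt0// exprn_gt0.
have rp : 0 < Num.sqrt (a ^+ 2 + s ^+ 2) by rewrite sqrtr_gt0.
by have := Pb _ h 1 0 rp ler01 h1; rewrite mul1r sqr_sqrtr// ltW.
Qed.

(** Separates direction from position: the coefficients of the linear form [u] depend on [x] only.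
    Joint measurability and averaging over a random direction rest on this, and on its quadratic
    analogue [D2_coord]. *)
Lemma D1_coord h s u x : expg h ->
  D1 s h u x = \sum_(k : 'I_d) u k * wsm (fun z => z k / s) s h x.
Proof.
move=> eh.
have ew (k : 'I_d) : expg (fun z : 'I_d -> R => z k / s).
  by under eq_fun do rewrite mulrC; apply: expgZ; exact: expg_coord.
transitivity (\sum_(k : 'I_d) \int[gam]_z (u k * (h (x + s *: z) * (z k / s)))).
  rewrite -esumr; last by move=> k; apply: integZ; exact: integ_w.
  apply: eq_Rintegral => z _; rewrite /dot mulr_suml mulr_sumr.
  by apply: eq_bigr => k _; ring.
by apply: eq_bigr => k _; rewrite eZ//; exact: integ_w.
Qed.

(** Hermite weight of the mixed second derivative in the coordinates [k] and [l]. *)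
Definition w2c s (k l : 'I_d) z : R := (z k * z l - (k == l)%:R) / s ^+ 2.

Lemma expg_w2c s (k l : 'I_d) : expg (w2c s k l).
Proof.
rewrite /w2c; under eq_fun do rewrite mulrC; apply: expgZ; apply: expgB; last exact: expg_cst.
by apply: expgM; exact: expg_coord.
Qed.

Lemma D2_coord h s u x : expg h ->
  D2 s h u x = \sum_(k : 'I_d) \sum_(l : 'I_d) u k * u l * wsm (w2c s k l) s h x.
Proof.
move=> eh.
transitivity (\sum_(k : 'I_d) \sum_(l : 'I_d) \int[gam]_z (u k * u l * (h (x + s *: z) * w2c s k l z))).
  under eq_bigr => k _.
    rewrite -esumr; last by move=> l; apply: integZ; apply: integ_w => //; exact: expg_w2c.
    over.
  rewrite -esumr; last first.
    move=> k; apply: integ_sum => l; apply: integZ; apply: integ_w => //; exact: expg_w2c.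
  apply: eq_Rintegral => z _.
  have -> : dot u z ^+ 2 - dot u u = \sum_(k : 'I_d) \sum_(l : 'I_d) u k * u l * (z k * z l - (k == l)%:R).
    rewrite expr2 /dot mulr_suml -sumrB; apply: eq_bigr => k _.
    under [RHS]eq_bigr do rewrite mulrBr.
    rewrite sumrB; congr (_ - _).
      by rewrite mulr_sumr; apply: eq_bigr => l _; ring.
    rewrite (bigD1 k)//= eqxx mulr1 big1 ?addr0// => l /negbTE lk.
    by rewrite eq_sym lk mulr0.
  rewrite mulr_suml mulr_sumr; apply: eq_bigr => k _.
  by rewrite mulr_suml mulr_sumr; apply: eq_bigr => l _; rewrite /w2c; ring.
apply: eq_bigr => k _; apply: eq_bigr => l _; rewrite eZ//.
by apply: integ_w => //; exact: expg_w2c.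
Qed.

Lemma measurable_D1 dS (S : measurableType dS) (U Y : S -> 'I_d -> R) L h s : 0 <= L -> lip L h ->
  measurable_fun setT U -> measurable_fun setT Y ->
  measurable_fun setT (fun p => D1 s h (U p) (Y p)).
Proof.
move=> L0 hL mU mY; under eq_fun do rewrite (D1_coord _ _ _ (expg_lip hL)).
apply: measurable_sum => k; apply: measurable_funM.
  exact: (measurableT_comp (measurable_coord k)).
apply: (measurableT_comp _ mY).
apply: (lip_measurable (wsm_lip gam_box s L0 hL _)).
by under eq_fun do rewrite mulrC; apply: expgZ; exact: expg_coord.
Qed.

Lemma measurable_D2 dS (S : measurableType dS) (U Y : S -> 'I_d -> R) L h s : 0 <= L -> lip L h ->
  measurable_fun setT U -> measurable_fun setT Y ->
  measurable_fun setT (fun p => D2 s h (U p) (Y p)).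
Proof.
move=> L0 hL mU mY; under eq_fun do rewrite (D2_coord _ _ _ (expg_lip hL)).
apply: measurable_sum => k; apply: measurable_sum => l; apply: measurable_funM.
  by apply: measurable_funM; exact: (measurableT_comp (measurable_coord _)).
apply: (measurableT_comp _ mY).
exact: (lip_measurable (wsm_lip gam_box s L0 hL (expg_w2c _ _ _))).
Qed.

(** Read off from the expansion at the increment [u] itself. The bound is crude in [s] and serves
    integrability only. *)
Lemma D1_bounded h s u x : lip 1 h -> 0 < s ->
  `|D1 s h u x| <= enorm u + enorm u ^+ 2 / s.
Proof.
move=> h1 s0.
have := sm_taylor0 gam_box x u ler01 h1 s0; rewrite mul1r => H.
have H2 := sm_lip gam_box s ler01 h1 (x + u) x; rewrite mul1r in H2.
have e : x + u - x = u by rewrite addrAC subrr add0r.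
rewrite e in H2.
have -> : D1 s h u x = (sm s h (x + u) - sm s h x) - (sm s h (x + u) - sm s h x - D1 s h u x) by ring.
by rewrite (le_trans (ler_normB _ _))// lerD.
Qed.

Lemma D2_bounded h s u x : lip 1 h -> 0 < s ->
  `|D2 s h u x| <= enorm u ^+ 2 / s + 2 * enorm u ^+ 3 / s ^+ 2.
Proof.
move=> h1 s0.
have := D1_taylor gam_box x u ler01 h1 s0 ler01; rewrite scale1r expr1n !mulr1 mul1r => H.
have H2 := D1_shift_le gam_box u x u ler01 h1 s0; rewrite mul1r in H2.
have -> : D2 s h u x = (D1 s h u (x + u) - D1 s h u x) - (D1 s h u (x + u) - D1 s h u x - D2 s h u x) by ring.
rewrite (le_trans (ler_normB _ _))// lerD//.
by rewrite (le_trans H2)// expr2 mulrA.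
Qed.
End kernel_functionals.

(** * Stein's identity for a sum of independent vectors *)

Section indep_pair.
Context dT (T : measurableType dT) d1 (T1 : measurableType d1) d2 (T2 : measurableType d2) (R : realType).
Variables (P : probability T R) (f : T -> T1) (g : T -> T2).

Definition indep2 := forall A B, measurable A -> measurable B ->
  P (f @^-1` A `&` g @^-1` B) = (P (f @^-1` A) * P (g @^-1` B))%E.

Hypotheses (mf : measurable_fun setT f) (mg : measurable_fun setT g) (fg : indep2).

(** Independence as an independent copy on the same sample space: the law of [(f w, g w)] under [P]
    and that of [(f w, g w')] under the product measure agree on rectangles. *)
Lemma indep2_expectation (F : T1 * T2 -> R) (M : R) : measurable_fun setT F ->
  (forall w w', `|F (f w, g w')| <= M) ->
  \int[P]_w F (f w, g w) = \int[P]_w \int[P]_w' F (f w, g w').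
Proof.
move=> mF FM.
have mfg : measurable_fun setT (fun w => (f w, g w)) by exact: measurable_fun_pair.
have mfg2 : measurable_fun setT (fun p : T * T => (f p.1, g p.2)).
  by apply: measurable_fun_pair; [exact: (measurableT_comp mf measurable_fst)|exact: (measurableT_comp mg measurable_snd)].
have mF2 := measurableT_comp mF mfg2.
have bd x y : `|(F \o (fun p : T * T => (f p.1, g p.2))) (x, y)| <= M * 1 by rewrite mulr1; exact: FM.
have iM := integ_cst P M; have i1 := integ_cst P (1 : R).
rewrite (e_prod1 mF2 iM i1 bd) /Rintegral; congr fine.
have iF2 := integ_prod mF2 iM i1 bd.
have iF : integ P (fun w => F (f w, g w)).
  by apply: (@integ_bounded _ _ _ _ _ M) => //; exact: (measurableT_comp mF mfg).
have mEF : measurable_fun setT (EFin \o F) by exact/measurable_EFinP.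
transitivity (\int[image_measure P mfg]_z (EFin \o F) z)%E.
  by rewrite (@integral_pushforward _ _ _ _ _ _ mfg _ _ _ mEF iF).
transitivity (\int[image_measure (P \x P) mfg2]_z (EFin \o F) z)%E; last first.
  by rewrite (@integral_pushforward _ _ _ _ _ _ mfg2 _ _ _ mEF iF2).
apply: eq_measure_integral => A mA _.
have mT A' B' : measurable A' -> measurable B' -> measurable (f @^-1` A') /\ measurable (g @^-1` B').
  by move=> mA' mB'; split; rewrite -[X in measurable X]setTI; [exact: mf|exact: mg].
apply: (@measure_unique _ _ _ [set C `*` D | C in measurable & D in measurable] (fun=> setT)) => //.
- exact: measurable_prod_measurableType.
- move=> _ _ [C mC [D mD <-]] [C' mC' [D' mD' <-]]; exists (C `&` C'); first exact: measurableI.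
  by exists (D `&` D'); [exact: measurableI|rewrite setXI].
- by move=> _; exists setT => //; exists setT => //; rewrite setXTT.
- exact: bigcup_const.
- move=> _ [C mC [D mD <-]]; rewrite !image_measureE.
  have [mC' mD'] := mT _ _ mC mD.
  refine (etrans (fg mC mD) (esym (product_measure1E P P mC' mD'))).
- move=> _; rewrite image_measureE preimage_setT.
  by rewrite (le_lt_trans (probability_le1 P measurableT))// ltry.
Qed.
End indep_pair.

Section stein_term.
Variables (R : realType) (d : nat) (gam : probability ('I_d -> R) R).
Hypothesis gam_box : forall B : 'I_d -> set R, (forall k, measurable (B k)) ->
  gam (box B) = (\prod_k (@normal_prob R 0 1) (B k))%E.
Context dT (T : measurableType dT) (P : probability T R).
Variables (xi Y : T -> 'I_d -> R) (delta : R).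
Hypotheses (mxi : measurable_fun setT xi) (mY : measurable_fun setT Y) (xiY : indep2 P xi Y).
Hypothesis xib : forall w, enorm (xi w) <= delta.
Hypothesis xi0 : forall k, \int[P]_w xi w k = 0.

Notation D1 := (D1 gam).
Notation D2 := (D2 gam).

Variables (a s bet : R) (h : ('I_d -> R) -> R).
Hypotheses (a0 : 0 <= a) (s0 : 0 < s) (h1 : lip 1 h) (bet0 : 0 <= bet).
Hypothesis Ybet : forall Phi m, kfun gam Phi m -> 0 <= m ->
  measurable_fun setT (Phi s h) -> `|\int[P]_w Phi s h (a *: Y w)| <= m * bet.

Let D1b : R := delta + delta ^+ 2 / s.
Let D2b : R := delta ^+ 2 / s + 2 * delta ^+ 3 / s ^+ 2.

Let delta0 : 0 <= delta.
Proof.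
have [w _] := probability_inhabited P.
exact: le_trans (enorm_ge0 _) (xib w).
Qed.

Let D1_le u x : enorm u <= delta -> `|D1 s h u x| <= D1b.
Proof.
move=> ud; rewrite (le_trans (D1_bounded gam_box u x h1 s0))// lerD// ler_wpM2r ?invr_ge0 ?(ltW s0)//.
by rewrite lerXn2r ?nnegrE ?enorm_ge0.
Qed.

Let D2_le u x : enorm u <= delta -> `|D2 s h u x| <= D2b.
Proof.
move=> ud; rewrite (le_trans (D2_bounded gam_box u x h1 s0))// lerD//.
  by rewrite ler_wpM2r ?invr_ge0 ?(ltW s0)// lerXn2r ?nnegrE ?enorm_ge0.
by rewrite ler_wpM2r ?invr_ge0 ?sqr_ge0// ler_wpM2l// lerXn2r ?nnegrE ?enorm_ge0.
Qed.

Let mD1 dS (S : measurableType dS) (U V : S -> 'I_d -> R) := @measurable_D1 R d gam gam_box dS S U V 1 h s ler01 h1.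
Let mD2 dS (S : measurableType dS) (U V : S -> 'I_d -> R) := @measurable_D2 R d gam gam_box dS S U V 1 h s ler01 h1.

Let mcomb dS (S : measurableType dS) (U V : S -> 'I_d -> R) :
  measurable_fun setT U -> measurable_fun setT V ->
  measurable_fun setT (fun p => a *: U p + a *: V p).
Proof. by move=> mU mV; apply: measurable_vecD; exact: measurable_vecZ. Qed.

Let i_xi2 : integ P (fun w => enorm (xi w) ^+ 2).
Proof.
apply: (@integ_bounded _ _ _ _ _ (delta ^+ 2)).
  by apply: measurable_funX; exact: (measurableT_comp (@measurable_enorm R d) mxi).
by move=> w; rewrite ger0_norm ?sqr_ge0// lerXn2r ?nnegrE ?enorm_ge0.
Qed.

Let mcst dS (S : measurableType dS) (u : 'I_d -> R) : measurable_fun setT (fun _ : S => u).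
Proof. exact: measurable_cst. Qed.

Let maY : measurable_fun setT (fun w => a *: Y w).
Proof. exact: measurable_vecZ. Qed.

(** Replace [Y] by an independent copy and expand in [a *: xi]. The zeroth order vanishes because
    [D1] is linear in a centred direction, the first order is the [D2] term, and for a frozen value
    of [xi] the remainder is [phiR], whose mean over [Y] is controlled by [Ybet]. One factor of
    [|xi|^3] is traded for [delta]. *)
Lemma stein_first : `|\int[P]_w D1 s h (xi w) (a *: Y w + a *: xi w)
   - a * \int[P]_w \int[P]_w' D2 s h (xi w) (a *: Y w')| <=
  2 * a ^+ 2 * delta * bet * \int[P]_w (enorm (xi w) ^+ 2).
Proof.
pose F (p : ('I_d -> R) * ('I_d -> R)) := D1 s h p.1 (a *: p.2 + a *: p.1).
have mF : measurable_fun setT F.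
  by apply: mD1; [exact: measurable_fst|apply: mcomb; [exact: measurable_snd|exact: measurable_fst]].
have Fb w w' : `|F (xi w, Y w')| <= D1b := D1_le _ (xib w).
rewrite [X in `|X - _|](indep2_expectation mxi mY xiY mF Fb) /F/=.
have i2 u : enorm u <= delta -> integ P (fun w' => D2 s h u (a *: Y w')).
  move=> ud; apply: (integ_bounded _ _ (B := D2b)) => [|w']; last exact: (D2_le _ ud).
  exact: (mD2 (mcst u) maY).
have i1 u v : enorm u <= delta -> integ P (fun w' => D1 s h u (a *: Y w' + v)).
  move=> ud; apply: (integ_bounded _ _ (B := D1b)) => [|w']; last exact: (D1_le _ ud).
  exact: (mD1 (mcst u) (measurable_vecD maY (mcst v))).
have i1' u : enorm u <= delta -> integ P (fun w' => D1 s h u (a *: Y w')).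
  by move=> ud; have := i1 u 0 ud; congr integ; apply/funext => w'; rewrite addr0.
have eh := expg_lip h1.
have m1 : measurable_fun setT (fun p : T * T => xi p.1) := measurableT_comp mxi measurable_fst.
have m2 : measurable_fun setT (fun p : T * T => a *: Y p.2) := measurableT_comp maY measurable_snd.
have m3 : measurable_fun setT (fun p : T * T => a *: Y p.2 + a *: xi p.1).
  by apply: measurable_vecD => //; exact: measurable_vecZ.
have iM (M : R) := integ_cst P M.
have dbl (G : T * T -> R) (M : R) : measurable_fun setT G -> (forall w w', `|G (w, w')| <= M) ->
    integ P (fun w => \int[P]_w' G (w, w')).
  by move=> mG GM; apply: (integ_e1 mG (iM M) (iM 1)) => w w'; rewrite mulr1.
(* Fubini puts the mean over [xi] inside, where linearity in the direction meets [E xi = 0]. *)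
have D10 : \int[P]_w \int[P]_w' D1 s h (xi w) (a *: Y w') = 0.
  rewrite (@e_fubini _ _ _ _ _ P P (fun p => D1 s h (xi p.1) (a *: Y p.2)) _ _ (mD1 m1 m2) (iM D1b) (iM 1)); last first.
    by move=> w w'; rewrite mulr1; exact: (D1_le _ (xib w)).
  rewrite -[RHS](ecst P); apply: eq_Rintegral => w' _ /=.
  under eq_Rintegral do rewrite (D1_coord gam_box s _ _ eh).
  have ik k : integ P (fun w => xi w k).
    apply: (integ_bounded _ _ (B := delta)) => [|w]; first exact: (measurableT_comp (measurable_coord k) mxi).
    exact: le_trans (coord_le_enorm _ _) (xib w).
  rewrite esumr; last first.
    by move=> k; under eq_fun do rewrite mulrC; exact: integZ.
  apply: big1 => k _; under eq_Rintegral do rewrite mulrC.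
  by rewrite eZ// xi0 mulr0.
pose G w := \int[P]_w' phiR gam a (xi w) s h (a *: Y w').
have iD1 : integ P (fun w => \int[P]_w' D1 s h (xi w) (a *: Y w' + a *: xi w)).
  by apply: (dbl (fun p => D1 s h (xi p.1) (a *: Y p.2 + a *: xi p.1)) D1b) => [|w w']; [exact: mD1|exact: (D1_le _ (xib w))].
have iD1' : integ P (fun w => \int[P]_w' D1 s h (xi w) (a *: Y w')).
  by apply: (dbl (fun p => D1 s h (xi p.1) (a *: Y p.2)) D1b) => [|w w']; [exact: mD1|exact: (D1_le _ (xib w))].
have iD2 : integ P (fun w => \int[P]_w' D2 s h (xi w) (a *: Y w')).
  by apply: (dbl (fun p => D2 s h (xi p.1) (a *: Y p.2)) D2b) => [|w w']; [exact: mD2|exact: (D2_le _ (xib w))].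
have GE w : G w = \int[P]_w' D1 s h (xi w) (a *: Y w' + a *: xi w)
    - \int[P]_w' D1 s h (xi w) (a *: Y w') - a * \int[P]_w' D2 s h (xi w) (a *: Y w').
  rewrite /G /phiR -(eZ a (i2 _ (xib w))) -(eB (i1 _ _ (xib w)) (i1' _ (xib w))).
  rewrite -(eB (integB (i1 _ _ (xib w)) (i1' _ (xib w))) (integZ a (i2 _ (xib w)))).
  by [].
have iG : integ P G.
  have -> : G = fun w => \int[P]_w' D1 s h (xi w) (a *: Y w' + a *: xi w)
    - \int[P]_w' D1 s h (xi w) (a *: Y w') - a * \int[P]_w' D2 s h (xi w) (a *: Y w').
    by apply/funext.
  exact: (integB (integB iD1 iD1') (integZ a iD2)).
have -> : \int[P]_w \int[P]_w' D1 s h (xi w) (a *: Y w' + a *: xi w)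
   - a * \int[P]_w \int[P]_w' D2 s h (xi w) (a *: Y w') = \int[P]_w G w.
  under [RHS]eq_Rintegral do rewrite GE.
  refine (esym (etrans (eB (integB iD1 iD1') (integZ a iD2)) _)).
  congr (_ - _); last exact: (eZ a iD2).
  refine (etrans (eB iD1 iD1') _).
  exact: (etrans (congr1 (fun y => _ - y) D10) (subr0 _)).
rewrite -(eZ _ i_xi2); apply: e_norm_le => //; first exact: integZ.
move=> w.
have kR := kfun_phiR gam_box (xi w) a0.
have ux := enorm_ge0 (xi w).
apply: (@le_trans _ _ (2 * a ^+ 2 * enorm (xi w) ^+ 3 * bet)).
  apply: (Ybet kR); first by rewrite !mulr_ge0 ?exprn_ge0.
  apply: measurable_funB.
    apply: measurable_funB; last exact: (mD1 (mcst (xi w)) (@measurable_id _ _ setT)).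
    exact: (mD1 (mcst (xi w)) (measurable_vecD (@measurable_id _ _ setT) (mcst (a *: xi w)))).
  apply: measurable_funM => //; exact: (mD2 (mcst (xi w)) (@measurable_id _ _ setT)).
have -> : 2 * a ^+ 2 * enorm (xi w) ^+ 3 * bet = 2 * a ^+ 2 * bet * enorm (xi w) ^+ 2 * enorm (xi w) by ring.
have -> : 2 * a ^+ 2 * delta * bet * enorm (xi w) ^+ 2 = 2 * a ^+ 2 * bet * enorm (xi w) ^+ 2 * delta by ring.
by rewrite ler_wpM2l// !mulr_ge0 ?exprn_ge0 ?enorm_ge0.
Qed.

(** Here the direction is already an independent copy, so the summand is removed from the position
    only. With the direction and the removed summand frozen, the change is [phiF]. *)
Lemma stein_second : `|\int[P]_w' \int[P]_w D2 s h (xi w') (a *: Y w + a *: xi w)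
   - \int[P]_w \int[P]_w' D2 s h (xi w) (a *: Y w')| <=
  2 * a * delta * bet * \int[P]_w (enorm (xi w) ^+ 2).
Proof.
have m1 : measurable_fun setT (fun p : T * T => xi p.1) := measurableT_comp mxi measurable_fst.
have m2 : measurable_fun setT (fun p : T * T => a *: Y p.2) := measurableT_comp maY measurable_snd.
have m3 : measurable_fun setT (fun p : T * T => a *: Y p.2 + a *: xi p.2).
  by apply: measurable_vecD => //; apply: measurable_vecZ; exact: (measurableT_comp mxi measurable_snd).
have iM (M : R) := integ_cst P M.
have dbl (G : T * T -> R) (M : R) : measurable_fun setT G -> (forall w w', `|G (w, w')| <= M) ->
    integ P (fun w => \int[P]_w' G (w, w')).
  by move=> mG GM; apply: (integ_e1 mG (iM M) (iM 1)) => w w'; rewrite mulr1.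
have i1 : integ P (fun w' => \int[P]_w D2 s h (xi w') (a *: Y w + a *: xi w)).
  by apply: (dbl (fun p => D2 s h (xi p.1) (a *: Y p.2 + a *: xi p.2)) D2b) => [|w w']; [exact: mD2|exact: (D2_le _ (xib w))].
have i2 : integ P (fun w => \int[P]_w' D2 s h (xi w) (a *: Y w')).
  by apply: (dbl (fun p => D2 s h (xi p.1) (a *: Y p.2)) D2b) => [|w w']; [exact: mD2|exact: (D2_le _ (xib w))].
rewrite -(eB i1 i2) -(eZ _ i_xi2).
apply: e_norm_le; [exact: integB|exact: integZ|move=> w].
set u := xi w; have ud : enorm u <= delta := xib w.
have j2 v : integ P (fun w' => D2 s h u (a *: Y w' + v)).
  apply: (integ_bounded _ _ (B := D2b)) => [|w']; last exact: (D2_le _ ud).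
  exact: (mD2 (mcst u) (measurable_vecD maY (mcst v))).
have j2' : integ P (fun w' => D2 s h u (a *: Y w')).
  by have := j2 0; congr integ; apply/funext => w'; rewrite addr0.
pose F (p : ('I_d -> R) * ('I_d -> R)) := D2 s h u (a *: p.2 + a *: p.1).
have mF : measurable_fun setT F.
  by apply: mD2; [exact: mcst|apply: mcomb; [exact: measurable_snd|exact: measurable_fst]].
have Fb w1 w2 : `|F (xi w1, Y w2)| <= D2b := D2_le _ ud.
rewrite [X in `|X - _|](indep2_expectation mxi mY xiY mF Fb) /F/=.
have j3 : integ P (fun w1 => \int[P]_w2 D2 s h u (a *: Y w2 + a *: xi w1)).
  have m4 : measurable_fun setT (fun p : T * T => a *: Y p.2 + a *: xi p.1).
    by apply: measurable_vecD => //; exact: measurable_vecZ.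
  by apply: (dbl (fun p => D2 s h u (a *: Y p.2 + a *: xi p.1)) D2b) => [|w1 w2]; [exact: (mD2 (mcst u) m4)|exact: (D2_le _ ud)].
rewrite -[X in _ - X](ecst P) -(eB j3 (iM _)).
apply: e_norm_cst; first exact: (integB j3 (iM _)).
move=> w1; rewrite -(eB (j2 _) j2').
have kF := kfun_phiF gam_box u (a *: xi w1).
have := Ybet kF.
rewrite enormZ (ger0_norm a0) => H.
have ux := enorm_ge0 (xi w1).
apply: (@le_trans _ _ (a * enorm (xi w1) * (2 * enorm u ^+ 2) * bet)).
  apply: H; first by rewrite !mulr_ge0 ?exprn_ge0 ?enorm_ge0.
  apply: measurable_funB; last exact: (mD2 (mcst u) (@measurable_id _ _ setT)).
  exact: (mD2 (mcst u) (measurable_vecD (@measurable_id _ _ setT) (mcst (a *: xi w1)))).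
have -> : a * enorm (xi w1) * (2 * enorm u ^+ 2) * bet = 2 * a * bet * enorm u ^+ 2 * enorm (xi w1) by ring.
have -> : 2 * a * delta * bet * enorm u ^+ 2 = 2 * a * bet * enorm u ^+ 2 * delta by ring.
by rewrite ler_wpM2l// !mulr_ge0 ?exprn_ge0 ?enorm_ge0.
Qed.

(* One summand of the Stein identity E<W, grad g(aW)> = a E Lap g(aW) up to third-order error. *)
Lemma stein_term : `|\int[P]_w D1 s h (xi w) (a *: Y w + a *: xi w)
   - a * \int[P]_w' \int[P]_w D2 s h (xi w') (a *: Y w + a *: xi w)| <=
  4 * a ^+ 2 * delta * bet * \int[P]_w (enorm (xi w) ^+ 2).
Proof.
set A := \int[P]_w _; set B := \int[P]_w' _; set E2 := (\int[P]_w (enorm _ ^+ 2)).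
pose C := \int[P]_w \int[P]_w' D2 s h (xi w) (a *: Y w').
have -> : A - a * B = (A - a * C) - a * (B - C) by ring.
have h2 : `|a * (B - C)| <= a * (2 * a * delta * bet * E2).
  by rewrite normrM (ger0_norm a0) ler_wpM2l// stein_second.
rewrite (le_trans (ler_normB _ _))//.
have -> : 4 * a ^+ 2 * delta * bet * E2 = 2 * a ^+ 2 * delta * bet * E2 + a * (2 * a * delta * bet * E2) by ring.
by rewrite lerD// stein_first.
Qed.
End stein_term.

(** * Independence of a summand from the sum of the others *)

Section leave_one_out.
Context dT (T : measurableType dT) (R : realType) (P : probability T R) (n d : nat).
Variable X : 'I_n -> 'I_d -> T -> R.
Hypothesis mX : forall i k, measurable_fun setT (X i k).
Hypothesis iX : indep_vectors P X.
Variable c : R.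

Definition summand (i : 'I_n) (w : T) : 'I_d -> R := fun k => c * X i k w.
Definition others (i : 'I_n) (w : T) : 'I_d -> R := fun k => \sum_(j | j != i) c * X j k w.

Lemma measurable_summand i : measurable_fun setT (summand i).
Proof. by apply/measurable_vecP => k; exact: measurable_funM. Qed.

Lemma measurable_others i : measurable_fun setT (others i).
Proof.
apply/measurable_vecP => k; rewrite /others.
under eq_fun do rewrite big_mkcond/=.
by apply: measurable_sum => j; case: (j != i) => //; exact: measurable_funM.
Qed.

Let gens (i : 'I_n) : set (set T) := [set A | exists k B, measurable B /\ A = X i k @^-1` B].

Let gen_measurable i A : gen_sigma (X i) A -> measurable A.
Proof.
apply: smallest_sub; first exact: sigma_algebra_measurable.
by move=> _ [k [B [mB ->]]]; have := mX i k measurableT mB; rewrite setTI.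
Qed.

Let genT i : gen_sigma (X i) setT.
Proof. exact: (@measurableT _ (g_sigma_algebraType (gens i))). Qed.

(** A pi-system for the vectors other than the [i]-th: full intersections whose [i]-th factor is the
    whole space, a shape to which the product formula applies directly. *)
Let G i : set (set T) := [set E | exists A : 'I_n -> set T,
  [/\ forall j, gen_sigma (X j) (A j), A i = setT & E = \bigcap_j A j]].

Let G_measurable i : G i `<=` measurable.
Proof.
move=> _ [A [gA _ ->]]; apply: fin_bigcap_measurable => // j _.
exact: gen_measurable (gA j).
Qed.

(** For fixed [D] both sides are finite measures in [E], and they agree on the pi-system [G i]. *)
Let indep_G i D E : gen_sigma (X i) D -> <<s G i >> E -> P (D `&` E) = (P D * P E)%E.
Proof.
move=> gD gE; have mD := gen_measurable gD.
have PD0 : 0 <= fine (P D) by rewrite fine_ge0.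
have PDE : (fine (P D))%:E = P D by rewrite fineK// fin_num_measure.
suff : mrestr P mD E = mscale (NngNum PD0) P E.
  by rewrite /mrestr/= /mscale/= PDE setIC.
apply: (g_sigma_algebra_measure_unique (G i) (@G_measurable i) (fun=> setT)) => //.
- by move=> _; exists (fun=> setT); split => //; rewrite bigcapT.
- exact: bigcup_const.
- move=> _ _ [A [gA Ai ->]] [B [gB Bi ->]]; exists (fun j => A j `&` B j); split.
  + by move=> j; apply: (@measurableI _ (g_sigma_algebraType (gens j))); [exact: gA|exact: gB].
  + by rewrite Ai Bi setIT.
  + by rewrite bigcapI.
- move=> _ [A [gA Ai ->]]; rewrite /mrestr/= /mscale/= PDE.
  pose A' j := if j == i then D else A j.
  have gA' j : gen_sigma (X j) (A' j) by rewrite /A'; case: eqP => [->|_].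
  transitivity (P (\bigcap_j A' j)).
    congr (P _); apply/seteqP; split => [w [Aw Dw] j _|w A'w]; first by rewrite /A'; case: eqP => // _; exact: Aw.
    split=> [j _|]; last by have := A'w i I; rewrite /A' eqxx.
    by have := A'w j I; rewrite /A'; case: eqP => // -> _; rewrite Ai.
  rewrite (iX gA') (iX gA) (bigD1 i)//= [in RHS](bigD1 i)//= Ai.
  rewrite [in RHS]probability_setT mul1e /A' eqxx; congr (_ * _)%E.
  by apply: eq_bigr => j /negbTE ->.
- by move=> _; apply: (le_lt_trans (probability_le1 P (measurableI _ _ measurableT mD))); rewrite ltry.
Qed.

Lemma indep2_summand_others i : indep2 P (summand i) (others i).
Proof.
move=> A B mA mB; apply: indep_G.
  have mf : measurable_fun (setT : set (g_sigma_algebraType (gens i))) (summand i).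
    apply/measurable_vecP => k; apply: measurable_funM; first exact: measurable_cst.
    move=> _ C mC; rewrite setTI; apply: sub_sigma_algebra; by exists k, C.
  have := mf measurableT A mA; rewrite setTI; exact.
have mg : measurable_fun (setT : set (g_sigma_algebraType (G i))) (others i).
  apply/measurable_vecP => k; rewrite /others; under eq_fun do rewrite big_mkcond/=.
  apply: measurable_sum => j; case: (boolP (j != i)) => [ji|_]; last exact: measurable_cst.
  apply: measurable_funM; first exact: measurable_cst.
  move=> _ C mC; rewrite setTI; apply: sub_sigma_algebra.
  exists (fun l => if l == j then X j k @^-1` C else setT); split.
  - move=> l; case: eqP => [->|_]; last exact: genT.
    by apply: sub_sigma_algebra; exists k, C.
  - by rewrite eq_sym (negbTE ji).
  - apply/seteqP; split => [w Cw l _|w /(_ j I)]; last by rewrite eqxx.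
    by case: eqP.
have := mg measurableT B mB; rewrite setTI; exact.
Qed.

Lemma summand_others i w : summand i w + others i w = fun k => c * \sum_(j < n) X j k w.
Proof.
apply/funext => k; change (summand i w k + others i w k = c * \sum_(j < n) X j k w).
by rewrite /summand /others mulr_sumr [in RHS](bigD1 i).
Qed.

End leave_one_out.

(** * Telescoping along the path and Riemann sums *)

Section telescope.
Variable R : realType.

(* Steps of length e^2 with error O(e^3): N steps accumulate only O(e). *)
Lemma telescope_le (M B : R -> R) (v0 v1 K : R) : v0 <= v1 -> 0 <= K ->
  (forall v e, v0 <= v -> 0 <= e -> v + e ^+ 2 <= v1 -> e ^+ 2 <= 1 / 2 ->
     `|M (v + e ^+ 2) - M v| <= B (v + e ^+ 2) - B v + K * e ^+ 3) ->
  `|M v1 - M v0| <= B v1 - B v0.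
Proof.
move=> v01 K0 step; pose D := v1 - v0.
have D0 : 0 <= D by rewrite subr_ge0.
apply/ler_addgt0Pr => eps eps0.
(* The first entry guarantees [e^2 <= 1 / 2], the second keeps the accumulated error [K * D * e]
   below [eps]. *)
pose e0 := Num.min (1 / 2) (eps / (K * D + 1)).
have KD : 0 < K * D + 1 by rewrite ltr_wpDl// mulr_ge0.
have e00 : 0 < e0 by rewrite lt_min divr_gt0//= divr_gt0.
pose N := (Num.bound (D / e0 ^+ 2)).+1.
have N0 : 0 < N%:R :> R by [].
pose e := Num.sqrt (D / N%:R).
have e2 : e ^+ 2 = D / N%:R by rewrite sqr_sqrtr// divr_ge0// ltW.
have ep : 0 <= e by exact: sqrtr_ge0.
have ee0 : e <= e0.
  rewrite -ler_sqr ?nnegrE ?(ltW e00)// e2 ler_pdivrMr// mulrC -ler_pdivrMr ?exprn_gt0//.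
  have := @archi_boundP R (D / e0 ^+ 2) ltac:(by rewrite divr_ge0// exprn_ge0// ltW).
  move=> /ltW h; rewrite (le_trans h)// ler_nat; exact: leqnSn.
have e12 : e ^+ 2 <= 1 / 2.
  have e1 : e <= 1 / 2 by rewrite (le_trans ee0)// ge_min lexx.
  nra.
have H j : (j <= N)%N -> `|M (v0 + j%:R * e ^+ 2) - M v0| <=
    B (v0 + j%:R * e ^+ 2) - B v0 + j%:R * (K * e ^+ 3).
  elim: j => [_|j IH jN]; first by rewrite !mul0r !addr0 !subrr normr0.
  have h1 := IH (ltnW jN).
  have Sj : v0 + j.+1%:R * e ^+ 2 = v0 + j%:R * e ^+ 2 + e ^+ 2 by rewrite -natr1 mulrDl mul1r addrA.
  have := step (v0 + j%:R * e ^+ 2) e _ ep _ e12.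
  rewrite -Sj => h2.
  have -> : M (v0 + j.+1%:R * e ^+ 2) - M v0 = (M (v0 + j.+1%:R * e ^+ 2) - M (v0 + j%:R * e ^+ 2)) + (M (v0 + j%:R * e ^+ 2) - M v0) by ring.
  rewrite (le_trans (ler_normD _ _))//.
  have -> : B (v0 + j.+1%:R * e ^+ 2) - B v0 + j.+1%:R * (K * e ^+ 3) =
    (B (v0 + j.+1%:R * e ^+ 2) - B (v0 + j%:R * e ^+ 2) + K * e ^+ 3) + (B (v0 + j%:R * e ^+ 2) - B v0 + j%:R * (K * e ^+ 3)).
    by rewrite -natr1; ring.
  rewrite lerD// h2//.
    by rewrite lerDl mulr_ge0// sqr_ge0.
  have -> : v1 = v0 + N%:R * e ^+ 2 by rewrite e2 /D; field; rewrite gt_eqF.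
  by rewrite lerD2l ler_wpM2r ?sqr_ge0// ler_nat.
have := H N (leqnn _).
have -> : v0 + N%:R * e ^+ 2 = v1 by rewrite e2 /D; field; rewrite gt_eqF.
move=> h; rewrite (le_trans h)// lerD2l.
have -> : N%:R * (K * e ^+ 3) = (K * (N%:R * e ^+ 2)) * e by ring.
have -> : N%:R * e ^+ 2 = D by rewrite e2; field; rewrite gt_eqF.
apply: (@le_trans _ _ ((K * D + 1) * e)).
  by rewrite ler_wpM2r// lerDl.
rewrite mulrC -ler_pdivlMr// (le_trans ee0)// ge_min lexx orbT //.
Qed.

(** One left rectangle of [1 / v] against the primitive [ln]. Taking [ln x <= x - 1] at
    [x = 1 / (1 + r)] gives [ln (1 + r) >= r - r^2], and [r^2] is of order [e^4]. *)
Lemma ln_step (v0 v e : R) : 0 < v0 -> v0 <= v -> 0 <= e -> e ^+ 2 <= 1 / 2 ->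
  e ^+ 2 / v <= ln (v + e ^+ 2) - ln v + v0 ^- 2 * e ^+ 3.
Proof.
move=> v00 v0v e0 e1; have vp : 0 < v by exact: lt_le_trans v0v.
pose r := e ^+ 2 / v; have r0 : 0 <= r by rewrite divr_ge0 ?sqr_ge0// ltW.
have -> : v + e ^+ 2 = v * (1 + r) by rewrite /r; field; rewrite gt_eqF.
have r1 : 0 < 1 + r by rewrite ltr_pwDl.
rewrite lnM ?posrE// [ln v + _]addrC addrK.
have h1 : r - r ^+ 2 <= ln (1 + r).
  have : ln (1 + r)^-1 <= (1 + r)^-1 - 1.
    have {1}-> : (1 + r)^-1 = 1 + ((1 + r)^-1 - 1) by rewrite [RHS]addrC subrK.
    apply: le_ln1Dx; rewrite ltrBrDl subrr invr_gt0//.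
  rewrite lnV ?posrE// => h2.
  have h3 : (1 + r)^-1 - 1 <= - (r - r ^+ 2).
    rewrite lerBlDr -[leLHS]mul1r ler_pdivrMr//.
    have -> : (- (r - r ^+ 2) + 1) * (1 + r) = 1 + r ^+ 3 by ring.
    by rewrite lerDl exprn_ge0.
  by move: h2 h3; lra.
have h4 : r ^+ 2 <= v0 ^- 2 * e ^+ 3.
  rewrite /r expr_div_n mulrC.
  have e11 : e <= 1 by nra.
  apply: ler_pM; rewrite ?invr_ge0 ?sqr_ge0//.
    by rewrite lef_pV2 ?posrE ?exprn_gt0// lerXn2r ?nnegrE ?(ltW v00) ?(ltW vp).
  by rewrite -exprM [leLHS]exprSr ler_piMr// exprn_ge0.
rewrite -/r; move: h1 h4; lra.
Qed.

(** One left rectangle of [v^(-3/2)] against the primitive [-2 / sqrt v]. The excess carries the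
    factor [(s' - s)^2], again of order [e^4]. *)
Lemma sqrt_step (v0 v e : R) : 0 < v0 -> v0 <= v -> 0 <= e -> e ^+ 2 <= 1 / 2 ->
  e ^+ 2 / Num.sqrt v ^+ 3 <=
  2 / Num.sqrt v - 2 / Num.sqrt (v + e ^+ 2) + Num.sqrt v0 ^- 5 * e ^+ 3.
Proof.
move=> v00 v0v e0 e1; have vp : 0 < v by exact: lt_le_trans v0v.
set s := Num.sqrt v; set s' := Num.sqrt (v + e ^+ 2); set s0 := Num.sqrt v0.
have v'p : 0 < v + e ^+ 2 by rewrite ltr_pwDl// sqr_ge0.
have s0p : 0 < s0 by rewrite sqrtr_gt0.
have sp : 0 < s by rewrite sqrtr_gt0.
have s'p : 0 < s' by rewrite sqrtr_gt0.
have ss' : s <= s' by rewrite ler_wsqrtr// lerDl sqr_ge0.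
have s0s : s0 <= s by rewrite ler_wsqrtr.
have s2 : s ^+ 2 = v by rewrite sqr_sqrtr// ltW.
have s'2 : s' ^+ 2 = v + e ^+ 2 by rewrite sqr_sqrtr// ltW.
have ee : e ^+ 2 = s' ^+ 2 - s ^+ 2 by rewrite s2 s'2; ring.
rewrite {1}ee.
have h : (s' ^+ 2 - s ^+ 2) / s ^+ 3 - (2 / s - 2 / s') = (s' - s) ^+ 2 * (s' + 2 * s) / (s ^+ 3 * s').
  by field; rewrite !gt_eqF.
have d1 : s' - s <= e ^+ 2 / (2 * s0).
  rewrite ler_pdivlMr ?mulr_gt0// ee; nra.
have h2 : (s' - s) ^+ 2 * (s' + 2 * s) / (s ^+ 3 * s') <= 3 * (s' - s) ^+ 2 / s0 ^+ 3.
  rewrite ler_pdivrMr ?mulr_gt0 ?exprn_gt0//.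
  have hs : s0 ^+ 3 <= s ^+ 3 by rewrite lerXn2r ?nnegrE ?(ltW s0p) ?(ltW sp).
  have -> : 3 * (s' - s) ^+ 2 / s0 ^+ 3 * (s ^+ 3 * s') = (s' - s) ^+ 2 * (3 * s') * (s ^+ 3 / s0 ^+ 3) by ring.
  apply: (@le_trans _ _ ((s' - s) ^+ 2 * (3 * s'))).
    by rewrite ler_wpM2l ?sqr_ge0//; lra.
  apply: ler_peMr; first by rewrite !mulr_ge0 ?sqr_ge0 ?(ltW s'p)// subr_ge0.
  by rewrite ler_pdivlMr ?exprn_gt0// mul1r.
have h3 : 3 * (s' - s) ^+ 2 / s0 ^+ 3 <= s0 ^- 5 * e ^+ 3.
  have e11 : e <= 1 by nra.
  have q : (s' - s) ^+ 2 <= (e ^+ 2 / (2 * s0)) ^+ 2.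
    by rewrite lerXn2r ?nnegrE ?subr_ge0// divr_ge0 ?sqr_ge0// mulr_ge0// ltW.
  rewrite ler_pdivrMr ?exprn_gt0//.
  have -> : s0 ^- 5 * e ^+ 3 * s0 ^+ 3 = e ^+ 3 / s0 ^+ 2 by field; rewrite gt_eqF.
  apply: (@le_trans _ _ (3 * (e ^+ 2 / (2 * s0)) ^+ 2)); first by rewrite ler_wpM2l.
  have -> : 3 * (e ^+ 2 / (2 * s0)) ^+ 2 = 3 / 4 * e * (e ^+ 3 / s0 ^+ 2) by field; rewrite gt_eqF.
  rewrite ler_piMl ?divr_ge0 ?exprn_ge0//; [exact: ltW|lra].
move: h h2 h3; lra.
Qed.

End telescope.

Section gauss_moments.
Variables (R : realType) (d : nat) (gam : probability ('I_d -> R) R).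
Hypothesis gam_box : forall B : 'I_d -> set R, (forall k, measurable (B k)) ->
  gam (box B) = (\prod_k (@normal_prob R 0 1) (B k))%E.
Let ig := expg_integ gam_box.

Definition basis (k : 'I_d) : 'I_d -> R := fun j => (j == k)%:R.

Lemma dot_basis k (z : 'I_d -> R) : dot (basis k) z = z k.
Proof.
rewrite /dot (bigD1 k)//= /basis eqxx mul1r big1 ?addr0// => j /negbTE ->.
by rewrite mul0r.
Qed.

Lemma gauss_mean k : \int[gam]_z z k = 0.
Proof. by rewrite -(e_dot gam_box (basis k)); apply: eq_Rintegral => z _; rewrite dot_basis. Qed.

(** Polarisation of [e_dot2]. *)
Lemma gauss_cov k l : \int[gam]_z (z k * z l) = (k == l)%:R.
Proof.
have i2 u := ig (expg_dot2 u).
have E u := e_dot2 gam_box u.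
transitivity (\int[gam]_z (2^-1 * (dot (basis k + basis l) z ^+ 2 - dot (basis k) z ^+ 2 - dot (basis l) z ^+ 2))).
  by apply: eq_Rintegral => z _; rewrite dotDl !dot_basis; field.
rewrite (eZ _ (integB (integB (i2 _) (i2 _)) (i2 _))) (eB (integB (i2 _) (i2 _)) (i2 _)) (eB (i2 _) (i2 _)) !E.
rewrite dotDl !dotDr !dot_basis /basis !eqxx [l == k]eq_sym; by field.
Qed.

Lemma gauss_sqr_norm : \int[gam]_z (enorm z ^+ 2) = d%:R.
Proof.
under eq_Rintegral do rewrite enorm_sqr /dot.
rewrite esumr; last by move=> k; apply: ig; apply: expgM; exact: expg_coord.
under eq_bigr do rewrite gauss_cov eqxx.
by rewrite sumr_const card_ord.
Qed.

Lemma e_norm_sqrt dT (T : measurableType dT) (P : probability T R) (f : T -> R) (D : R) :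
  0 < D -> integ P (fun w => f w ^+ 2) -> measurable_fun setT f ->
  \int[P]_w (f w ^+ 2) <= D ^+ 2 -> integ P f /\ \int[P]_w `|f w| <= D.
Proof.
move=> D0 i2 mf fD; have D2 : 0 < 2 * D by rewrite mulr_gt0.
have ib : integ P (fun w => (2 * D)^-1 * f w ^+ 2 + D / 2).
  by apply: integD; [exact: integZ|exact: integ_cst].
have le w : `|f w| <= (2 * D)^-1 * f w ^+ 2 + D / 2.
  rewrite -[f w ^+ 2]real_normK ?num_real// -subr_ge0.
  have -> : (2 * D)^-1 * `|f w| ^+ 2 + D / 2 - `|f w| = (`|f w| - D) ^+ 2 / (2 * D).
    by field; rewrite gt_eqF.
  by rewrite divr_ge0 ?sqr_ge0// ltW.
have iF : integ P f by exact: (integ_le mf ib le).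
split => //; apply: (@le_trans _ _ (\int[P]_w ((2 * D)^-1 * f w ^+ 2 + D / 2))).
  by apply: e_le => //; exact: integrable_norm.
rewrite (eD (integZ _ i2) (integ_cst _ _)) (eZ _ i2) ecst.
apply: (@le_trans _ _ ((2 * D)^-1 * D ^+ 2 + D / 2)).
  by rewrite lerD2r ler_wpM2l// invr_ge0 ltW.
by rewrite le_eqVlt; apply/orP; left; apply/eqP; field; rewrite gt_eqF.
Qed.

(** Averaging a quadratic form over a standard Gaussian direction gives its trace, so this integral
    is the Laplacian of [sm s h]. *)
Lemma Lap_coord s h x : expg h ->
  \int[gam]_z D2 gam s h z x = \sum_k wsm gam (w2c s k k) s h x.
Proof.
move=> eh; under eq_Rintegral do rewrite (D2_coord gam_box s _ _ eh).
have ikl (k l : 'I_d) : integ gam (fun z => z k * z l).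
  by apply: ig; apply: expgM; exact: expg_coord.
have iw k l : integ gam (fun z => z k * z l * wsm gam (w2c s k l) s h x).
  by under eq_fun do rewrite mulrC; exact: integZ.
rewrite esumr; last by move=> k; exact: integ_sum.
apply: eq_bigr => k _; rewrite esumr// (bigD1 k)//= big1 ?addr0.
  under eq_Rintegral do rewrite mulrC.
  by rewrite (eZ _ (ikl k k)) gauss_cov eqxx mulr1.
move=> l lk; under eq_Rintegral do rewrite mulrC.
by rewrite (eZ _ (ikl k l)) gauss_cov eq_sym (negbTE lk) mulr0.
Qed.
End gauss_moments.

Section stein_sum.
Variables (R : realType) (d : nat) (gam : probability ('I_d -> R) R).
Hypothesis gam_box : forall B : 'I_d -> set R, (forall k, measurable (B k)) ->
  gam (box B) = (\prod_k (@normal_prob R 0 1) (B k))%E.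
Context dT (T : measurableType dT) (P : probability T R) (n : nat) (X : 'I_n -> 'I_d -> T -> R).
Hypotheses (n0 : (0 < n)%N) (mX : forall i k, measurable_fun setT (X i k)) (iX : indep_vectors P X).
Variable beta : R.
Hypothesis Xb : forall i w, enorm (fun k => X i k w) <= beta.
Hypothesis X0 : forall i k, \int[P]_w X i k w = 0.
Hypothesis Xcov : forall k l, \int[P]_w (Wsum X w k * Wsum X w l) = (k == l)%:R.

Let c : R := (Num.sqrt n%:R)^-1.
Let xi := summand X c.
Let oth := others X c.
Let W := Wsum X.
Let delta : R := beta / Num.sqrt n%:R.

Let c0 : 0 < c. Proof. by rewrite invr_gt0 sqrtr_gt0 ltr0n. Qed.

Let mxi i : measurable_fun setT (xi i). Proof. exact: measurable_summand. Qed.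
Let moth i : measurable_fun setT (oth i). Proof. exact: measurable_others. Qed.
Let xiW i w : oth i w + xi i w = W w.
Proof. by rewrite addrC; exact: summand_others. Qed.

Lemma summand_le i w : enorm (xi i w) <= delta.
Proof.
have -> : xi i w = c *: (fun k => X i k w) by [].
by rewrite enormZ (gtr0_norm c0) mulrC ler_wpM2r ?(ltW c0).
Qed.

Let delta0 : 0 <= delta.
Proof.
have [w _] := probability_inhabited P.
exact: le_trans (enorm_ge0 _) (summand_le (Ordinal n0) w).
Qed.

Lemma W_sum w k : W w k = \sum_i xi i w k.
Proof. by rewrite /W /Wsum mulr_sumr. Qed.

Lemma measurable_W : measurable_fun setT W.
Proof.
apply/measurable_vecP => k; apply: measurable_funM => //.
by apply: measurable_sum => i; exact: mX.
Qed.

(** A deterministic bound far from sharp; it supplies integrability and enters no estimate. *)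
Definition Wbound : R := d%:R * (n%:R * delta).

Lemma W_le w : enorm (W w) <= Wbound.
Proof.
rewrite (le_trans (enorm_le_norm1 _))// /norm1 /Wbound.
rewrite -[X in X%:R * _]card_ord -sumr_const mulr_suml; apply: ler_sum => k _.
rewrite mul1r W_sum (le_trans (ler_norm_sum _ _ _))//.
rewrite -[X in X%:R * _]card_ord -sumr_const mulr_suml; apply: ler_sum => i _.
by rewrite mul1r (le_trans (coord_le_enorm _ _))// summand_le.
Qed.

Let i_xi i k : integ P (fun w => xi i w k).
Proof.
apply: (integ_bounded _ _ (B := delta)) => [|w].
  exact: (measurableT_comp (measurable_coord k) (mxi i)).
exact: le_trans (coord_le_enorm _ _) (summand_le i w).
Qed.

Let Wk_le w k : `|W w k| <= Wbound.
Proof. exact: le_trans (coord_le_enorm _ _) (W_le w). Qed.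

Let mxik i k : measurable_fun setT (fun w => xi i w k).
Proof. exact: (measurableT_comp (measurable_coord k) (mxi i)). Qed.

Let othk_le i w k : `|oth i w k| <= Wbound + delta.
Proof.
have -> : oth i w k = W w k - xi i w k.
  by rewrite -(xiW i w); change (oth i w k = oth i w k + xi i w k - xi i w k); rewrite addrK.
rewrite (le_trans (ler_normB _ _))// lerD//.
exact: le_trans (coord_le_enorm _ _) (summand_le i w).
Qed.

Let e_xi i k : \int[P]_w xi i w k = 0.
Proof.
have iXk : integ P (X i k).
  apply: (integ_bounded _ _ (B := beta)) => [|w]; first exact: mX.
  exact: le_trans (coord_le_enorm (fun k => X i k w) _) (Xb i w).
by rewrite /xi /summand (eZ _ iXk) X0 mulr0.
Qed.

Let i_xixi i k l : integ P (fun w => xi i w k * xi i w l).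
Proof.
apply: (integ_bounded _ _ (B := delta * delta)) => [|w]; first exact: measurable_funM.
by rewrite normrM ler_pM// (le_trans (coord_le_enorm _ _))// summand_le.
Qed.

(** Split one factor of [W W^T] into summands and the other as [xi i + oth i]: the mixed terms
    vanish by independence and centring, so the covariances of the summands add up to the
    identity. *)
Lemma cov_sum k l : \sum_i \int[P]_w (xi i w k * xi i w l) = (k == l)%:R.
Proof.
rewrite -Xcov.
have E w : Wsum X w k * Wsum X w l = \sum_i (xi i w k * xi i w l + xi i w k * oth i w l).
  rewrite [X in X * _]W_sum mulr_suml; apply: eq_bigr => i _.
  rewrite -mulrDr; congr (_ * _).
  by rewrite -[Wsum X w]/(W w) -(xiW i w) [RHS]addrC.
have moth_l i m : measurable_fun setT (fun w => oth i w m).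
  exact: (measurableT_comp (measurable_coord m) (moth i)).
have ixo i : integ P (fun w => xi i w k * oth i w l).
  apply: (integ_bounded _ _ (B := delta * (Wbound + delta))) => [|w]; first exact: measurable_funM.
  by rewrite normrM ler_pM// (le_trans (coord_le_enorm _ _))// summand_le.
under [RHS]eq_Rintegral do rewrite E.
rewrite esumr; last by move=> i; exact: integD.
apply: eq_bigr => i _; rewrite (eD (i_xixi i k l) (ixo i)).
have -> : \int[P]_w (xi i w k * oth i w l) = 0; last by rewrite addr0.
pose F (p : ('I_d -> R) * ('I_d -> R)) := p.1 k * p.2 l.
have mF : measurable_fun setT F.
  apply: measurable_funM.
    exact: (measurableT_comp (measurable_coord k) measurable_fst).
  exact: (measurableT_comp (measurable_coord l) measurable_snd).
have Fb w w' : `|F (xi i w, oth i w')| <= delta * (Wbound + delta).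
  by rewrite /F/= normrM ler_pM// (le_trans (coord_le_enorm _ _))// summand_le.
have io : integ P (fun w => oth i w l).
  by apply: (integ_bounded _ _ (B := Wbound + delta)) => // w.
rewrite (indep2_expectation (mxi i) (moth i) (indep2_summand_others mX iX c i) mF Fb) /F/=.
under eq_Rintegral do rewrite (eZ _ io) mulrC.
by rewrite (eZ _ (i_xi i k)) e_xi mulr0.
Qed.

(** The trace of [cov_sum], and the origin of the factor [d] next to [delta] in [stein_sum]. *)
Lemma sqr_sum : \sum_i \int[P]_w (enorm (xi i w) ^+ 2) = d%:R.
Proof.
transitivity (\sum_i \sum_k \int[P]_w (xi i w k * xi i w k)).
  apply: eq_bigr => i _; rewrite -esumr; last by move=> k.
  by apply: eq_Rintegral => w _; rewrite enorm_sqr.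
rewrite exchange_big/=.
under eq_bigr do rewrite cov_sum eqxx.
by rewrite sumr_const card_ord.
Qed.

Lemma W_sqr : \int[P]_w (enorm (W w) ^+ 2) = d%:R.
Proof.
have iWW k : integ P (fun w => W w k * W w k).
  apply: (integ_bounded _ _ (B := Wbound * Wbound)) => [|w].
    by apply: measurable_funM; exact: (measurableT_comp (measurable_coord k) measurable_W).
  by rewrite normrM ler_pM.
under eq_Rintegral do rewrite enorm_sqr /dot.
rewrite esumr//.
under eq_bigr do rewrite Xcov eqxx.
by rewrite sumr_const card_ord.
Qed.

Variables (a s bet : R) (h : ('I_d -> R) -> R).
Hypotheses (a0 : 0 <= a) (s0 : 0 < s) (h1 : lip 1 h) (bet0 : 0 <= bet).
Hypothesis Ybet : forall i Phi m, kfun gam Phi m -> 0 <= m ->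
  measurable_fun setT (Phi s h) -> `|\int[P]_w Phi s h (a *: oth i w)| <= m * bet.

Notation D1 := (D1 gam).
Notation D2 := (D2 gam).

(** Both terms are distributed over the summands: the drift because [D1] is linear in the direction,
    the Laplacian because the covariances add up to the identity, which makes it a sum of [D2]
    averaged over independent copies of the summands. [stein_term] compares them one by one. *)
Lemma stein_sum : `|\int[P]_w D1 s h (W w) (a *: W w)
    - a * \int[P]_w \int[gam]_z D2 s h z (a *: W w)| <= 4 * a ^+ 2 * delta * bet * d%:R.
Proof.
have eh := expg_lip h1.
have maW : measurable_fun setT (fun w => a *: W w) by apply: measurable_vecZ; exact: measurable_W.
have aW i w : a *: W w = a *: oth i w + a *: xi i w by rewrite -(xiW i w) scalerDr.
have iD1 i : integ P (fun w => D1 s h (xi i w) (a *: W w)).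
  apply: (integ_bounded _ _ (B := delta + delta ^+ 2 / s)) => [|w].
    exact: (measurable_D1 gam_box s ler01 h1 (mxi i) maW).
  have xd := summand_le i w.
  rewrite (le_trans (D1_bounded gam_box _ _ h1 s0))// lerD// ler_wpM2r ?invr_ge0 ?(ltW s0)//.
  by rewrite lerXn2r ?nnegrE ?enorm_ge0.
have E1 : \int[P]_w D1 s h (W w) (a *: W w) = \sum_i \int[P]_w D1 s h (xi i w) (a *: oth i w + a *: xi i w).
  transitivity (\int[P]_w \sum_i D1 s h (xi i w) (a *: W w)).
    apply: eq_Rintegral => w _; rewrite (D1_coord gam_box s _ _ eh).
    under eq_bigr do rewrite W_sum mulr_suml.
    rewrite exchange_big/=; apply: eq_bigr => i _.
    by rewrite (D1_coord gam_box s _ _ eh).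
  rewrite (esumr _ iD1); apply: eq_bigr => i _; apply: eq_Rintegral => w _.
  exact: (congr1 (D1 s h (xi i w)) (aW i w)).
have wl k l := wsm_lip gam_box s ler01 h1 (expg_w2c s k l).
have iw k l : integ P (fun w => wsm gam (w2c s k l) s h (a *: W w)).
  pose Lkl := 1 * \int[gam]_z `|w2c s k l z|.
  have L0 : 0 <= Lkl by rewrite /Lkl mul1r Rintegral_ge0.
  apply: (integ_bounded _ _ (B := `|wsm gam (w2c s k l) s h 0| + Lkl * (a * Wbound))) => [|w].
    exact: (measurableT_comp (lip_measurable (wl k l)) maW).
  rewrite -[X in `|X|](subrK (wsm gam (w2c s k l) s h 0)) addrC (le_trans (ler_normD _ _))// lerD2l.
  rewrite (le_trans (wl k l _ _))// subr0 ler_wpM2l// enormZ (ger0_norm a0) ler_wpM2l//.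
  exact: W_le.
have E2 : \int[P]_w \int[gam]_z D2 s h z (a *: W w) =
    \sum_i \int[P]_w' \int[P]_w D2 s h (xi i w') (a *: oth i w + a *: xi i w).
  pose b k l := \int[P]_w wsm gam (w2c s k l) s h (a *: W w).
  have delta_sum (u v : 'I_d -> R) k : (forall l, u l = (k == l)%:R) -> \sum_l u l * v l = v k.
    move=> uE; rewrite (bigD1 k)//= uE eqxx mul1r big1 ?addr0// => l lk.
    by rewrite uE eq_sym (negbTE lk) mul0r.
  transitivity (\sum_k b k k).
    under eq_Rintegral do rewrite (Lap_coord gam_box s _ eh).
    by rewrite esumr.
  transitivity (\sum_i \sum_k \sum_l \int[P]_w (xi i w k * xi i w l) * b k l).
    rewrite exchange_big/=; apply: eq_bigr => k _.
    rewrite exchange_big/= -[LHS](delta_sum _ (b k) k (cov_sum k)).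
    by apply: eq_bigr => l _; rewrite mulr_suml.
  apply: eq_bigr => i _.
  transitivity (\int[P]_w' \sum_k \sum_l (xi i w' k * xi i w' l) * b k l).
    have ib k l : integ P (fun w => xi i w k * xi i w l * b k l).
      by under eq_fun do rewrite mulrC; exact: integZ.
    rewrite esumr; last by move=> k; exact: integ_sum.
    apply: eq_bigr => k _; rewrite esumr//; apply: eq_bigr => l _.
    under [RHS]eq_Rintegral do rewrite mulrC.
    by rewrite (eZ _ (i_xixi i k l)) mulrC.
  apply: eq_Rintegral => w' _.
  transitivity (\int[P]_w \sum_k \sum_l (xi i w' k * xi i w' l) * wsm gam (w2c s k l) s h (a *: W w)).
    rewrite esumr; last by move=> k; apply: integ_sum => l; exact: integZ.
    apply: eq_bigr => k _; rewrite esumr; last by move=> l; exact: integZ.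
    by apply: eq_bigr => l _; rewrite (eZ _ (iw k l)).
  by apply: eq_Rintegral => w _; rewrite -aW (D2_coord gam_box s _ _ eh).
rewrite E1 E2 mulr_sumr -sumrB (le_trans (ler_norm_sum _ _ _))//.
rewrite -sqr_sum mulr_sumr; apply: ler_sum => i _.
exact: (stein_term gam_box (mxi i) (moth i) (indep2_summand_others mX iX c i)
  (summand_le i) (e_xi i) a0 s0 h1 bet0 (@Ybet i)).
Qed.
End stein_sum.

Lemma half_le (R : realType) (q v : R) : q <= 1 / 2 -> 1 / 2 <= 1 - (v + q) + v.
Proof. by lra. Qed.

(** * Interpolation between the sum and the Gaussian *)

Section path.
Variables (R : realType) (d : nat) (gam : probability ('I_d -> R) R).
Hypothesis gam_box : forall B : 'I_d -> set R, (forall k, measurable (B k)) ->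
  gam (box B) = (\prod_k (@normal_prob R 0 1) (B k))%E.
Context dT (T : measurableType dT) (P : probability T R) (n : nat) (X : 'I_n -> 'I_d -> T -> R).
Hypotheses (n0 : (0 < n)%N) (mX : forall i k, measurable_fun setT (X i k)) (iX : indep_vectors P X).
Variable beta : R.
Hypothesis Xb : forall i w, enorm (fun k => X i k w) <= beta.
Hypothesis X0 : forall i k, \int[P]_w X i k w = 0.
Hypothesis Xcov : forall k l, \int[P]_w (Wsum X w k * Wsum X w l) = (k == l)%:R.

Let oth := others X (Num.sqrt n%:R)^-1.
Let W := Wsum X.
Let delta : R := beta / Num.sqrt n%:R.
Let ig := expg_integ gam_box.
Let mW : measurable_fun setT W. Proof. exact: measurable_W. Qed.
Let B : R := Wbound d n beta.
Let WB w : enorm (W w) <= B. Proof. exact: W_le. Qed.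

Variable h : ('I_d -> R) -> R.
Hypothesis h1 : lip 1 h.
Let eh := expg_lip h1.

Notation sm := (sm gam).
Notation D1 := (D1 gam).
Notation D2 := (D2 gam).

Lemma integ_lip_W L f (a : R) : 0 <= L -> lip L f -> integ P (fun w => f (a *: W w)).
Proof.
move=> L0 fL.
apply: (integ_bounded _ _ (B := `|f 0| + L * (`|a| * B))) => [|w].
  exact: (measurableT_comp (lip_measurable fL) (measurable_vecZ a mW)).
rewrite -[f (_ *: _)](subrK (f 0)) addrC (le_trans (ler_normD _ _))// lerD2l.
by rewrite (le_trans (fL _ _))// ler_wpM2l// subr0 enormZ ler_wpM2l.
Qed.

Let i_enorm2 : integ P (fun w => enorm (W w) ^+ 2).
Proof.
apply: (integ_bounded _ _ (B := B ^+ 2)) => [|w].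
  by apply: measurable_funX; exact: (measurableT_comp (@measurable_enorm R d) mW).
rewrite ger0_norm ?sqr_ge0// lerXn2r ?nnegrE ?enorm_ge0//.
exact: le_trans (enorm_ge0 _) (WB w).
Qed.

(* [path_mean 0] is the mean of [h] at the sum, [path_mean 1] its mean under the Gaussian law. *)
Definition path_mean (v : R) : R := \int[P]_w sm (Num.sqrt v) h (Num.sqrt (1 - v) *: W w).
Definition Lap s x : R := \int[gam]_z D2 s h z x.
Let C3 : R := \int[gam]_z (enorm z ^+ 3).

Let i_e3 : integ gam (fun z => enorm z ^+ 3).
Proof. by apply: ig; exact: (expgX 3 (@expg_enorm R d)). Qed.

Let i_e2 : integ gam (fun z => enorm z ^+ 2).
Proof. by apply: ig; exact: (expgX 2 (@expg_enorm R d)). Qed.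

Let i_D2z s x : 0 < s -> integ gam (fun z => D2 s h z x).
Proof.
move=> s0; apply: (integ_le (g := fun z => s^-1 * enorm z ^+ 2 + 2 / s ^+ 2 * enorm z ^+ 3)).
- apply: (measurable_D2 gam_box s ler01 h1); [exact: measurable_id|exact: measurable_cst].
- by apply: integD; exact: integZ.
- move=> z; rewrite (le_trans (D2_bounded gam_box z x h1 s0))//.
  by rewrite le_eqVlt; apply/orP; left; apply/eqP; ring.
Qed.

Lemma D1_scale s u x (e : R) : D1 s h (e *: u) x = e * D1 s h u x.
Proof.
rewrite /D1 /wsm -eZ; last by apply: (integ_w gam_box) => //; exact: expg_w1.
by apply: eq_Rintegral => z _; rewrite dotZl; ring.
Qed.

Lemma D2_scale s u x (e : R) : D2 s h (e *: u) x = e ^+ 2 * D2 s h u x.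
Proof.
rewrite /D2 /wsm -eZ; last by apply: (integ_w gam_box) => //; exact: expg_w2.
by apply: eq_Rintegral => z _; rewrite dotZl dotZl dotZr; ring.
Qed.

Lemma e_D1z s x : \int[gam]_z D1 s h z x = 0.
Proof.
under eq_Rintegral do rewrite (D1_coord gam_box s _ _ eh).
have ik (k : 'I_d) : integ gam (fun z => z k) by apply: ig; exact: expg_coord.
rewrite esumr; last by move=> k; under eq_fun do rewrite mulrC; exact: integZ.
apply: big1 => k _; under eq_Rintegral do rewrite mulrC.
by rewrite (eZ _ (ik k)) (gauss_mean gam_box) mulr0.
Qed.

(** Expand in the extra Gaussian displacement [e *: z]: the first order averages out, the second
    gives the Laplacian, and the third costs the moment [C3]. *)
Lemma sm_increment s x (e : R) : 0 < s -> 0 <= e ->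
  `|sm e (sm s h) x - sm s h x - e ^+ 2 / 2 * Lap s x| <= 2 * e ^+ 3 / s ^+ 2 * C3.
Proof.
move=> s0 e0.
have glip := sm_lip gam_box s ler01 h1.
have i1 := integ_s gam_box e x (expg_lip glip).
have iD1 : integ gam (fun z => D1 s h z x).
  apply: (integ_le (g := fun z => enorm z + s^-1 * enorm z ^+ 2)).
  - by apply: (measurable_D1 gam_box s ler01 h1); [exact: measurable_id|exact: measurable_cst].
  - by apply: integD; [apply: ig; exact: expg_enorm|exact: integZ].
  - by move=> z; rewrite (le_trans (D1_bounded gam_box z x h1 s0))// mulrC.
have iD2 := i_D2z x s0.
have -> : sm e (sm s h) x - sm s h x - e ^+ 2 / 2 * Lap s x =
    \int[gam]_z (sm s h (x + e *: z) - sm s h x - e * D1 s h z x - e ^+ 2 / 2 * D2 s h z x).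
  rewrite (eB (integB (integB i1 (integ_cst _ _)) (integZ e iD1)) (integZ _ iD2)).
  rewrite (eB (integB i1 (integ_cst _ _)) (integZ e iD1)) (eB i1 (integ_cst _ _)) ecst.
  by rewrite (eZ e iD1) (eZ _ iD2) e_D1z mulr0 subr0.
rewrite -(eZ _ i_e3); apply: e_norm_le; [|exact: integZ|].
  exact: (integB (integB (integB i1 (integ_cst _ _)) (integZ e iD1)) (integZ _ iD2)).
move=> z; have := sm_taylor gam_box x (e *: z) ler01 h1 s0.
rewrite D1_scale D2_scale enormZ (ger0_norm e0) exprMn mulr1.
have -> : e ^+ 2 * D2 s h z x / 2 = e ^+ 2 / 2 * D2 s h z x by ring.
by move=> H; rewrite (le_trans H)// le_eqVlt; apply/orP; left; apply/eqP; ring.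
Qed.

Lemma Lap_le s0 s x : 0 < s0 -> s0 <= s ->
  `|Lap s x| <= s0^-1 * d%:R + 2 / s0 ^+ 2 * C3.
Proof.
move=> s00 s0s; have sp : 0 < s by exact: lt_le_trans s0s.
rewrite -(gauss_sqr_norm gam_box) -(eZ _ i_e2) -(eZ _ i_e3) -(eD (integZ _ i_e2) (integZ _ i_e3)).
apply: e_norm_le; [exact: i_D2z|by apply: integD; exact: integZ|].
move=> z; rewrite (le_trans (D2_bounded gam_box z x h1 sp))//.
have hi : s^-1 <= s0^-1 by rewrite lef_pV2 ?posrE.
have hi2 : s ^- 2 <= s0 ^- 2 by rewrite lef_pV2 ?posrE ?exprn_gt0// lerXn2r ?nnegrE ?(ltW s00) ?(ltW sp).
rewrite lerD//; first by rewrite mulrC ler_wpM2r// sqr_ge0.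
rewrite mulrAC ler_wpM2r ?exprn_ge0 ?enorm_ge0//.
by rewrite ler_wpM2l.
Qed.

Let i_Lap s (a : R) : 0 < s -> integ P (fun w => Lap s (a *: W w)).
Proof.
move=> s0; rewrite (_ : (fun w => _) = fun w => \sum_k wsm gam (w2c s k k) s h (a *: W w)); last first.
  by apply/funext => w; rewrite /Lap (Lap_coord gam_box).
apply: integ_sum => k.
apply: (integ_lip_W a _ (wsm_lip gam_box s ler01 h1 (expg_w2c s k k))).
by rewrite mul1r Rintegral_ge0.
Qed.

Let i_D1W s (a : R) : 0 < s -> integ P (fun w => D1 s h (W w) (a *: W w)).
Proof.
move=> s0; apply: (integ_bounded _ _ (B := B + B ^+ 2 / s)) => [|w].
  exact: (measurable_D1 gam_box s ler01 h1 mW (measurable_vecZ a mW)).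
rewrite (le_trans (D1_bounded gam_box _ _ h1 s0))// lerD// ler_wpM2r ?invr_ge0 ?(ltW s0)//.
rewrite lerXn2r ?nnegrE ?enorm_ge0//; exact: le_trans (enorm_ge0 _) (WB w).
Qed.

(** A first-order expansion suffices here, since the scale changes only by O(e^2) in a step of
    variance [e^2]. *)
Lemma scale_increment s (a a' : R) : 0 < s ->
  `|\int[P]_w sm s h (a *: W w) - \int[P]_w sm s h (a' *: W w)
     - (a - a') * \int[P]_w D1 s h (W w) (a' *: W w)| <= (a - a') ^+ 2 * d%:R / s.
Proof.
move=> s0; have glip := sm_lip gam_box s ler01 h1.
have j1 := integ_lip_W a ler01 glip; have j2 := integ_lip_W a' ler01 glip.
have j3 := i_D1W a' s0.
rewrite -(eZ _ j3) -(eB j1 j2) -(eB (integB j1 j2) (integZ _ j3)).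
have -> : (a - a') ^+ 2 * d%:R / s = \int[P]_w ((a - a') ^+ 2 / s * enorm (W w) ^+ 2).
  by rewrite (eZ _ i_enorm2) (W_sqr n0 mX Xb Xcov); ring.
apply: e_norm_le; [exact: (integB (integB j1 j2) (integZ _ j3))|exact: integZ|].
move=> w; have := sm_taylor0 gam_box (a' *: W w) ((a - a') *: W w) ler01 h1 s0.
rewrite -scalerDl [a' + _]addrC subrK D1_scale enormZ mul1r exprMn real_normK ?num_real//.
by move=> H; rewrite (le_trans H)// mulrAC.
Qed.

Variables (bet : R -> R) (v0 v1 : R).
Hypotheses (v00 : 0 < v0) (v11 : v1 < 1).
Hypothesis bet0 : forall s, 0 < s -> 0 <= bet s.
Hypothesis Hbet : forall (a s : R) i Phi m, 0 < a -> a <= 1 -> 0 < s -> 1 / 2 <= a ^+ 2 + s ^+ 2 ->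
  kfun gam Phi m -> 0 <= m -> measurable_fun setT (Phi s h) ->
  `|\int[P]_w Phi s h (a *: oth i w)| <= m * bet s.

(** A step adds variance [e^2] to the smoothing and shrinks the scale from [a] to [a' = a - lam]. As
    [e^2 = lam * (2 * a' + lam)], the Laplacian term [e^2 / 2 * IL] and the drift term [lam * ID]
    combine into [lam] times the Stein difference [ID - a' * IL], up to [lam^2 / 2 * IL]. [K] may
    depend on [d], [v0] and [v1], since telescoping removes it. *)
Lemma path_step : exists2 K, 0 <= K & forall v e, v0 <= v -> 0 <= e -> v + e ^+ 2 <= v1 ->
  e ^+ 2 <= 1 / 2 ->
  `|path_mean (v + e ^+ 2) - path_mean v| <= 2 * delta * d%:R * bet (Num.sqrt v) * e ^+ 2 + K * e ^+ 3.
Proof.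
pose s0 := Num.sqrt v0; pose a1 := Num.sqrt (1 - v1).
have s00 : 0 < s0 by rewrite sqrtr_gt0.
have a10 : 0 < a1 by rewrite sqrtr_gt0 subr_gt0.
have C30 : 0 <= C3 by apply: Rintegral_ge0 => z _; rewrite exprn_ge0// enorm_ge0.
pose C2 := s0^-1 * d%:R + 2 / s0 ^+ 2 * C3.
have C20 : 0 <= C2 by rewrite addr_ge0// !mulr_ge0 ?invr_ge0 ?exprn_ge0// ltW.
exists (2 / s0 ^+ 2 * C3 + (d%:R / s0 + C2 / 2) / a1 ^+ 2).
  rewrite addr_ge0// ?divr_ge0 ?exprn_ge0 ?(ltW a10)//.
    by rewrite mulr_ge0// divr_ge0 ?exprn_ge0 ?(ltW s00).
  by rewrite addr_ge0// divr_ge0// ltW.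
move=> v e v0v e0 vev1 e12.
have e2 : 0 <= e ^+ 2 by exact: sqr_ge0.
have e1 : e <= 1 by nra.
set s := Num.sqrt v; set a := Num.sqrt (1 - v); set a' := Num.sqrt (1 - (v + e ^+ 2)).
have vp : 0 < v by exact: lt_le_trans v0v.
have sp : 0 < s by rewrite sqrtr_gt0.
have s0s : s0 <= s by rewrite ler_wsqrtr.
have a1a' : a1 <= a' by rewrite ler_wsqrtr// lerD2l lerN2.
have a'a : a' <= a by rewrite ler_wsqrtr// lerD2l lerN2 lerDl.
have a'p : 0 < a' by exact: lt_le_trans a1a'.
have s2 : s ^+ 2 = v by rewrite sqr_sqrtr// ltW.
have a2 : a ^+ 2 = 1 - v by rewrite sqr_sqrtr//; move: vev1 e2 v11; lra.
have a'2 : a' ^+ 2 = 1 - (v + e ^+ 2) by rewrite sqr_sqrtr//; move: vev1 e2 v11; lra.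
have a'1 : a' <= 1 by rewrite -ler_sqr ?nnegrE ?(ltW a'p)// a'2 expr1n; lra.
set lam := a - a'.
have lam0 : 0 <= lam by rewrite subr_ge0.
have lamE : lam * (a + a') = e ^+ 2.
  have -> : lam * (a + a') = a ^+ 2 - a' ^+ 2 by rewrite /lam; ring.
  by rewrite a2 a'2; ring.
have lame : lam * a1 <= e ^+ 2.
  rewrite -lamE ler_wpM2l// (le_trans a1a')// lerDr; apply: le_trans a'a; exact: ltW.
have lamle : lam ^+ 2 <= e ^+ 3 / a1 ^+ 2.
  rewrite ler_pdivlMr ?exprn_gt0// -exprMn.
  apply: (@le_trans _ _ (e ^+ 2 ^+ 2)).
    by rewrite lerXn2r ?nnegrE// mulr_ge0// ltW.
  have -> : e ^+ 2 ^+ 2 = e ^+ 3 * e by ring.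
  by rewrite ler_piMr// exprn_ge0.
have lama' : 2 * (lam * a') <= e ^+ 2 by rewrite -lamE /lam; nra.
pose I1 := \int[P]_w sm s h (a *: W w); pose I2 := \int[P]_w sm s h (a' *: W w).
pose ID := \int[P]_w D1 s h (W w) (a' *: W w); pose IL := \int[P]_w Lap s (a' *: W w).
have MvE : path_mean v = I1 by [].
have glip := sm_lip gam_box s ler01 h1.
have j2 := integ_lip_W a' ler01 glip.
have jL := i_Lap a' sp.
have hA : `|path_mean (v + e ^+ 2) - I2 - e ^+ 2 / 2 * IL| <= 2 * e ^+ 3 / s ^+ 2 * C3.
  have -> : path_mean (v + e ^+ 2) = \int[P]_w sm e (sm s h) (a' *: W w).
    apply: eq_Rintegral => w _; rewrite (sm_sm gam_box)//.
    by rewrite s2.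
  have jm := integ_lip_W a' ler01 (sm_lip gam_box e ler01 glip).
  rewrite -(eZ _ jL) -(eB jm j2) -(eB (integB jm j2) (integZ _ jL)).
  apply: e_norm_cst; first exact: (integB (integB jm j2) (integZ _ jL)).
  by move=> w; exact: sm_increment.
have hB := scale_increment a a' sp; rewrite -/I1 -/I2 -/ID -/lam in hB.
have hC : `|ID - a' * IL| <= 4 * a' ^+ 2 * delta * bet s * d%:R.
  apply: (stein_sum gam_box n0 mX iX Xb X0 Xcov (ltW a'p) sp h1 (bet0 sp)).
  (* The scale belongs to [v + e^2] but the smoothing to [v], so the two variances add up to
     [1 - e^2], which is at least 1/2. *)
  move=> i Phi m; apply: Hbet => //.
  by rewrite a'2 s2; exact: half_le.
have hL : `|IL| <= C2.
  by apply: e_norm_cst => // w; exact: Lap_le.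
have dp : 0 <= delta.
  have [w _] := probability_inhabited P.
  exact: le_trans (enorm_ge0 _) (summand_le n0 Xb (Ordinal n0) w).
rewrite MvE.
have -> : path_mean (v + e ^+ 2) - I1 = (path_mean (v + e ^+ 2) - I2 - e ^+ 2 / 2 * IL)
   - (I1 - I2 - lam * ID) - lam * (ID - a' * IL) + lam ^+ 2 / 2 * IL.
  have -> : e ^+ 2 = lam * (2 * a' + lam) by rewrite -lamE /lam; ring.
  by field.
have bs := bet0 sp.
have kk : 0 <= delta * d%:R * bet s := mulr_ge0 (mulr_ge0 dp (ler0n _ _)) bs.
have t1 : 2 * e ^+ 3 / s ^+ 2 * C3 <= 2 / s0 ^+ 2 * C3 * e ^+ 3.
  have -> : 2 * e ^+ 3 / s ^+ 2 * C3 = (2 * C3 * e ^+ 3) * s ^- 2 by ring.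
  have -> : 2 / s0 ^+ 2 * C3 * e ^+ 3 = (2 * C3 * e ^+ 3) * s0 ^- 2 by ring.
  rewrite ler_wpM2l ?mulr_ge0 ?exprn_ge0//.
  by rewrite lef_pV2 ?posrE ?exprn_gt0// lerXn2r ?nnegrE ?(ltW s00) ?(ltW sp).
have t2 : lam ^+ 2 * d%:R / s <= d%:R / s0 / a1 ^+ 2 * e ^+ 3.
  have -> : d%:R / s0 / a1 ^+ 2 * e ^+ 3 = e ^+ 3 / a1 ^+ 2 * (d%:R / s0) by ring.
  rewrite -mulrA ler_pM ?sqr_ge0 ?divr_ge0 ?(ltW sp)//.
  by rewrite ler_wpM2l// lef_pV2 ?posrE.
have t3 : `|lam * (ID - a' * IL)| <= 2 * delta * d%:R * bet s * e ^+ 2.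
  rewrite normrM (ger0_norm lam0) (le_trans (ler_wpM2l lam0 hC))//.
  have -> : lam * (4 * a' ^+ 2 * delta * bet s * d%:R) = (2 * (lam * a')) * a' * (2 * (delta * d%:R * bet s)) by ring.
  have -> : 2 * delta * d%:R * bet s * e ^+ 2 = e ^+ 2 * (2 * (delta * d%:R * bet s)) by ring.
  apply: ler_wpM2r; first exact: mulr_ge0.
  apply: (@le_trans _ _ (2 * (lam * a'))) => //.
  by apply: ler_piMr => //; rewrite !mulr_ge0// ltW.
have t4 : `|lam ^+ 2 / 2 * IL| <= C2 / 2 / a1 ^+ 2 * e ^+ 3.
  rewrite normrM ger0_norm ?divr_ge0 ?sqr_ge0//.
  have -> : C2 / 2 / a1 ^+ 2 * e ^+ 3 = e ^+ 3 / a1 ^+ 2 / 2 * C2 by ring.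
  by rewrite ler_pM ?divr_ge0 ?sqr_ge0// ler_wpM2r.
have -> : 2 * delta * d%:R * bet s * e ^+ 2 + (2 / s0 ^+ 2 * C3 + (d%:R / s0 + C2 / 2) / a1 ^+ 2) * e ^+ 3 =
  2 / s0 ^+ 2 * C3 * e ^+ 3 + d%:R / s0 / a1 ^+ 2 * e ^+ 3 + 2 * delta * d%:R * bet s * e ^+ 2 + C2 / 2 / a1 ^+ 2 * e ^+ 3 by ring.
rewrite (le_trans (ler_normD _ _))// lerD//.
rewrite (le_trans (ler_normB _ _))// lerD//.
rewrite (le_trans (ler_normB _ _))// lerD//; first exact: le_trans hA t1.
exact: le_trans hB t2.
Qed.
End path.

(** * The gap for Lipschitz functions and its self-bounding inequality *)

Section wasserstein_gap.
Variables (R : realType) (d : nat) (gam : probability ('I_d -> R) R).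
Hypothesis gam_box : forall B : 'I_d -> set R, (forall k, measurable (B k)) ->
  gam (box B) = (\prod_k (@normal_prob R 0 1) (B k))%E.
Context dT (T : measurableType dT) (P : probability T R) (n : nat) (X : 'I_n -> 'I_d -> T -> R).
Hypotheses (n0 : (0 < n)%N) (mX : forall i k, measurable_fun setT (X i k)) (iX : indep_vectors P X).
Variable beta : R.
Hypothesis Xb : forall i w, enorm (fun k => X i k w) <= beta.
Hypothesis X0 : forall i k, \int[P]_w X i k w = 0.
Hypothesis Xcov : forall k l, \int[P]_w (Wsum X w k * Wsum X w l) = (k == l)%:R.
Hypothesis d0 : (0 < d)%N.

Let xi := summand X (Num.sqrt n%:R)^-1.
Let oth := others X (Num.sqrt n%:R)^-1.
Let W := Wsum X.
Let delta : R := beta / Num.sqrt n%:R.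
Let ig := expg_integ gam_box.
Let mW : measurable_fun setT W. Proof. exact: measurable_W. Qed.

Notation sm := (sm gam).
Notation path_mean := (path_mean gam P X).

Let sd : R := Num.sqrt d%:R.
Let sd0 : 0 < sd. Proof. by rewrite sqrtr_gt0 ltr0n. Qed.
Let sd2 : sd ^+ 2 = d%:R. Proof. by rewrite sqr_sqrtr. Qed.
Let sn0 : 0 < Num.sqrt n%:R :> R. Proof. by rewrite sqrtr_gt0 ltr0n. Qed.

Lemma delta_ge0 : 0 <= delta.
Proof.
have [w _] := probability_inhabited P.
exact: le_trans (enorm_ge0 _) (summand_le n0 Xb (Ordinal n0) w).
Qed.

(** The [n] second moments are at most [delta^2] each and add up to [d], so the hypotheses force
    [beta >= sqrt d]. Cutting the path at [v0 = 1 / n] thus costs only O(delta). *)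
Lemma sqrt_dim_le_delta : sd <= delta * Num.sqrt n%:R.
Proof.
have dn : 0 <= delta * Num.sqrt n%:R := mulr_ge0 delta_ge0 (ltW sn0).
rewrite -ler_sqr ?nnegrE ?(ltW sd0)// sd2 exprMn sqr_sqrtr//.
rewrite -(sqr_sum n0 mX iX Xb X0 Xcov) mulrC.
rewrite -[X in X%:R * _]card_ord -sumr_const mulr_suml; apply: ler_sum => i _; rewrite mul1r.
rewrite -[leRHS](ecst P); apply: e_le; [|exact: integ_cst|].
  apply: (integ_bounded _ _ (B := delta ^+ 2)) => [|w].
    apply: measurable_funX; apply: (measurableT_comp (@measurable_enorm R d)).
    exact: measurable_summand.
  by rewrite ger0_norm ?sqr_ge0// lerXn2r ?nnegrE ?enorm_ge0 ?delta_ge0// summand_le.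
by move=> w; rewrite lerXn2r ?nnegrE ?enorm_ge0 ?delta_ge0// summand_le.
Qed.

Let eW : integ P (fun w => enorm (W w)) /\ \int[P]_w enorm (W w) <= sd.
Proof.
have i2 : integ P (fun w => enorm (W w) ^+ 2).
  apply: (integ_bounded _ _ (B := Wbound d n beta ^+ 2)) => [|w].
    by apply: measurable_funX; exact: (measurableT_comp (@measurable_enorm R d) mW).
  have WB := W_le n0 Xb w.
  rewrite ger0_norm ?sqr_ge0// lerXn2r ?nnegrE ?enorm_ge0//.
  exact: le_trans (enorm_ge0 _) WB.
have [] := e_norm_sqrt sd0 i2 (measurableT_comp (@measurable_enorm R d) mW) _.
  by rewrite (W_sqr n0 mX Xb Xcov) sd2.
move=> iW le; split=> //; apply: le_trans le; apply: e_le => //.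
  exact: integrable_norm.
by move=> w; exact: ler_norm.
Qed.

Let eZn : integ gam (@enorm R d) /\ \int[gam]_z enorm z <= sd.
Proof.
have i2 : integ gam (fun w => enorm w ^+ 2) by apply: ig; exact: (expgX 2 (@expg_enorm R d)).
have [] := e_norm_sqrt sd0 i2 (@measurable_enorm R d) _.
  by rewrite (gauss_sqr_norm gam_box) sd2.
move=> iW le; split=> //; apply: le_trans le; apply: e_le => //.
  exact: integrable_norm.
by move=> w; exact: ler_norm.
Qed.

Lemma integ_lip_W1 L f : 0 <= L -> lip L f -> integ P (fun w => f (W w)).
Proof.
move=> L0 fL; have := integ_lip_W P n0 mX Xb 1 L0 fL.
by congr integ; apply/funext => w; rewrite scale1r.
Qed.

Definition gap (f : ('I_d -> R) -> R) : R := \int[P]_w f (W w) - \int[gam]_z f z.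

(** Compare both means with [f 0]. This makes the supremum of the gap finite, as the absorption
    argument requires, and covers the regimes where no useful [v0] exists. *)
Lemma gap_trivial f : lip 1 f -> `|gap f| <= 2 * sd.
Proof.
move=> f1; have [iW eWl] := eW; have [iZ eZl] := eZn.
have iF := integ_lip_W1 ler01 f1; have ifz := ig (expg_lip f1).
have -> : gap f = \int[P]_w (f (W w) - f 0) - \int[gam]_z (f z - f 0).
  by rewrite (eB iF (integ_cst _ _)) (eB ifz (integ_cst _ _)) !ecst /gap; ring.
have fb x : `|f x - f 0| <= enorm x by have := f1 x 0; rewrite mul1r subr0.
rewrite (le_trans (ler_normB _ _))// [2 * _]mulrDl mul1r lerD//.
  rewrite (le_trans _ eWl)//; apply: e_norm_le => //; exact: (integB iF (integ_cst _ _)).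
rewrite (le_trans _ eZl)//; apply: e_norm_le => //; exact: (integB ifz (integ_cst _ _)).
Qed.

Section one_function.
Variable h : ('I_d -> R) -> R.
Hypothesis h1 : lip 1 h.

Lemma sm_diff_le (a s : R) (x : 'I_d -> R) : 0 <= a -> a <= 1 -> 0 <= s ->
  `|h x - sm s h (a *: x)| <= (1 - a) * enorm x + s * sd.
Proof.
move=> a0 a1 s0; have [iZ eZl] := eZn.
have ih := integ_s gam_box s (a *: x) (expg_lip h1).
rewrite -[X in X - _](ecst gam) -(eB (integ_cst _ _) ih).
have iB : integ gam (fun z => (1 - a) * enorm x + s * enorm z).
  by apply: integD; [exact: integ_cst|exact: integZ].
apply: (@le_trans _ _ (\int[gam]_z ((1 - a) * enorm x + s * enorm z))).
  apply: e_norm_le => //; first exact: (integB (integ_cst _ _) ih).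
  move=> z; rewrite (le_trans (h1 _ _))// mul1r.
  have -> : x - (a *: x + s *: z) = (1 - a) *: x - s *: z.
    by rewrite scalerBl scale1r opprD addrA.
  rewrite (le_trans (enormD _ _))// enormN !enormZ (ger0_norm s0) ger0_norm// subr_ge0//.
by rewrite (eD (integ_cst _ _) (integZ _ iZ)) ecst (eZ _ iZ) lerD2l ler_wpM2l.
Qed.

Let iM (s a : R) : integ P (fun w => sm s h (a *: W w)).
Proof. exact: (integ_lip_W P n0 mX Xb a ler01 (sm_lip gam_box s ler01 h1)). Qed.

Lemma path_start v0 : 0 < v0 -> v0 < 1 ->
  `|\int[P]_w h (W w) - path_mean h v0| <= 2 * sd * Num.sqrt v0.
Proof.
move=> v00 v01; have [iW eWl] := eW.
set s := Num.sqrt v0; set a := Num.sqrt (1 - v0).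
have s0 : 0 <= s := sqrtr_ge0 _; have a0 : 0 <= a := sqrtr_ge0 _.
have s2 : s ^+ 2 = v0 by rewrite sqr_sqrtr// ltW.
have a2 : a ^+ 2 = 1 - v0 by rewrite sqr_sqrtr// subr_ge0 ltW.
have a1 : a <= 1 by rewrite -ler_sqr ?nnegrE// a2 expr1n gerBl ltW.
have s1 : s <= 1 by rewrite -ler_sqr ?nnegrE// s2 expr1n ltW.
have as1 : 1 - a <= s by nra.
rewrite /path_mean -/s -/a -(eB (integ_lip_W1 ler01 h1) (iM s a)).
have iB : integ P (fun w => (1 - a) * enorm (W w) + s * sd).
  by apply: integD; [exact: integZ|exact: integ_cst].
apply: (@le_trans _ _ (\int[P]_w ((1 - a) * enorm (W w) + s * sd))).
  apply: e_norm_le => //; first exact: (integB (integ_lip_W1 ler01 h1) (iM s a)).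
  by move=> w; exact: sm_diff_le.
rewrite (eD (integZ _ iW) (integ_cst _ _)) ecst (eZ _ iW).
have -> : 2 * sd * s = s * sd + s * sd by ring.
rewrite lerD2r ler_pM ?subr_ge0//.
by apply: Rintegral_ge0 => w _; exact: enorm_ge0.
Qed.

Lemma path_end v1 : 0 < v1 -> v1 < 1 ->
  `|path_mean h v1 - \int[gam]_z h z| <= 2 * sd * Num.sqrt (1 - v1).
Proof.
move=> v10 v11; have [iW eWl] := eW; have [iZ eZl] := eZn.
set s := Num.sqrt v1; set a := Num.sqrt (1 - v1).
have s0 : 0 <= s := sqrtr_ge0 _; have a0 : 0 <= a := sqrtr_ge0 _.
have s2 : s ^+ 2 = v1 by rewrite sqr_sqrtr// ltW.
have a2 : a ^+ 2 = 1 - v1 by rewrite sqr_sqrtr// subr_ge0 ltW.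
have s1 : s <= 1 by rewrite -ler_sqr ?nnegrE// s2 expr1n ltW.
have a1 : a <= 1 by rewrite -ler_sqr ?nnegrE// a2 expr1n gerBl ltW.
have sa : 1 - s <= a by nra.
rewrite /path_mean -/s -/a -[X in _ - X](ecst P) -(eB (iM s a) (integ_cst _ _)).
have iB : integ P (fun w => a * enorm (W w) + a * sd).
  by apply: integD; [exact: integZ|exact: integ_cst].
apply: (@le_trans _ _ (\int[P]_w (a * enorm (W w) + a * sd))).
  apply: e_norm_le => //; first exact: (integB (iM s a) (integ_cst _ _)).
  move=> w; have ih := integ_s gam_box s (a *: W w) (expg_lip h1).
  have iz := ig (expg_lip h1). have s1' : 0 <= 1 - s by rewrite subr_ge0.
  rewrite -(eB ih iz).
  have iC : integ gam (fun z => a * enorm (W w) + (1 - s) * enorm z).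
    by apply: integD; [exact: integ_cst|exact: integZ].
  apply: (@le_trans _ _ (\int[gam]_z (a * enorm (W w) + (1 - s) * enorm z))).
    apply: e_norm_le => //; first exact: (integB ih iz).
    move=> z; rewrite (le_trans (h1 _ _))// mul1r.
    have -> : a *: W w + s *: z - z = a *: W w - (1 - s) *: z.
      by rewrite scalerBl scale1r opprB addrA.
    rewrite (le_trans (enormD _ _))// enormN !enormZ (ger0_norm a0) (ger0_norm s1')//.
  rewrite (eD (integ_cst _ _) (integZ _ iZ)) ecst (eZ _ iZ) lerD2l ler_pM ?subr_ge0//.
  by apply: Rintegral_ge0 => z _; exact: enorm_ge0.
rewrite (eD (integZ _ iW) (integ_cst _ _)) ecst (eZ _ iW).
have -> : 2 * sd * a = a * sd + a * sd by ring.
by rewrite lerD2r ler_wpM2l.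
Qed.

(** [Bf] plays the primitive of [bet (sqrt v)], with O(e^3) slack per step. Of the two cuts of the
    path, the one at [v1] is pushed to 1 and the one at [v0] stays as the first term of the
    bound. *)
Lemma gap_le (bet Bf : R -> R) (v0 Cst K' : R) : 0 < v0 -> v0 < 1 -> 0 <= K' ->
  (forall s, 0 < s -> 0 <= bet s) ->
  (forall (a s : R) i Phi m, 0 < a -> a <= 1 -> 0 < s -> 1 / 2 <= a ^+ 2 + s ^+ 2 ->
    kfun gam Phi m -> 0 <= m -> measurable_fun setT (Phi s h) ->
    `|\int[P]_w Phi s h (a *: oth i w)| <= m * bet s) ->
  (forall v e, v0 <= v -> 0 <= e -> e ^+ 2 <= 1 / 2 ->
    bet (Num.sqrt v) * e ^+ 2 <= Bf (v + e ^+ 2) - Bf v + K' * e ^+ 3) ->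
  (forall v1, v0 <= v1 -> v1 < 1 -> Bf v1 - Bf v0 <= Cst) ->
  `|gap h| <= 2 * sd * Num.sqrt v0 + 2 * delta * d%:R * Cst.
Proof.
move=> v00 v01 K'0 bet0 Hbet Bstep BC.
have dd : 0 <= 2 * delta * d%:R := mulr_ge0 (mulr_ge0 (ler0n _ 2) delta_ge0) (ler0n _ _).
apply/ler_addgt0Pr => eps eps0.
(* [v1 = 1 - t^2] makes the right end cost [2 * sd * t <= eps]. *)
pose t := Num.min (1 - v0) (eps / (2 * sd)) / 2.
have s2 : 0 < 2 * sd by rewrite mulr_gt0.
have m0 : 0 < Num.min (1 - v0) (eps / (2 * sd)) by rewrite lt_min subr_gt0 v01 divr_gt0.
have t0 : 0 < t by rewrite divr_gt0.
have tm : t <= Num.min (1 - v0) (eps / (2 * sd)) by rewrite /t; lra.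
have t1 : t <= 1 - v0 by rewrite (le_trans tm)// ge_min lexx.
have t2 : t * (2 * sd) <= eps by rewrite -ler_pdivlMr// (le_trans tm)// ge_min lexx orbT.
pose v1 := 1 - t ^+ 2.
have tt : t ^+ 2 <= t by rewrite expr2 ler_piMl ?(ltW t0)//; lra.
have v0v1 : v0 <= v1 by rewrite /v1; lra.
have v11 : v1 < 1 by rewrite /v1 gtrBl exprn_gt0.
have v1E : Num.sqrt (1 - v1) = t.
  have -> : 1 - v1 = t ^+ 2 by rewrite /v1; ring.
  by rewrite sqrtr_sqr gtr0_norm.
have hs := path_start v00 v01.
have he := path_end (lt_le_trans v00 v0v1) v11; rewrite v1E in he.
have [K K0 Kstep] := path_step gam_box n0 mX iX Xb X0 Xcov h1 v00 v11 bet0 Hbet.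
have hm : `|path_mean h v1 - path_mean h v0| <= 2 * delta * d%:R * Bf v1 - 2 * delta * d%:R * Bf v0.
  apply: (telescope_le (B := fun v => 2 * delta * d%:R * Bf v) v0v1 (addr_ge0 (mulr_ge0 dd K'0) K0)).
  move=> v e v0v e0 vev1 e12; rewrite (le_trans (Kstep v e v0v e0 vev1 e12))//.
  rewrite [X in _ <= _ + X]mulrDl addrA lerD2r -mulrBr -[X in _ <= _ + X]mulrA -mulrDr -mulrA.
  by rewrite ler_wpM2l// Bstep.
have hc : 2 * delta * d%:R * Bf v1 - 2 * delta * d%:R * Bf v0 <= 2 * delta * d%:R * Cst.
  by rewrite -mulrBr ler_wpM2l// BC.
have -> : gap h = (\int[P]_w h (W w) - path_mean h v0) - (path_mean h v1 - path_mean h v0) + (path_mean h v1 - \int[gam]_z h z).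
  by rewrite [in RHS]opprB subrKA subrKA.
rewrite (le_trans (ler_normD _ _))// lerD//; last by rewrite (le_trans he)// mulrC.
rewrite (le_trans (ler_normB _ _))// lerD//.
exact: le_trans hm hc.
Qed.

Let oth_W i w : enorm (oth i w - W w) <= delta.
Proof.
have -> : oth i w - W w = - xi i w.
  have -> : W w = xi i w + oth i w by rewrite /xi /oth summand_others.
  by rewrite opprD addrCA subrr addr0.
by rewrite enormN; exact: summand_le.
Qed.

Let moth i : measurable_fun setT (oth i). Proof. exact: measurable_others. Qed.

(** The pointwise bound on Phi gives [bet s = s^-2], hence [1 / v] along the path, with primitive
    [ln]. *)
Lemma gap_log v0 : 0 < v0 -> v0 < 1 ->
  `|gap h| <= 2 * sd * Num.sqrt v0 + 2 * delta * d%:R * (- ln v0).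
Proof.
move=> v00 v01; apply: (@gap_le (fun s => s ^- 2) (@ln R) _ _ (v0 ^- 2)) => //.
- by rewrite invr_ge0 sqr_ge0.
- by move=> s s0; rewrite invr_ge0 sqr_ge0.
- move=> a s i Phi m a0 a1 s0 _ [Pb _ _ _] m0 mP.
  have bd w : `|Phi s h (a *: oth i w)| <= m * s ^- 2.
    by have := Pb s h 1 (a *: oth i w) s0 ler01 h1; rewrite mul1r.
  apply: e_norm_cst => //; apply: (integ_bounded _ _ bd).
  exact: (measurableT_comp mP (measurable_vecZ a (moth i))).
- move=> v e v0v e0 e12; rewrite mulrC.
  have vp : 0 < v by exact: lt_le_trans v0v.
  by rewrite sqr_sqrtr ?(ltW vp)//; exact: ln_step.
- move=> v1 v0v1 v11; rewrite gerDr ln_le0// ltW//.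
Qed.

(** The mean of Phi at [oth i] is its Gaussian mean, at most [2 * m] because [a^2 + s^2 >= 1 / 2],
    plus the Lipschitz constant [3 * m / s^3] times [kap + delta]: [kap] for passing from the
    Gaussian to [W], [delta] for passing from [W] to [oth i]. *)
Lemma gap_self kap v0 : 0 < v0 -> v0 < 1 -> 0 <= kap ->
  (forall f, lip 1 f -> `|gap f| <= kap) ->
  `|gap h| <= 2 * sd * Num.sqrt v0 + 2 * delta * d%:R * (2 + 6 * (kap + delta) / Num.sqrt v0).
Proof.
move=> v00 v01 kap0 Hk; set k' := kap + delta.
have k'0 : 0 <= k' := addr_ge0 kap0 delta_ge0.
have gapL L f : 0 <= L -> lip L f -> `|gap f| <= L * kap.
  move=> L0 fL; have [L00|Ln0] := eqVneq L 0.
    have fc x : f x = f 0.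
      have := fL x 0; rewrite L00 mul0r normr_le0 subr_eq0 => /eqP; exact.
    rewrite /gap; under eq_Rintegral do rewrite fc.
    under [X in _ - X]eq_Rintegral do rewrite fc.
    by rewrite !ecst subrr normr0 L00 mul0r.
  have Lp : 0 < L by rewrite lt_neqAle eq_sym Ln0.
  have f1 : lip 1 (fun x => L^-1 * f x).
    move=> x y; rewrite -mulrBr normrM gtr0_norm ?invr_gt0// mul1r mulrC ler_pdivrMr// mulrC.
    exact: fL.
  have := Hk _ f1.
  rewrite /gap (eZ _ (integ_lip_W1 L0 fL)) (eZ _ (ig (expg_lip fL))) -mulrBr normrM.
  by rewrite gtr0_norm ?invr_gt0// mulrC ler_pdivrMr// mulrC.
apply: (@gap_le (fun s => 2 + 3 * k' / s ^+ 3) (fun v => 2 * v - 6 * k' / Num.sqrt v) _ _ (3 * k' * Num.sqrt v0 ^- 5)) => //.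
- by rewrite mulr_ge0 ?invr_ge0 ?exprn_ge0 ?sqrtr_ge0// mulr_ge0.
- by move=> s s0; rewrite addr_ge0// divr_ge0 ?exprn_ge0 ?(ltW s0)// mulr_ge0.
- move=> a s i Phi m a0 a1 s0 as1 kP m0 mP.
  pose L := 3 * m / s ^+ 3.
  have L0 : 0 <= L by rewrite divr_ge0 ?exprn_ge0 ?(ltW s0)// mulr_ge0.
  have PL : lip L (Phi s h) := kfun_lip gam_box kP m0 s0 h1.
  have fL : lip L (fun y => Phi s h (a *: y)).
    move=> x y; rewrite (le_trans (PL _ _))// ler_wpM2l// -scalerBr enormZ (gtr0_norm a0).
    by rewrite ler_piMl ?enorm_ge0.
  have io : integ P (fun w => Phi s h (a *: oth i w)).
    have [Pb _ _ _] := kP.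
    have bd w : `|Phi s h (a *: oth i w)| <= m * s ^- 2.
      by have := Pb s h 1 (a *: oth i w) s0 ler01 h1; rewrite mul1r.
    apply: (integ_bounded _ _ bd).
    exact: (measurableT_comp mP (measurable_vecZ a (moth i))).
  have iWf := integ_lip_W1 L0 fL.
  have e1 : `|\int[P]_w Phi s h (a *: oth i w) - \int[P]_w Phi s h (a *: W w)| <= L * delta.
    rewrite -(eB io iWf); apply: e_norm_cst; first exact: (integB io iWf).
    by move=> w; rewrite (le_trans (fL _ _))// ler_wpM2l.
  have e2 := gapL _ _ L0 fL.
  have e3 : `|\int[gam]_z Phi s h (a *: z)| <= m * 2.
    rewrite (le_trans (kfun_gauss kP a0 s0 h1))// ler_wpM2l//.
    rewrite -[leRHS]invrK lef_pV2 ?posrE ?invr_gt0//; first by rewrite -div1r.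
    by rewrite addr_gt0// exprn_gt0.
  have -> : \int[P]_w Phi s h (a *: oth i w) = (\int[P]_w Phi s h (a *: oth i w) - \int[P]_w Phi s h (a *: W w))
     + gap (fun y => Phi s h (a *: y)) + \int[gam]_z Phi s h (a *: z) by rewrite /gap; ring.
  have -> : m * (2 + 3 * k' / s ^+ 3) = L * delta + L * kap + m * 2.
    by rewrite /L /k'; ring.
  by rewrite (le_trans (ler_normD _ _))// lerD// (le_trans (ler_normD _ _))// lerD.
- move=> v e v0v e0 e12; have := sqrt_step v00 v0v e0 e12.
  move=> /(ler_wpM2l (mulr_ge0 (ler0n R 3) k'0)) H.
  rewrite mulrDl.
  have -> : 3 * k' / Num.sqrt v ^+ 3 * e ^+ 2 = 3 * k' * (e ^+ 2 / Num.sqrt v ^+ 3) by ring.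
  rewrite (le_trans (lerD (lexx _) H))// le_eqVlt; apply/orP; left; apply/eqP; ring.
- move=> v1 v0v1 v11.
  have s0p : 0 < Num.sqrt v0 by rewrite sqrtr_gt0.
  have : 0 <= 6 * k' / Num.sqrt v1 by rewrite divr_ge0 ?sqrtr_ge0// mulr_ge0.
  lra.
Qed.
End one_function.

(** For [sqrt v0 = s0 = 24 * delta * d] the self-referential term of [gap_self] becomes half of
    [kappa + delta], where [kappa = sup S] is finite, and is absorbed on the left. What remains is
    at most [(96 + 8 + 1) * d^2 * delta]. *)
Lemma gap_dim f : lip 1 f -> `|gap f| <= 106 * d%:R ^+ 2 * delta.
Proof.
move=> f1; have dp : 1 <= d%:R :> R by rewrite ler1n.
have sdd : sd <= d%:R.
  by rewrite -ler_sqr ?nnegrE ?(ltW sd0)// sd2 expr2 ler_peMl.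
have dl := delta_ge0.
pose s0 : R := 24 * delta * d%:R.
have s0p : 0 <= s0 := mulr_ge0 (mulr_ge0 (ler0n R 24) dl) (ler0n R d).
have dd : d%:R <= d%:R ^+ 2 :> R by rewrite expr2 ler_peMl.
(* When [s0 >= 1] the value [s0^2] is not an admissible [v0], but then the trivial bound is below
   [48 * d^2 * delta]. *)
have [s1|s1] := leP 1 s0.
  rewrite (le_trans (gap_trivial f1))//.
  apply: (@le_trans _ _ (2 * d%:R * s0)).
    apply: (@le_trans _ _ (2 * d%:R)); first by rewrite ler_wpM2l.
    by rewrite ler_peMr// mulr_ge0.
  have -> : 2 * d%:R * s0 = 48 * (d%:R ^+ 2 * delta) by rewrite /s0; ring.
  have q0 : 0 <= d%:R ^+ 2 * delta := mulr_ge0 (exprn_ge0 2 (ler0n R d)) dl.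
  by rewrite -[leRHS]mulrA ler_wpM2r// ler_nat.
pose S := [set x | exists2 g, lip 1 g & x = `|gap g|].
have S0 : S !=set0 by exists `|gap f|, f.
have Sub : has_ubound S by exists (2 * sd) => _ [g g1 ->]; exact: gap_trivial.
have hS : has_sup S by split.
have gk g : lip 1 g -> `|gap g| <= sup S by move=> g1; apply: ub_le_sup => //; exists g.
have k0 : 0 <= sup S by exact: le_trans (normr_ge0 _) (gk f f1).
have delp : 0 < delta.
  rewrite lt_neqAle dl andbT; apply/eqP => de.
  by have := sqrt_dim_le_delta; rewrite -de mul0r leNgt sd0.
have s0pp : 0 < s0.
  apply: mulr_gt0; last exact: lt_le_trans ltr01 dp.
  by apply: mulr_gt0; rewrite // ltr0n.
have v00 : 0 < s0 ^+ 2 by rewrite exprn_gt0.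
have v01 : s0 ^+ 2 < 1 by rewrite expr_lt1.
have sE : Num.sqrt (s0 ^+ 2) = s0 by rewrite sqrtr_sqr gtr0_norm.
have : sup S <= 2 * sd * s0 + 4 * delta * d%:R + (sup S + delta) / 2.
  apply: ge_sup => // _ [g g1 ->].
  have := gap_self g1 v00 v01 k0 gk; rewrite sE => H; rewrite (le_trans H)//.
  suff -> : 2 * delta * d%:R * (2 + 6 * (sup S + delta) / s0) = 4 * delta * d%:R + (sup S + delta) / 2.
    by rewrite addrA.
  have : delta * d%:R != 0 by rewrite mulf_neq0 ?(gt_eqF delp)// gt_eqF// (lt_le_trans ltr01 dp).
  rewrite /s0 -!(mulrA _ delta); move: (delta * d%:R) (sup S + delta) => q y q0.
  by field.
move=> H; rewrite (le_trans (gk f f1))//.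
have h1 : 2 * sd * s0 <= 48 * (d%:R ^+ 2 * delta).
  have -> : 48 * (d%:R ^+ 2 * delta) = 2 * d%:R * s0 by rewrite /s0; ring.
  by rewrite ler_wpM2r// ler_wpM2l.
have h2 : delta * d%:R <= d%:R ^+ 2 * delta by rewrite mulrC ler_wpM2r.
have h3 : delta <= d%:R ^+ 2 * delta by rewrite ler_peMl// (le_trans dp).
have -> : 106 * d%:R ^+ 2 * delta = 106 * (d%:R ^+ 2 * delta) by ring.
move: H h1 h2 h3; set q := d%:R ^+ 2 * delta.
have -> : 4 * delta * d%:R = 4 * (delta * d%:R) by ring.
lra.
Qed.

(** Take [v0 = 1 / n] in [gap_log]: the start costs [2 * sd / sqrt n <= 2 * delta], and [- ln v0] is
    [ln n]. The constant is the one of [gap_dim], so that a single constant serves both bounds. *)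
Lemma gap_logn f : lip 1 f -> `|gap f| <= 106 * d%:R * delta * (1 + ln n%:R).
Proof.
move=> f1; have dp : 1 <= d%:R :> R by rewrite ler1n.
have dl := delta_ge0; have sdl := sqrt_dim_le_delta.
have dld : delta <= d%:R * delta by rewrite ler_peMl.
have dd0 : 0 <= d%:R * delta := mulr_ge0 (ler0n _ _) dl.
have ln0 : 0 <= ln (n%:R : R) by rewrite ln_ge0// ler1n.
(* For [n = 1] the choice [v0 = 1 / n] is not below 1; in that case [sd <= delta] and the trivial
   bound is enough. *)
have [n1|n1] := leqP n 1.
  have nE : n = 1%N by apply/eqP; rewrite eqn_leq n1 n0.
  have s1 : Num.sqrt (n%:R : R) = 1 by rewrite nE sqrtr1.
  rewrite s1 mulr1 in sdl.
  rewrite (le_trans (gap_trivial f1))// nE ln1 addr0 mulr1 -mulrA; lra.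
have nR : 1 < n%:R :> R by rewrite ltr1n.
have np : 0 < n%:R :> R by rewrite (lt_trans ltr01).
have v00 : 0 < (n%:R : R)^-1 by rewrite invr_gt0.
have v01 : (n%:R : R)^-1 < 1 by rewrite invf_lt1.
rewrite (le_trans (gap_log f1 v00 v01))// lnV ?posrE// opprK.
have hs : sd * Num.sqrt (n%:R)^-1 <= delta.
  by rewrite sqrtrV ?(ltW np)// ler_pdivrMr.
have -> : 2 * sd * Num.sqrt (n%:R)^-1 = 2 * (sd * Num.sqrt (n%:R)^-1) by ring.
have -> : 2 * delta * d%:R * ln n%:R = 2 * (d%:R * delta * ln n%:R) by ring.
have -> : 106 * d%:R * delta * (1 + ln n%:R) = 106 * (d%:R * delta) + 106 * (d%:R * delta * ln n%:R) by ring.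
have : 0 <= d%:R * delta * ln n%:R by rewrite mulr_ge0.
move: hs dld dd0; lra.
Qed.
End wasserstein_gap.

(** * Reduction to bounded summands and to the law of Z *)

Section clip.
Variables (R : realType) (d : nat) (b : R).

(** The summands are bounded only almost surely, whereas the estimates above use a pointwise bound.
    Clipping acts on each vector by a measurable map, so independence survives, and almost surely it
    changes nothing. *)
Definition clip (x : 'I_d -> R) : 'I_d -> R := if enorm x <= b then x else 0.

Lemma measurable_clip : measurable_fun setT clip.
Proof.
apply: measurable_fun_ifT => //.
by apply: measurable_fun_ler; [exact: measurable_enorm|exact: measurable_cst].
Qed.

Lemma clip_le x : 0 <= b -> enorm (clip x) <= b.
Proof. by move=> b0; rewrite /clip; case: ifPn => // _; rewrite enorm0. Qed.

End clip.

Section independence_image.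
Context dT (T : measurableType dT) (R : realType) (n d : nat).

Lemma gen_sigma_preimage (X : 'I_d -> T -> R) (A : set ('I_d -> R)) : measurable A ->
  gen_sigma X ((fun w k => X k w) @^-1` A).
Proof.
move=> mA; pose G := [set A | exists k B, measurable B /\ A = X k @^-1` B].
have mf : measurable_fun (setT : set (g_sigma_algebraType G)) (fun w k => X k w).
  apply/measurable_vecP => k _ C mC; rewrite setTI.
  by apply: sub_sigma_algebra; exists k, C.
by have := mf measurableT A mA; rewrite setTI.
Qed.

Lemma indep_vectors_image (P : probability T R) (X : 'I_n -> 'I_d -> T -> R)
    (g : 'I_n -> ('I_d -> R) -> 'I_d -> R) :
  (forall i, measurable_fun setT (g i)) -> indep_vectors P X ->
  indep_vectors P (fun i k w => g i (fun l => X i l w) k).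
Proof.
move=> mg iX A gA; apply: iX => i; have := gA i.
apply: smallest_sub; first exact: smallest_sigma_algebra.
move=> _ [k [B [mB ->]]].
have mgk := measurableT_comp (measurable_coord k) (mg i).
have := mgk measurableT B mB; rewrite setTI => /(@gen_sigma_preimage (X i) _).
exact.
Qed.
End independence_image.

Section normal_law.
Context dT (T : measurableType dT) (R : realType) (Q : probability T R) (d : nat).
Variable Z : 'I_d -> T -> R.
Hypothesis hZ : std_normal_vector Q Z.

Let zf (y : T) : 'I_d -> R := fun k => Z k y.
Let mzf : measurable_fun setT zf.
Proof. by apply/measurable_vecP => k; case: hZ => mZ _ _; exact: mZ. Qed.
HB.instance Definition _ := isMeasurableFun.Build _ _ _ _ zf mzf.

(** The measure [gam] of the preceding sections; its values on boxes come from the independence and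
    the normal marginals of the coordinates of Z. *)
Definition law : probability ('I_d -> R) R := distribution Q zf.

Lemma law_box B : (forall k, measurable (B k)) ->
  law (box B) = (\prod_k (@normal_prob R 0 1) (B k))%E.
Proof.
case: hZ => mZ iZ nZ mB.
have := iZ (fun k => Z k @^-1` B k).
have -> : \bigcap_k (Z k @^-1` B k) = zf @^-1` box B.
  by apply/seteqP; split => y /= h k => [|_]; exact: h.
move=> QE; rewrite [LHS]QE; last by move=> k; apply: sub_sigma_algebra; exists ord0, (B k).
by apply: eq_bigr => k _; exact: nZ.
Qed.

Lemma integral_law L h : lip L h ->
  (\int[Q]_y (h (fun k => Z k y))%:E)%E = (\int[law]_z (h z))%:E.
Proof.
move=> hL; have mh := lip_measurable hL.
have ih : integ law h by apply: (expg_integ law_box); exact: (expg_lip hL).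
have mE : measurable_fun setT (EFin \o h) by exact/measurable_EFinP.
rewrite (EFin_e ih) integral_distribution//.
apply/integrableP; split; first exact: (measurableT_comp mE mzf).
have /integrableP[_] := ih.
rewrite ge0_integral_distribution//.
exact: (measurableT_comp (@abse_measurable R setT) mE).
Qed.
End normal_law.

Section almost_surely_bounded.
Context (R : realType) (d n : nat) (beta : R).
Context dT (T : measurableType dT) (P : probability T R) (X : 'I_n -> 'I_d -> T -> R).
Context dT' (T' : measurableType dT') (Q : probability T' R) (Z : 'I_d -> T' -> R).
Hypotheses (n0 : (0 < n)%N) (mX : forall i k, measurable_fun setT (X i k))
  (iX : indep_vectors P X)
  (X0 : forall i k, (\int[P]_x (X i k x)%:E = 0)%E)
  (Xb : forall i, {ae P, forall x, enorm (fun k => X i k x) <= beta})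
  (Xcov : forall k l, (\int[P]_x (Wsum X x k * Wsum X x l)%:E = (if k == l then 1 else 0)%:E)%E)
  (hZ : std_normal_vector Q Z).

Let beta0 : 0 <= beta.
Proof.
have PF : ProperFilter (almost_everywhere P).
  by apply: ae_properfilter_algebraOfSetsType; rewrite [ltRHS]probability_setT.
have [w] := @filter_ex _ _ PF _ (Xb (Ordinal n0)).
exact: le_trans (enorm_ge0 _).
Qed.

Let Xc (i : 'I_n) (k : 'I_d) (w : T) : R := clip beta (fun l => X i l w) k.

Let mXc i k : measurable_fun setT (Xc i k).
Proof.
have m : measurable_fun setT (fun w l => X i l w) by apply/measurable_vecP.
exact: (measurableT_comp (measurable_coord k) (measurableT_comp (measurable_clip beta) m)).
Qed.

Let Xcb i w : enorm (fun k => Xc i k w) <= beta.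
Proof. exact: clip_le. Qed.

Let iXc : indep_vectors P Xc.
Proof. by apply: (indep_vectors_image (g := fun=> clip beta)) => // _; exact: measurable_clip. Qed.

Let ae_integral (f g : T -> R) : measurable_fun setT f -> measurable_fun setT g ->
  (forall w, (forall i k, X i k w = Xc i k w) -> f w = g w) ->
  (\int[P]_w (f w)%:E = \int[P]_w (g w)%:E)%E.
Proof.
move=> mf mg fg; apply: ae_eq_integral => //; [exact/measurable_EFinP|exact/measurable_EFinP|].
apply: filterS (filter_forall _ Xb) => w wb _; congr EFin.
by apply: fg => i k; rewrite /Xc /clip wb.
Qed.

Let mW : measurable_fun setT (Wsum X). Proof. exact: measurable_W. Qed.
Let mWc : measurable_fun setT (Wsum Xc). Proof. exact: measurable_W. Qed.

Let W_eq w : (forall i k, X i k w = Xc i k w) -> Wsum X w = Wsum Xc w.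
Proof.
move=> Xw; apply/funext => k; rewrite /Wsum; congr (_ * _).
by apply: eq_bigr => i _; exact: Xw.
Qed.

Let Xc0 i k : \int[P]_w Xc i k w = 0.
Proof. by rewrite /Rintegral -(ae_integral (mX i k)) ?X0. Qed.

Let Xccov k l : \int[P]_w (Wsum Xc w k * Wsum Xc w l) = (k == l)%:R.
Proof.
have m (V : T -> 'I_d -> R) (mV : measurable_fun setT V) : measurable_fun setT (fun w => V w k * V w l).
  by apply: measurable_funM; exact: (measurableT_comp (measurable_coord _) mV).
rewrite /Rintegral -(ae_integral (m _ mW) (m _ mWc)) => [|w /W_eq -> //].
by rewrite Xcov; case: eqP.
Qed.

Lemma wasserstein_le (c : R) : (forall h, lip 1 h -> `|gap (law hZ) P Xc h| <= c) ->
  (wasserstein P (Wsum X) Q (fun y k => Z k y) <= c%:E)%E.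
Proof.
move=> Hc; apply: ge_ereal_sup => _ [h hl <-].
have h1 : lip 1 h by move=> x y; rewrite mul1r; exact: hl.
have mh := lip_measurable h1.
rewrite (integral_law hZ h1).
rewrite (ae_integral (measurableT_comp mh mW) (measurableT_comp mh mWc)) => [|w /W_eq /= -> //].
rewrite -EFin_e; first by rewrite -EFinB lee_fin; exact: Hc.
have := integ_lip_W P n0 mXc Xcb 1 ler01 h1.
by congr integ; apply/funext => w; rewrite scale1r.
Qed.

(** R^0 is a single point. This case is treated apart because the gap estimates are stated for
    positive dimension. *)
Let gap_dim0 h : d = 0%N -> lip 1 h -> gap (law hZ) P Xc h = 0.
Proof.
move=> dE hl.
have hc x : h x = h 0 by congr h; apply/funext => k; have := ltn_ord k; rewrite [X in (_ < X)%N]dE.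
rewrite /gap; under eq_Rintegral do rewrite hc.
by under [X in _ - X]eq_Rintegral do rewrite hc; rewrite !ecst subrr.
Qed.

Lemma wasserstein_logn :
  (wasserstein P (Wsum X) Q (fun y k => Z k y)
     <= (106 * d%:R * beta / Num.sqrt n%:R * (1 + ln n%:R))%:E)%E.
Proof.
apply: wasserstein_le => h h1; have [d0|d0] := posnP d.
  by rewrite gap_dim0// normr0 [X in _ * X%:R]d0 mulr0 !mul0r.
rewrite -[_ * beta / _]mulrA.
exact: (gap_logn (law_box hZ) n0 mXc iXc Xcb Xc0 Xccov d0 h1).
Qed.

Lemma wasserstein_dim :
  (wasserstein P (Wsum X) Q (fun y k => Z k y)
     <= (106 * d%:R ^+ 2 * beta / Num.sqrt n%:R)%:E)%E.
Proof.
apply: wasserstein_le => h h1; have [d0|d0] := posnP d.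
  by rewrite gap_dim0// normr0 [X in X%:R ^+ 2]d0 expr0n/= mulr0 !mul0r.
rewrite -[_ * beta / _]mulrA.
exact: (gap_dim (law_box hZ) n0 mXc iXc Xcb Xc0 Xccov d0 h1).
Qed.

End almost_surely_bounded.

Theorem theoremB1 (R : realType) :
  exists C : R, 0 < C /\
  forall (d n : nat) (beta : R)
    (dT : measure_display) (T : measurableType dT) (P : probability T R)
    (X : 'I_n -> 'I_d -> T -> R)
    (dT' : measure_display) (T' : measurableType dT') (Q : probability T' R)
    (Z : 'I_d -> T' -> R),
  (0 < n)%N ->
  (forall i k, measurable_fun setT (X i k)) ->
  indep_vectors P X ->
  (forall i k, (\int[P]_x (X i k x)%:E = 0)%E) ->
  (forall i, {ae P, forall x, enorm (fun k => X i k x) <= beta}) ->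
  (forall k l, (\int[P]_x (Wsum X x k * Wsum X x l)%:E
                 = (if k == l then 1 else 0)%:E)%E) ->
  std_normal_vector Q Z ->
  (wasserstein P (Wsum X) Q (fun y k => Z k y)
     <= (C * d%:R * beta / Num.sqrt n%:R * (1 + ln n%:R))%:E)%E /\
  (wasserstein P (Wsum X) Q (fun y k => Z k y)
     <= (C * d%:R ^+ 2 * beta / Num.sqrt n%:R)%:E)%E.
Proof.
exists 106; split; first by rewrite ltr0n.
move=> d n beta dT T P X dT' T' Q Z n0 mX iX X0 Xb Xcov hZ; split.
  exact: wasserstein_logn.
exact: wasserstein_dim.
Qed.
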